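(* Let $(\mathcal{X},g)$ be a closed Riemannian manifold of dimension at least two, with induced metric $d$. Let $H(\mathcal{X})$ be the space of homeomorphisms of $\mathcal{X}$ with the $C^0$ (uniform) topology. The set $$A=\{F\in H(\mathcal{X}):\overline{mdim}(\mathcal{X},d,F)=\dim(\mathcal{X})\}$$ is dense in the subspace of homeomorphisms with a fixed point, i.e. every $F\in H(\mathcal{X})$ having a fixed point is a limit of elements of $A$. The set $$B=\{F\in H(\mathcal{X}):\overline{mdim}(\mathcal{X},d,F)>0\}$$ is dense in $H(\mathcal{X})$.
   Context: For a continuous map $F$ of a compact metric space $(\mathcal{X},d)$ let $d_n(x,y)=\max_{0\le k\le n-1}d(F^kx,F^ky)$. A set is $(n,\epsilon)$-separated if $d_n(x,y)>\epsilon$ for all distinct $x,y$ in it. $N_d(n,\epsilon)$ is the maximal cardinality of an $(n,\epsilon)$-separated subset of $\mathcal{X}$, $S(\mathcal{X},d,\epsilon)=\limsup_{n\to\infty}\frac1n\log N_d(n,\epsilon)$, and the upper metric mean dimension is $\overline{mdim}(\mathcal{X},d,F)=\limsup_{\epsilon\to0}\frac{S(\mathcal{X},d,\epsilon)}{|\log\epsilon|}$. A closed manifold is a compact manifold without boundary. *)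

(* Defs.v *)
From HB Require Import structures.
From mathcomp Require Import all_boot all_order all_algebra.
From mathcomp Require Import all_classical all_reals all_analysis.

Set Implicit Arguments.
Unset Strict Implicit.
Unset Printing Implicit Defensive.

Import Order.TTheory GRing.Theory Num.Theory.
Import numFieldNormedType.Exports.

Local Open Scope classical_set_scope.
Local Open Scope ring_scope.

Section Smoothness.
Context {R : realType} {n : nat} {V : normedModType R}.

(* For U open: all iterated partial derivatives of f of order at most k exist
   and are continuous on U. *)
Fixpoint Ck_on (k : nat) (U : set 'rV[R]_n) (f : 'rV[R]_n -> V) : Prop :=
  {in U, continuous f} /\
  match k with
  | 0%N => True
  | k'.+1 => forall i : 'I_n,
      (forall x, U x -> derivable f x (delta_mx 0 i)) /\
      Ck_on k' U (fun x => 'D_(delta_mx 0 i) f x)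
  end.

Definition smooth_on (U : set 'rV[R]_n) (f : 'rV[R]_n -> V) : Prop :=
  forall k, Ck_on k U f.

End Smoothness.

(* chart_map and chart_inv are total functions; only their values on chart_dom
   and on chart_img respectively are meaningful. *)
Record chart (R : realType) (n : nat) (X : topologicalType) := Chart {
  chart_dom : set X ;
  chart_map :> X -> 'rV[R]_n ;
  chart_inv : 'rV[R]_n -> X ;
  chart_dom_open : open chart_dom ;
  chart_img_open : open (chart_map @` chart_dom) ;
  chart_mapK : {in chart_dom, cancel chart_map chart_inv} ;
  chart_map_continuous : {in chart_dom, continuous chart_map} ;
  chart_inv_continuous : {in chart_map @` chart_dom, continuous chart_inv}
}.

Definition chart_img (R : realType) (n : nat) (X : topologicalType)
  (c : chart R n X) : set 'rV[R]_n := c @` chart_dom c.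

Definition transition (R : realType) (n : nat) (X : topologicalType)
  (c1 c2 : chart R n X) : 'rV[R]_n -> 'rV[R]_n := c2 \o chart_inv c1.

(* Smooth n-dimensional Riemannian structure without boundary on X.  The metric
   tensor is given by its Gram matrices in the charts of the atlas; vectors are
   rows, so the differential of a transition map acts by v |-> v *m 'J. *)
Record riemannian_structure (R : realType) (n : nat) (X : topologicalType) :=
  RiemannianStructure {
  atlas : set (chart R n X) ;
  chart_at : X -> chart R n X ;
  chart_at_atlas : forall x, atlas (chart_at x) ;
  chart_at_dom : forall x, chart_dom (chart_at x) x ;
  transition_smooth : forall c1 c2, atlas c1 -> atlas c2 ->
    smooth_on (c1 @` (chart_dom c1 `&` chart_dom c2)) (transition c1 c2) ;
  gram : chart R n X -> 'rV[R]_n -> 'M[R]_n ;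
  gram_smooth : forall c, atlas c -> smooth_on (chart_img c) (gram c) ;
  gram_sym : forall c x, atlas c -> chart_img c x -> (gram c x)^T = gram c x ;
  gram_posdef : forall c x (v : 'rV[R]_n), atlas c -> chart_img c x -> v != 0 ->
    0 < (v *m gram c x *m v^T) 0 0 ;
  gram_transition : forall c1 c2 x, atlas c1 -> atlas c2 ->
    (c1 @` (chart_dom c1 `&` chart_dom c2)) x ->
    let J := jacobian (transition c1 c2) x in
    gram c1 x = J *m gram c2 (transition c1 c2 x) *m J^T
}.

Section RiemannianDistance.
Context {R : realType} {n : nat} {X : topologicalType}.
Variable g : riemannian_structure R n X.

Definition C1_curve_on (U : set R) (gamma : R -> X) : Prop :=
  {in U, continuous gamma} /\
  forall c t, atlas g c -> U t -> chart_dom c (gamma t) ->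
    derivable (c \o gamma) t 1 /\ {for t, continuous (derive1 (c \o gamma))}.

(* C^1 up to the endpoints, i.e. extending as a C^1 curve to a neighbourhood. *)
Definition C1_segment (gamma : R -> X) : Prop :=
  exists U : set R, [/\ open U, `[0, 1] `<=` U & C1_curve_on U gamma].

Definition speed (gamma : R -> X) (t : R) : R :=
  let c := chart_at g (gamma t) in
  let v := derive1 (c \o gamma) t in
  Num.sqrt ((v *m gram g c (c (gamma t)) *m v^T) 0 0).

Definition segment_length (gamma : R -> X) : \bar R :=
  (\int[lebesgue_measure]_(t in `[0%R, 1%R]) (speed gamma t)%:E)%E.

(* A piecewise C^1 curve from x to y is a finite concatenation of C^1 segments,
   each of them parametrized by [0, 1]. *)
Fixpoint piecewise_C1_path (x y : X) (s : seq (R -> X)) : Prop :=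
  match s with
  | [::] => x = y
  | gamma :: s' =>
      [/\ C1_segment gamma, gamma 0 = x & piecewise_C1_path (gamma 1) y s']
  end.

Definition path_length (s : seq (R -> X)) : \bar R :=
  (\sum_(gamma <- s) segment_length gamma)%E.

Definition riemannian_dist (x y : X) : \bar R :=
  ereal_inf [set path_length s | s in piecewise_C1_path x y].

End RiemannianDistance.

(* The distance of X, which also induces its topology, is the Riemannian
   distance of g.  Since mdist is finite, X is then connected. *)
Definition is_induced_metric (R : realType) (n : nat) (X : metricType R)
    (g : riemannian_structure R n X) : Prop :=
  forall x y : X, (mdist x y)%:E = riemannian_dist g x y.

Section MetricMeanDimension.
Context {R : realType} {X : metricType R}.
Implicit Types (F : X -> X) (eps : R) (k : nat).

Definition dyn_dist F k (x y : X) : R :=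
  \big[Num.max/0]_(i < k) mdist (iter i F x) (iter i F y).

Definition separated F k eps (E : set X) : Prop :=
  forall x y, E x -> E y -> x <> y -> eps < dyn_dist F k x y.

Definition max_separated F k eps : \bar R :=
  ereal_sup [set counting E | E in separated F k eps].

Definition separated_growth F eps : \bar R :=
  limn_esup (fun k => (k%:R^-1)%:E * lne (max_separated F k eps))%E.

Definition upper_mdim F : \bar R :=
  limf_esup (fun eps => separated_growth F eps * (`|ln eps|^-1)%:E)%E 0^'+.

End MetricMeanDimension.

Definition homeomorphism (X : topologicalType) (F : X -> X) : Prop :=
  continuous F /\ exists G : X -> X, [/\ continuous G, cancel F G & cancel G F].

(* Main.v *)
Require Import Defs.
From HB Require Import structures.
From mathcomp Require Import all_boot all_order all_algebra finmap.
From mathcomp Require Import all_classical all_reals all_analysis.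
From mathcomp Require Import measurable_realfun.
From mathcomp Require Import ring lra.

(** Both density statements come from one perturbation near a periodic point.
Let [p] have period [P] under a homeomorphism [F], its iterates [F^i p] with
[0 < i < P] being different from [p].  In a chart centred at [p] the return map
[F^P] reads as a continuous injection [phi] that fixes 0.  Compose [F] with a
homeomorphism [h] supported in a chart ball so small that it does not meet its
first [P - 1] images: the return map of the perturbed map reads as [h \o phi].
If [h \o phi] has, at scales [eps] tending to 0, horseshoes with about [eps^-n]
legs at distance more than [eps], counting itineraries shows that the upper
metric mean dimension of the perturbed map is at least [n / P]
([periodic_horseshoes], [upper_mdim_ge]).  On the other hand it is at most [n]
for every map, since the manifold is covered by [C * eps^-n] sets of diameter at
most [eps] ([covering_bound], [upper_mdim_le]).  A fixed point is the case
[P = 1].  Without a fixed point, an orbit returns to some small chart ball by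
compactness, and a perturbation supported in that ball closes it up at its first
return ([closing_orbit]); the period is not controlled, hence mere positivity.

The heart is the construction of [h] for a given [phi] ([local_horseshoes]).  At
one scale, take a cubic lattice of [m^n] points near 0 and at each of them a thin
tube along one axis [al].  The image under [phi] of a tube spans an interval of
values of the coordinate [al].  For each pair of tubes [(i, k)] reserve a value in
the interval spanned by the image of [i], all these values being distinct, and
let [h] map the part of that image near the reserved value across the tube [k],
from end to end.  A path that crosses the tube [i] lengthwise then has a piece
that [h \o phi] maps to a path crossing the tube [k] lengthwise, whatever [k] is:
nested intervals on a path realise every itinerary ([itinerary]).  No estimate on
[phi] is involved, which is why mere continuity and injectivity suffice.  The
slabs around the reserved values have to be permuted, which increasing maps of
one coordinate cannot do; with a second coordinate they can be moved past each
other ([box_transport]), and this is where dimension at least two enters.  The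
maps of successive scales are supported in disjoint shells shrinking to 0, so
that they fit together into a single homeomorphism.

All this takes place in [R^n] with the sup norm.  It carries over to the manifold
because the Riemannian distance is bilipschitz to the sup norm of a chart near
each point ([riemannian_bilip]): straight segments give the upper bound, and for
the lower bound a path shorter than the distance to the boundary of a chart ball,
measured with the lower bound of the metric tensor, cannot leave that ball
([path_length_lower]). *)

Set Implicit Arguments.
Unset Strict Implicit.
Unset Printing Implicit Defensive.

Import Order.TTheory GRing.Theory Num.Theory.
Import numFieldNormedType.Exports.

Local Open Scope classical_set_scope.
Local Open Scope ring_scope.

(** * Supported homeomorphisms, and increasing homeomorphisms of the line *)

(** Continuity of the inverse is recovered on the compact manifold, by
[compact_homeomorphism]. *)
Definition supported_homeo (T : topologicalType) (W : set T) (g : T -> T) : Prop :=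
  [/\ continuous g, bijective g & forall x, ~ W x -> g x = x].

Section SelfHomeo.
Context {T : topologicalType}.
Implicit Types (W : set T) (g : T -> T).

Lemma inj_surj_bij g : injective g -> (forall y, exists x, g x = y) ->
  bijective g.
Proof.
move=> gI gS; have [f fK] := choice gS.
by exists f => // x; apply: gI; rewrite fK.
Qed.

Lemma supported_homeo_id W : supported_homeo W id.
Proof. by split => // [x|]; [exact: cvg_id|exists id]. Qed.

Lemma supported_homeo_comp W g1 g2 :
  supported_homeo W g1 -> supported_homeo W g2 -> supported_homeo W (g2 \o g1).
Proof.
move=> [c1 b1 f1] [c2 b2 f2]; split.
- by move=> x; apply: continuous_comp; [exact: c1|exact: c2].
- exact: bij_comp.
- by move=> x Wx /=; rewrite f1 // f2.
Qed.

Lemma supported_homeo_sub W W' g : W `<=` W' -> supported_homeo W g -> supported_homeo W' g.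
Proof. by move=> WW' [c b f]; split => // x W'x; apply: f => /WW'. Qed.

Lemma supported_homeo_stable W g x : supported_homeo W g -> W x -> W (g x).
Proof.
move=> [_ /bij_inj gI f] Wx; apply: contrapT => /[dup] nW /f /gI gx.
by apply: nW; rewrite gx.
Qed.

End SelfHomeo.

Section Plateau.
Context {R : realType}.
Implicit Types (lo e hi t x y : R).

(** A trapezoid with feet [lo] and [hi] and shoulders [e1] and [e2]; a tent for
[e1 = e2]. *)
Definition plateau lo e1 e2 hi t : R :=
  Num.max 0 (Num.min 1 (Num.min ((t - lo) / (e1 - lo)) ((hi - t) / (hi - e2)))).

Lemma plateau_continuous lo e1 e2 hi : continuous (plateau lo e1 e2 hi).
Proof.
move=> t.
have -> : plateau lo e1 e2 hi = (cst 0 : R -> R) \max ((cst 1 : R -> R) \min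
   ((fun t => (t - lo) / (e1 - lo)) \min (fun t => (hi - t) / (hi - e2)))) by [].
apply: continuous_max; first exact: cvg_cst.
apply: continuous_min; first exact: cvg_cst.
apply: continuous_min.
  by apply: cvgMl; apply: cvgB; [exact: cvg_id|exact: cvg_cst].
by apply: cvgMl; apply: cvgB; [exact: cvg_cst|exact: cvg_id].
Qed.

Lemma plateau_itv lo e1 e2 hi t : 0 <= plateau lo e1 e2 hi t <= 1.
Proof.
by rewrite /plateau le_max lexx /= ge_max ler01 /= ge_min lexx.
Qed.

Lemma plateau1 lo e1 e2 hi t : lo < e1 -> e2 < hi -> e1 <= t <= e2 ->
  plateau lo e1 e2 hi t = 1.
Proof.
move=> h1 h2 /andP[h3 h4]; rewrite /plateau.
rewrite min_l ?max_r // le_min !ler_pdivlMr ?subr_gt0 //.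
by apply/andP; split; lra.
Qed.

Lemma plateau0 lo e1 e2 hi t : lo < e1 -> e2 < hi -> ~~ (lo < t < hi) ->
  plateau lo e1 e2 hi t = 0.
Proof.
move=> h1 h2 h; rewrite /plateau; apply: max_l; rewrite 2!ge_min.
rewrite !ler_pdivrMr ?subr_gt0 // !mul0r !subr_le0.
by move: h; rewrite negb_and -!leNgt orbC => /orP[] ->; rewrite !orbT.
Qed.

(** These slopes are what keeps a map of the form [x + d * tent x] increasing
for small [d]. *)
Lemma plateau_lip lo e hi x y : lo < e -> e < hi -> x <= y ->
  - ((y - x) / (hi - e)) <= plateau lo e e hi y - plateau lo e e hi x
    <= (y - x) / (e - lo).
Proof.
move=> h1 h2 xy; rewrite /plateau.
have H1 : 0 <= (y - x) / (hi - e) by rewrite divr_ge0 ?subr_ge0 // ltW.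
have H2 : 0 <= (y - x) / (e - lo) by rewrite divr_ge0 ?subr_ge0 // ltW.
have -> : (y - lo) / (e - lo) = (x - lo) / (e - lo) + (y - x) / (e - lo).
  by rewrite -mulrDl; congr (_ / _); lra.
have -> : (hi - y) / (hi - e) = (hi - x) / (hi - e) - (y - x) / (hi - e).
  by rewrite -mulrBl; congr (_ / _); lra.
move: ((y - x) / (hi - e)) ((y - x) / (e - lo)) H1 H2 => a b a0 b0.
move: ((x - lo) / (e - lo)) ((hi - x) / (hi - e)) => p q.
have mn (u u' v v' c : R) : u' <= u + c -> v' <= v + c ->
    Num.min u' v' <= Num.min u v + c.
  by move=> h h'; rewrite addr_minl le_min !ge_min h h' orbT.
have mx (u u' v v' c : R) : u' <= u + c -> v' <= v + c ->
    Num.max u' v' <= Num.max u v + c.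
  by move=> h h'; rewrite addr_maxl ge_max !le_max h h' orbT.
set X := Num.max 0 (Num.min 1 (Num.min p q)).
set Y := Num.max 0 (Num.min 1 (Num.min (p + b) (q - a))).
have XY : X <= Y + a.
  by apply mx; [lra|apply mn; [lra|apply mn; lra]].
have YX : Y <= X + b.
  by apply mx; [lra|apply mn; [lra|apply mn; lra]].
by apply/andP; split; lra.
Qed.

Definition incr_homeo_on lo hi (f : R -> R) : Prop :=
  [/\ continuous f, {homo f : x y / x < y}
    & forall x, ~~ (lo < x < hi) -> f x = x].

Lemma incr_homeo_on_comp lo hi f1 f2 :
  incr_homeo_on lo hi f1 -> incr_homeo_on lo hi f2 ->
  incr_homeo_on lo hi (f2 \o f1).
Proof.
move=> [c1 m1 i1] [c2 m2 i2]; split.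
- by move=> x; apply: continuous_comp; [exact: c1|exact: c2].
- by move=> x y xy; apply/m2/m1.
- by move=> x xW /=; rewrite i1 // i2.
Qed.

Lemma incr_homeo_on_sub lo hi lo' hi' f : lo' <= lo -> hi <= hi' ->
  incr_homeo_on lo hi f -> incr_homeo_on lo' hi' f.
Proof.
move=> l h [c m i]; split => // x xW; apply: i; apply: contra xW.
by case/andP => *; apply/andP; split; lra.
Qed.

Lemma incr_homeo_on_mono lo hi f :
  incr_homeo_on lo hi f -> {mono f : x y / x <= y}.
Proof. by move=> [_ m _]; apply: le_mono. Qed.

(** The shift by [t - e] is damped by the tent with apex [e]; on the side
towards which [e] moves, the damped shift decreases with slope less than 1. *)
Lemma kink_exists lo e hi t : lo < e < hi -> lo < t < hi ->
  exists2 f, incr_homeo_on lo hi f & f e = t.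
Proof.
move=> /andP[h1 h2] /andP[h3 h4].
exists (fun x => x + (t - e) * plateau lo e e hi x); last first.
  by rewrite plateau1 ?lexx // mulr1 addrC subrK.
split.
- move=> x; apply: cvgD; first exact: cvg_id.
  by apply: cvgMr; exact: plateau_continuous.
- move=> x y xy.
  have /andP[l1 l2] := plateau_lip h1 h2 (ltW xy).
  move: (plateau lo e e hi x) (plateau lo e e hi y) l1 l2 => p q l1 l2.
  have [et|te] := leP e t.
    have k1 : (t - e) * ((y - x) / (hi - e)) < y - x.
      rewrite mulrCA gtr_pMr ?subr_gt0 // ltr_pdivrMr ?subr_gt0 // mul1r; lra.
    have : (t - e) * (p - q) <= (t - e) * ((y - x) / (hi - e)).
      by apply: ler_wpM2l; lra.
    lra.
  have k1 : (e - t) * ((y - x) / (e - lo)) < y - x.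
    rewrite mulrCA gtr_pMr ?subr_gt0 // ltr_pdivrMr ?subr_gt0 // mul1r; lra.
  have : (e - t) * (q - p) <= (e - t) * ((y - x) / (e - lo)).
    by apply: ler_wpM2l; lra.
  lra.
- by move=> x xW; rewrite plateau0 // mulr0 addr0.
Qed.

(** A first kink brings [e2] to its target; a second one, supported on the left
of that target, corrects [e1]. *)
Lemma incr_homeo_exists lo hi e1 e2 t1 t2 :
  lo < e1 -> e1 < e2 -> e2 < hi -> lo < t1 -> t1 < t2 -> t2 < hi ->
  exists f, [/\ incr_homeo_on lo hi f, f e1 = t1 & f e2 = t2].
Proof.
move=> h1 h2 h3 h4 h5 h6.
have [||f1 F1 fe2] := @kink_exists lo e2 hi t2; [by apply/andP; split; lra..|].
have f1lo : f1 lo = lo by case: F1 => _ _; apply; rewrite ltxx.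
have a1 : lo < f1 e1 by rewrite -[ltLHS]f1lo; case: F1 => _ + _; exact.
have a2 : f1 e1 < t2 by rewrite -fe2; case: F1 => _ + _; exact.
have [||f2 F2 fe1] := @kink_exists lo (f1 e1) t2 t1; [by apply/andP; split; lra..|].
exists (f2 \o f1); split => //=.
  by apply: incr_homeo_on_comp F1 _; apply: incr_homeo_on_sub F2; lra.
by rewrite fe2; case: F2 => _ _; apply; rewrite ltxx andbF.
Qed.

End Plateau.

(** * Moving boxes coordinate by coordinate *)

Section Boxes.
Context {R : realType} {n : nat}.
Local Notation V := 'rV[R]_n.
Implicit Types (x y : V) (c : 'I_n) (lo hi : 'I_n -> R) (W : set V).

Lemma rV_entry_continuous c : continuous (fun x : V => x 0 c).
Proof. by move=> x; exact: coord_continuous. Qed.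

Lemma delta_mx_entry (t : R) c i : (t *: delta_mx 0 c : V) 0 i = t *+ (i == c).
Proof. by rewrite !mxE eqxx /= mulr_natr. Qed.

(** On each line parallel to the axis [c] the factor [s] is constant, and the
map is the interpolation [(1 - s) id + s f] between two increasing
bijections. *)
Lemma coordinate_move c (s : V -> R) (lo hi : R) f W :
  continuous s -> (forall x, 0 <= s x <= 1) ->
  (forall x t, s (x + t *: delta_mx 0 c) = s x) -> incr_homeo_on lo hi f ->
  (forall x, s x != 0 -> lo < x 0 c < hi -> W x) ->
  supported_homeo W (fun x => x + (s x * (f (x 0 c) - x 0 c)) *: delta_mx 0 c).
Proof.
move=> sc s01 sinv [fc fm fi] sW.
set g := (fun x : V => _).
have gE x i : g x 0 i = x 0 i + (s x * (f (x 0 c) - x 0 c)) *+ (i == c).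
  by rewrite mxE delta_mx_entry.
have gc x : g x 0 c = (1 - s x) * x 0 c + s x * f (x 0 c).
  by rewrite gE eqxx mulr1n; ring.
have sg x : s (g x) = s x by rewrite /g sinv.
have mono (a : R) (u v : R) : 0 <= a <= 1 -> u < v ->
    (1 - a) * u + a * f u < (1 - a) * v + a * f v.
  move=> /andP[a0 a1] uv; have fuv := fm _ _ uv.
  have [->|an0] := eqVneq a 0; first by rewrite subr0 !mul1r !mul0r !addr0.
  have : 0 <= (1 - a) * (v - u) by rewrite mulr_ge0 // subr_ge0 // ltW.
  have : 0 < a * (f v - f u) by rewrite mulr_gt0 ?subr_gt0 // lt_neqAle eq_sym an0.
  nra.
split.
- move=> x; rewrite /g; apply: (@continuousD R V V id); first by move=> ?.
  apply: (@continuousZr_tmp R V V); apply: continuousM; first exact: sc.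
  apply: (@continuousB R R V (fun x => f (x 0 c))); last exact: rV_entry_continuous.
  by apply: (@continuous_comp _ _ _ (fun x : V => x 0 c) f); [exact: rV_entry_continuous|exact: fc].
- apply: inj_surj_bij => [x y gxy|y].
    have sxy : s x = s y by rewrite -[LHS]sg -[RHS]sg gxy.
    have cxy : x 0 c = y 0 c.
      move: (congr1 (fun v : V => v 0 c) gxy); rewrite !gc sxy => e.
      have [h|h|//] := ltgtP (x 0 c) (y 0 c).
        by have := mono _ _ _ (s01 y) h; rewrite e ltxx.
      by have := mono _ _ _ (s01 y) h; rewrite e ltxx.
    apply/rowP => i; move: (congr1 (fun v : V => v 0 i) gxy); rewrite !gE cxy sxy.
    by apply: addIr.
  have [u uE] : exists u, (1 - s y) * u + s y * f u = y 0 c.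
    have [yW|] := boolP (lo < y 0 c < hi); last first.
      by move=> yW; exists (y 0 c); rewrite fi //; ring.
    have [lo_y y_hi] := andP yW.
    suff [u _ uE] : exists2 u, u \in `[lo, hi] & (1 - s y) * u + s y * f u = y 0 c.
      by exists u.
    apply: (@IVT R (fun u => (1 - s y) * u + s y * f u)).
    - exact: ltW (lt_trans lo_y y_hi).
    - apply: continuous_subspaceT => u; apply: cvgD; apply: cvgMr.
        exact: cvg_id.
      exact: fc.
    - rewrite !fi ?ltxx ?andbF //.
      rewrite -!mulrDl subrK !mul1r ge_min le_max (ltW lo_y) (ltW y_hi).
      by rewrite orbT.
  exists (y + (u - y 0 c) *: delta_mx 0 c).
  set x := y + _.
  have xc : x 0 c = u by rewrite mxE delta_mx_entry eqxx mulr1n addrC subrK.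
  have sx : s x = s y by rewrite /x sinv.
  apply/rowP => i; rewrite gE xc sx.
  case: (eqVneq i c) => [->|ic]; last by rewrite mulr0n addr0 mxE delta_mx_entry (negbTE ic) addr0.
  by rewrite mulr1n xc -uE; ring.
- move=> x nW; rewrite /g.
  have [->|sx0] := eqVneq (s x) 0; first by rewrite mul0r scale0r addr0.
  rewrite fi ?subrr ?mulr0 ?scale0r ?addr0 //.
  by apply/negP => xW; exact/nW/sW.
Qed.

Definition obox lo hi : set V := [set x | forall c, lo c < x 0 c < hi c].
Definition cbox lo hi : set V := [set x | forall c, lo c <= x 0 c <= hi c].

(** The damping factor is the product of the plateaus in the coordinates other
than [c]. *)
Lemma box_coordinate_move c lo hi (i1 i2 : 'I_n -> R) f :
  (forall d, lo d < i1 d) -> (forall d, i2 d < hi d) ->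
  incr_homeo_on (lo c) (hi c) f ->
  exists2 g, supported_homeo (obox lo hi) g & forall x,
    (forall d, d != c -> i1 d <= x 0 d <= i2 d) ->
    forall d, g x 0 d = if d == c then f (x 0 c) else x 0 d.
Proof.
move=> h1 h2 F.
pose s x := \prod_(d | d != c) plateau (lo d) (i1 d) (i2 d) (hi d) (x 0 d).
have s1 x : (forall d, d != c -> i1 d <= x 0 d <= i2 d) -> s x = 1.
  by move=> xI; rewrite /s big1 // => d dc; rewrite plateau1 // xI.
exists (fun x => x + (s x * (f (x 0 c) - x 0 c)) *: delta_mx 0 c).
  apply: (@coordinate_move _ _ (lo c) (hi c)) => //.
  - apply: (@continuous_big R 'I_n *%R 1 (fun d => d != c)).
      by move=> z; exact: mul_continuous.
    move=> d _ x; apply: continuous_comp; first exact: rV_entry_continuous.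
    exact: plateau_continuous.
  - move=> x; apply/andP; split.
      by apply: prodr_ge0 => d _; case/andP: (plateau_itv (lo d) (i1 d) (i2 d) (hi d) (x 0 d)).
    by apply: prodr_ile1 => d _; exact: plateau_itv.
  - move=> x t; apply: eq_bigr => d dc.
    by rewrite mxE delta_mx_entry (negbTE dc) addr0.
  - move=> x sx xc d; have [->//|dc] := eqVneq d c.
    apply: contraTT sx => xd; rewrite negbK /s (bigD1 d) //=.
    by rewrite plateau0 // mul0r.
move=> x xI d; rewrite mxE delta_mx_entry s1 // mul1r.
by case: eqVneq => [->|_]; rewrite ?mulr1n ?addr0 // addrC subrK.
Qed.

(** One coordinate at a time. When a coordinate is moved, some of the others
have already been moved and some have not: the plateaus must be 1 on both
ranges, whence the corners [i1] and [i2]. *)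
Lemma product_move lo hi (e1 e2 : 'I_n -> R) (f : 'I_n -> R -> R) :
  (forall d, lo d < e1 d) -> (forall d, e2 d < hi d) ->
  (forall d, e1 d <= e2 d) ->
  (forall d, incr_homeo_on (lo d) (hi d) (f d)) ->
  exists2 g, supported_homeo (obox lo hi) g & forall x, cbox e1 e2 x ->
    forall d, g x 0 d = f d (x 0 d).
Proof.
move=> h1 h2 e12 F.
have flo d : f d (lo d) = lo d by case: (F d) => _ _; apply; rewrite ltxx.
have fhi d : f d (hi d) = hi d by case: (F d) => _ _; apply; rewrite ltxx andbF.
(* the smallest intervals that contain the coordinates before and after the
   move *)
pose i1 d := Num.min (e1 d) (f d (e1 d)).
pose i2 d := Num.max (e2 d) (f d (e2 d)).
suff [g gW gE] : exists2 g, supported_homeo (obox lo hi) g & forall x, cbox e1 e2 x ->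
    forall d, g x 0 d = if d \in enum 'I_n then f d (x 0 d) else x 0 d.
  by exists g => // x xe d; rewrite gE // mem_enum.
elim: (enum 'I_n) (enum_uniq 'I_n) => [_|c cs IH /= /andP[ccs /IH[g gW gE]]].
  by exists id => //; exact: supported_homeo_id.
have [d|d||k kW kE] := @box_coordinate_move c lo hi i1 i2 (f c).
- rewrite /i1 lt_min h1 /= -[ltLHS]flo.
  by case: (F d) => _ + _; apply; exact: h1.
- rewrite /i2 gt_max h2 /= -[ltRHS]fhi.
  by case: (F d) => _ + _; apply; exact: h2.
- exact: F.
exists (k \o g); first exact: supported_homeo_comp.
move=> x xe d /=; rewrite kE => [|{}d dc].
  rewrite inE; have [->|dc] := eqVneq d c; last by rewrite gE.
  by rewrite gE // (negbTE ccs).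
rewrite gE //; case: ifP => _.
  have /andP[x1 x2] := xe d.
  rewrite /i1 /i2 ge_min le_max !(incr_homeo_on_mono (F d)) x1 x2.
  by rewrite !orbT.
by have /andP[x1 x2] := xe d; rewrite ge_min le_max x1 x2.
Qed.

Lemma box_move lo hi (e1 e2 t1 t2 : 'I_n -> R) :
  (forall d, [/\ lo d < e1 d, e1 d < e2 d & e2 d < hi d]) ->
  (forall d, [/\ lo d < t1 d, t1 d < t2 d & t2 d < hi d]) ->
  exists2 g, supported_homeo (obox lo hi) g & forall x, cbox e1 e2 x ->
   [/\ cbox t1 t2 (g x), forall d, x 0 d = e1 d -> g x 0 d = t1 d
     & forall d, x 0 d = e2 d -> g x 0 d = t2 d].
Proof.
move=> he ht.
have /choice[f F] d : exists f : R -> R,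
    [/\ incr_homeo_on (lo d) (hi d) f, f (e1 d) = t1 d & f (e2 d) = t2 d].
  by have [? ? ?] := he d; have [? ? ?] := ht d; exact: incr_homeo_exists.
have [d|d|d|d|g gW gE] := @product_move lo hi e1 e2 f.
- by case: (he d).
- by case: (he d).
- by case: (he d) => _ /ltW.
- by case: (F d).
exists g => // x xe; split=> d.
- rewrite gE //; have [Fd <- <-] := F d; have /andP[x1 x2] := xe d.
  by rewrite !(incr_homeo_on_mono Fd) x1.
- by move=> xd; rewrite gE // xd; case: (F d).
- by move=> xd; rewrite gE // xd; case: (F d).
Qed.

Lemma point_move lo hi x y : obox lo hi x -> obox lo hi y ->
  exists2 g, supported_homeo (obox lo hi) g & g x = y.
Proof.
move=> xb yb.
have /choice[f F] d : exists f : R -> R,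
    incr_homeo_on (lo d) (hi d) f /\ f (x 0 d) = y 0 d.
  by have [f ? ?] := kink_exists (xb d) (yb d); exists f.
have [d|d|d|d|g gW gE] := @product_move lo hi (x 0) (x 0) f.
- by case/andP: (xb d).
- by case/andP: (xb d).
- exact: lexx.
- by case: (F d).
exists g => //; apply/rowP => d; rewrite gE; first by case: (F d).
by move=> c; rewrite lexx.
Qed.

End Boxes.

(** * Separating points and gluing homeomorphisms *)

Section Finite.
Context {R : realType}.

Lemma finite_pos_bound (K : finType) (f : K -> R) :
  (forall k, 0 < f k) -> exists2 w : R, 0 < w & forall k, w <= f k.
Proof.
move=> f0; exists (\big[Num.min/1]_k f k).
  by apply/bigmin_gtP; split.
by move=> k; exact: bigmin_le_cond.
Qed.

Lemma avoid_seq (s : seq R) (a b : R) : a < b ->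
  exists2 t, a < t < b & t \notin s.
Proof.
elim: s a b => [|c s IH] a b ab.
  by exists ((a + b) / 2) => //; apply/andP; split; lra.
have [ac|ca] := ltP a c.
  have [|t /andP[t1 t2] ts] := IH a (Num.min b c); first by rewrite lt_min ab.
  move: t2; rewrite lt_min => /andP[t2 t3]; exists t; first by rewrite t1.
  by rewrite inE negb_or ts lt_eqF.
have [t /andP[t1 t2] ts] := IH _ _ ab; exists t; first by rewrite t1.
by rewrite inE negb_or ts gt_eqF // (le_lt_trans ca).
Qed.

(** Points are chosen one after the other, off the finitely many previous ones;
[w] is then a fixed fraction of the smallest gap. *)
Lemma separated_representatives (K : finType) (A B : K -> R) :
  (forall k, A k < B k) ->
  exists (a : K -> R) (w : R), [/\ 0 < w,
    forall k, A k < a k - 2 * w /\ a k + 2 * w < B k &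
    forall k l, k != l -> 4 * w < `|a k - a l|].
Proof.
move=> AB.
have [a [aAB aI]] : exists a : K -> R, (forall k, A k < a k < B k) /\
    {in enum K &, injective a}.
  elim: (enum K) => [|c s [a [aAB aI]]].
    exists (fun k => (A k + B k) / 2); split => // k; have := AB k.
    by move=> ?; apply/andP; split; lra.
  have [t tAB ts] := avoid_seq (map a s) (AB c).
  exists (fun k => if k == c then t else a k); split.
    by move=> k; case: eqP => [->|].
  move=> k l; rewrite !inE.
  case: eqVneq => [->|kc]; case: eqVneq => [->|lc] //= ks ls.
  - by move=> e; move: ts; rewrite e map_f.
  - by move=> e; move: ts; rewrite -e map_f.
  - exact: aI.
have [|w1 w10 w1P] := @finite_pos_bound K (fun k => Num.min (a k - A k) (B k - a k)).
  by move=> k; have /andP[? ?] := aAB k; rewrite lt_min !subr_gt0.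
have [|w2 w20 w2P] := @finite_pos_bound (K * K)%type
    (fun p => if p.1 == p.2 then 1 else `|a p.1 - a p.2|).
  move=> [k l] /=; case: eqP => // kl; rewrite normr_gt0 subr_eq0.
  by apply/eqP => /aI kl'; apply: kl; apply: kl'; rewrite mem_enum.
(* any divisor larger than 4 would do *)
exists a, (Num.min w1 w2 / 5).
have w0 : 0 < Num.min w1 w2 by rewrite lt_min w10.
have m1 : Num.min w1 w2 <= w1 by rewrite ge_min lexx.
have m2 : Num.min w1 w2 <= w2 by rewrite ge_min lexx orbT.
split.
- by rewrite divr_gt0.
- by move=> k; have := w1P k; rewrite le_min => /andP[? ?]; split; lra.
- by move=> k l kl; have := w2P (k, l); rewrite /= (negbTE kl) => ?; lra.
Qed.

End Finite.

Lemma continuous_epsdelta (R : realType) (U W : normedModType R) (f : U -> W) x :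
  {for x, continuous f} <-> forall e, 0 < e ->
    exists2 d, 0 < d & forall y, `|y - x| < d -> `|f y - f x| < e.
Proof.
split=> [/cvgrPdist_lt fx e e0|fx].
  have /nbhs_ballP[d /= d0 dP] := fx _ e0.
  by exists d => // y yd; rewrite distrC; apply: dP; rewrite -ball_normE /= distrC.
apply/cvgrPdist_lt => e /fx[d d0 dP]; apply/nbhs_ballP; exists d => //= y.
by rewrite -ball_normE /= distrC => /dP; rewrite distrC.
Qed.

Section RowNorm.
Context {R : realType} {n : nat}.
Local Notation V := 'rV[R]_n.
Implicit Types (u v x y : V) (e : R).

Lemma rV_entry_le v c : `|v 0 c| <= `|v|.
Proof.
rewrite [leRHS]/Num.Def.normr /= mx_normrE.
by apply/bigmax_geP; right; exists (0, c).
Qed.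

Lemma rV_norm_leP v e : 0 <= e -> `|v| <= e <-> forall c, `|v 0 c| <= e.
Proof.
move=> e0; split=> [ve c|ve]; first exact: le_trans (rV_entry_le _ _) ve.
rewrite [leLHS]/Num.Def.normr /= mx_normrE; apply/bigmax_leP; split => // -[i c] _.
by rewrite /= ord1.
Qed.

Lemma rV_norm_ltP v e : 0 < e -> `|v| < e <-> forall c, `|v 0 c| < e.
Proof.
move=> e0; split=> [ve c|ve]; first exact: le_lt_trans (rV_entry_le _ _) ve.
rewrite [ltLHS]/Num.Def.normr /= mx_normrE; apply/bigmax_ltP; split => // -[i c] _.
by rewrite /= ord1.
Qed.

Lemma rV_neq0 v : v != 0 -> exists c, v 0 c != 0.
Proof.
move=> v0; apply: contrapT => h; move/eqP: v0; apply; apply/rowP => c.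
by rewrite mxE; apply/eqP; apply: contrapT => vc; apply: h; exists c; apply/negP.
Qed.

Lemma obox_ball x y e : 0 < e ->
  obox (fun c => x 0 c - e) (fun c => x 0 c + e) y <-> `|y - x| < e.
Proof.
move=> e0; rewrite rV_norm_ltP //; split => h c; have := h c; rewrite !mxE ltr_distl //.
Qed.

(** By induction on the list: the next point is moved, in a ball that avoids the
points already placed, to a value of the coordinate [c] that none of them
takes. *)
Lemma push_apart (W : set V) (c : 'I_n) (pts : seq V) :
  open W -> (forall x, x \in pts -> W x) ->
  exists2 g, supported_homeo W g & forall x y, x \in pts -> y \in pts -> x != y ->
    g x 0 c != g y 0 c.
Proof.
move=> Wo; elim: pts => [_|x l IH lW]; first by exists id => //; exact: supported_homeo_id.
have [|g gW gP] := IH; first by move=> y yl; apply: lW; rewrite inE yl orbT.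
have [xl|xl] := boolP (x \in l).
  by exists g => // y z; rewrite !inE => /predU1P[->|yl] /predU1P[->|zl]; apply: gP.
have gI : injective g by case: gW => _ /bij_inj.
set x' := g x.
have Wx' : W x' by apply: supported_homeo_stable gW _; apply: lW; rewrite inE eqxx.
have [d d0 dW] : exists2 d : R, 0 < d & forall z, `|z - x'| < d -> W z.
  move: Wo; rewrite openE => /(_ _ Wx') /nbhs_ballP[d /= d0 dW].
  by exists d => // z zd; apply: dW; rewrite -ball_normE /= distrC.
have [r r0 rP] : exists2 r : R, 0 < r & forall z, z \in l -> r <= `|g z - x'|.
  elim: (l) xl => [_|z s IHs]; first by exists 1.
  rewrite inE negb_or => /andP[xz /IHs[r r0 rP]].
  exists (Num.min r `|g z - x'|).
    by rewrite lt_min r0 normr_gt0 subr_eq0; apply: contraNneq xz => /gI ->.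
  move=> w; rewrite inE => /predU1P[->|ws]; first by rewrite ge_min lexx orbT.
  by rewrite ge_min rP.
pose e := Num.min d r.
have e0 : 0 < e by rewrite lt_min d0.
have [|t /andP[t1 t2] tl] := @avoid_seq _ [seq g z 0 c | z <- l] (x' 0 c) (x' 0 c + e).
  by rewrite ltrDl.
pose y' := x' + (t - x' 0 c) *: delta_mx 0 c.
have y'c : y' 0 c = t by rewrite mxE delta_mx_entry eqxx mulr1n addrC subrK.
have [||k kW kx] := @point_move _ _ (fun c => x' 0 c - e) (fun c => x' 0 c + e) x' y'.
- by apply/obox_ball; rewrite ?subrr ?normr0.
- apply/obox_ball => //; rewrite addrC addKr; apply/rV_norm_ltP => // i.
  rewrite delta_mx_entry; case: eqP => _; last by rewrite mulr0n normr0.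
  by rewrite mulr1n ger0_norm; lra.
have kl z : z \in l -> k (g z) = g z.
  move=> zl; case: kW => _ _; apply => /obox_ball => /(_ e0).
  by rewrite ltNge => /negP; apply; rewrite ge_min rP // orbT.
exists (k \o g).
  apply: supported_homeo_comp gW _; apply: supported_homeo_sub kW => z /obox_ball => /(_ e0) ze.
  by apply: dW; apply: lt_le_trans ze _; rewrite ge_min lexx.
have key z : z \in l -> t != g z 0 c.
  by move=> zl; apply: contraNneq tl => ->; apply/mapP; exists z.
move=> y z; rewrite !inE /= => /predU1P[->|yl] /predU1P[->|zl].
- by rewrite eqxx.
- by rewrite -/x' kx y'c kl // => _; exact: key.
- by rewrite -/x' kx y'c kl // => _; rewrite eq_sym; exact: key.
- by rewrite !kl //; exact: gP.
Qed.

(** For continuity, the glued map is uniformly within [e / 4] of the composition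
of the finitely many [g i] that move some point further than that; since the
supports are disjoint, this composition coincides with the relevant [g i] on
each of them. *)
Lemma supported_homeo_bigcup (I : eqType) (W : I -> set V) (g : I -> V -> V) :
  (forall i, supported_homeo (W i) (g i)) ->
  (forall i j x, W i x -> W j x -> i = j) ->
  (forall e : R, 0 < e -> exists s : seq I, forall i, i \notin s ->
     forall x, W i x -> `|g i x - x| <= e) ->
  exists2 h, supported_homeo (\bigcup_i W i) h & forall i x, W i x -> h x = g i x.
Proof.
move=> gW Wd gs.
have gI i : injective (g i) by case: (gW i) => _ /bij_inj.
pose h x := if pselect (exists i, W i x) is left H then g (projT1 (cid H)) x else x.
have hE i x : W i x -> h x = g i x.
  move=> Wx; rewrite /h; case: pselect => [H|[]]; last by exists i.
  by congr (g _ x); apply: Wd (projT2 (cid H)) Wx.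
have h0 x : (forall i, ~ W i x) -> h x = x.
  by move=> nW; rewrite /h; case: pselect => // H; exfalso; case: H => i /nW.
exists h => //; split.
- move=> x; apply/(@continuous_epsdelta R V V) => e e0.
  have e30 : 0 < e / 4 by rewrite divr_gt0.
  have [s0 s0P] := gs _ e30; pose s := undup s0.
  have sP i : i \notin s -> forall x, W i x -> `|g i x - x| <= e / 4.
    by rewrite mem_undup; exact: s0P.
  have us : uniq s := undup_uniq _.
  (* the finite composition that approximates the glued map *)
  pose H := foldr (fun i f => g i \o f) id s.
  have Hc : continuous H.
    rewrite /H; elim: (s) => [|i t IH] /= y; first by move=> ?.
    by apply: continuous_comp; [exact: IH|case: (gW i) => + _ _; exact].
  have HP y : (forall i, i \in s -> W i y -> H y = g i y) /\
      ((forall i, i \in s -> ~ W i y) -> H y = y).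
    rewrite /H; elim: (s) us y => [//|c t IH] /= /andP[ct ut] y.
    have [IH1 IH2] := IH ut y; split.
      move=> i; rewrite inE => /predU1P[->|it] Wy.
        rewrite IH2 // => j jt Wjy; move: ct.
        by rewrite (Wd _ _ _ Wy Wjy) jt.
      rewrite (IH1 _ it Wy); case: (gW c) => _ _; apply => Wc.
      have Wi := supported_homeo_stable (gW i) Wy.
      by move: ct; rewrite (Wd _ _ _ Wc Wi) it.
    move=> nW; rewrite IH2; last by move=> i it; apply: nW; rewrite inE it orbT.
    by case: (gW c) => _ _; apply; apply: nW; rewrite inE eqxx.
  have hH y : `|h y - H y| <= e / 4.
    have [[i Wy]|nW] := pselect (exists i, W i y).
      rewrite (hE _ _ Wy); have [i_s|nis] := boolP (i \in s).
        by case: (HP y) => + _ => /(_ _ i_s Wy) ->; rewrite subrr normr0 ltW.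
      case: (HP y) => _ -> => [|j js Wj]; first exact: sP.
      by move: nis; rewrite (Wd _ _ _ Wy Wj) js.
    rewrite h0; last by move=> i Wi; apply: nW; exists i.
    case: (HP y) => _ ->; last by move=> i _ Wi; apply: nW; exists i.
    by rewrite subrr normr0 ltW.
  have /(@continuous_epsdelta R V V) /(_ _ e30)[d d0 dP] := Hc x.
  exists d => // y /dP Hy.
  have -> : h y - h x = (h y - H y) + (H y - H x) + (H x - h x).
    by rewrite !addrA !subrK.
  apply: le_lt_trans (ler_normD _ _) _.
  apply: le_lt_trans (lerD (ler_normD _ _) (lexx _)) _.
  have := hH x; have := hH y; rewrite (distrC (H x)); lra.
- apply: inj_surj_bij => [x y|y].
    have [[i Wx]|nx] := pselect (exists i, W i x);
      have [[j Wy]|ny] := pselect (exists i, W i y).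
    + rewrite (hE _ _ Wx) (hE _ _ Wy) => gxy.
      have Wgx := supported_homeo_stable (gW i) Wx.
      have Wgy := supported_homeo_stable (gW j) Wy.
      move: Wgy; rewrite -gxy => Wgy; have ij := Wd _ _ _ Wgx Wgy.
      by subst j; exact: gI gxy.
    + rewrite (hE _ _ Wx) (h0 y) => [gxy|k Wk]; last by apply: ny; exists k.
      by exfalso; apply: ny; exists i; rewrite -gxy; exact: supported_homeo_stable (gW i) Wx.
    + rewrite (hE _ _ Wy) (h0 x) => [gxy|k Wk]; last by apply: nx; exists k.
      by exfalso; apply: nx; exists j; rewrite gxy; exact: supported_homeo_stable (gW j) Wy.
    + rewrite !h0 // => k Wk; [by apply: ny; exists k|by apply: nx; exists k].
  have [[i Wy]|ny] := pselect (exists i, W i y); last first.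
    by exists y; apply: h0 => i Wi; apply: ny; exists i.
  have [_ [f _ fK] gf] := gW i; exists (f y); rewrite (hE i) ?fK //.
  apply: contrapT => /[dup] nW /gf; rewrite fK => e.
  by apply: nW; rewrite -e.
- by move=> x nW; apply: h0 => i Wi; apply: nW; exists i.
Qed.

End RowNorm.

(** * Crossing paths and itineraries *)

Section Subpath.
Context {R : realType}.
Implicit Types (f : R -> R) (s t u w a b x : R).

Lemma last_level f u w a : u <= w ->
  (forall x, u <= x <= w -> {for x, continuous f}) -> f u <= a -> a < f w ->
  exists s, [/\ u <= s <= w, f s = a & forall x, s <= x <= w -> a <= f x].
Proof.
move=> uw fc fua afw.
(* the last passage is the last time at which [f] is at most [a] *)
pose A := [set x | u <= x <= w /\ f x <= a].
have Au : A u by split => //; rewrite lexx.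
have Aw x : A x -> x <= w by case => /andP[].
have supA : has_sup A by split; [exists u|exists w => x /Aw].
set s := sup A.
have us : u <= s by apply: sup_upper_bound.
have sw : s <= w by apply: ge_sup => // ; exists u.
have suw : u <= s <= w by rewrite us.
have out x : s < x -> x <= w -> a < f x.
  move=> sx xw; rewrite ltNge; apply/negP => fxa.
  suff : x <= s by rewrite leNgt sx.
  by apply: sup_upper_bound => //; split => //; rewrite (le_trans us (ltW sx)).
have /(@continuous_epsdelta R R R) fs := fc _ suw.
have fsa : f s = a.
  apply/eqP; rewrite eq_le; apply/andP; split; rewrite leNgt; apply/negP => h.
    have [d d0 dP] := fs (f s - a) ltac:(by rewrite subr_gt0).
    have [y Ay sy] := sup_adherent d0 supA.
    have ys : y <= s by apply: sup_upper_bound.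
    case: Ay => _ fya.
    have : `|f y - f s| < f s - a by apply: dP; rewrite ler0_norm; rewrite -/s in sy; lra.
    by rewrite ltr_norml => /andP[]; lra.
  have [d d0 dP] := fs (a - f s) ltac:(by rewrite subr_gt0).
  have sltw : s < w.
    by rewrite lt_neqAle sw andbT; apply/eqP => e; move: h; rewrite e; lra.
  pose y := Num.min w (s + d / 2).
  have sy : s < y by rewrite lt_min sltw; lra.
  have yw : y <= w by rewrite ge_min lexx.
  have ysd : y <= s + d / 2 by rewrite ge_min lexx orbT.
  have := out _ sy yw.
  have : `|f y - f s| < a - f s by apply: dP; rewrite ger0_norm; lra.
  by rewrite ltr_norml => /andP[]; lra.
exists s; split => // x /andP[]; rewrite le_eqVlt => /predU1P[<-|sx] xw.
  by rewrite fsa.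
exact/ltW/out.
Qed.

(** After the last passage at [a], stop at the first passage at [b], which is
the last one for the reversed path. *)
Lemma subpath_le f u w a b : u <= w ->
  (forall x, u <= x <= w -> {for x, continuous f}) -> f u <= a -> a < b ->
  b <= f w ->
  exists s t, [/\ u <= s, s <= t, t <= w, f s = a /\ f t = b
    & forall x, s <= x <= t -> a <= f x <= b].
Proof.
move=> uw fc fua ab bfw.
have [s [/andP[us sw] fsa sP]] := last_level uw fc fua (lt_le_trans ab bfw).
have [|x /andP[wx xs]|||r [/andP[wr rs] fr rP]] :=
    @last_level (fun x => - f (- x)) (- w) (- s) (- b).
- by rewrite lerN2.
- apply: continuousN; apply: (@continuous_comp _ _ _ -%R f).
    exact: opp_continuous.
  by apply: fc; apply/andP; split; lra.
- by rewrite opprK lerN2.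
- by rewrite opprK fsa ltrN2.
exists s, (- r); split; try lra.
move=> x /andP[sx xr]; apply/andP; split; first by apply: sP; apply/andP; split; lra.
have := rP (- x) ltac:(by apply/andP; split; lra).
by rewrite opprK lerN2.
Qed.

Lemma subpath f s t u w a b : s <= u <= t -> s <= w <= t ->
  (forall x, s <= x <= t -> {for x, continuous f}) -> f u <= a -> a < b ->
  b <= f w ->
  exists s' t', [/\ s <= s', s' <= t', t' <= t,
    (exists2 x, s' <= x <= t' & f x = a) /\ (exists2 x, s' <= x <= t' & f x = b)
    & forall x, s' <= x <= t' -> a <= f x <= b].
Proof.
move=> /andP[su ut] /andP[sw wt] fc fua ab bfw.
have [uw|wu] := leP u w.
  have [|s' [t' [h1 h2 h3 [e1 e2] h4]]] := subpath_le uw _ fua ab bfw.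
    by move=> x /andP[? ?]; apply: fc; apply/andP; split; lra.
  exists s', t'; split => //; try lra.
  by split; [exists s'|exists t'] => //; apply/andP; split; lra.
have [|x /andP[? ?]||//||s' [t' [h1 h2 h3 [e1 e2] h4]]] :=
   @subpath_le (fun x => f (- x)) (- u) (- w) a b.
- by rewrite lerN2 ltW.
- apply: (@continuous_comp _ _ _ -%R f); first exact: opp_continuous.
  by apply: fc; apply/andP; split; lra.
- by rewrite opprK.
- by rewrite opprK.
exists (- t'), (- s'); split => //; try lra.
- by split; [exists (- s')|exists (- t')] => //; apply/andP; split; lra.
- move=> x /andP[? ?]; have := h4 (- x); rewrite opprK; apply.
  by apply/andP; split; lra.
Qed.

End Subpath.

Section Itinerary.
Context {R : realType} {T : Type} {I : Type}.
Variables (f : T -> T) (Q : I -> set T) (cross : I -> (R -> T) -> R -> R -> Prop).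
Hypothesis cross_le : forall i p s t, cross i p s t -> s <= t.
Hypothesis cross_in : forall i p s t, cross i p s t ->
  forall x, s <= x <= t -> Q i (p x).
Hypothesis cross_step : forall i j p s t, cross i p s t ->
  exists s' t', [/\ s <= s', t' <= t & cross j (f \o p) s' t'].

(** The parameter intervals on which the path follows longer and longer prefixes
of the itinerary are nested, and a common point of them follows all of it. The
relation [cross i p s t] stands for: the piece of the path [p] between [s] and
[t] stays in [Q i] and joins its two ends. *)
Lemma itinerary (p : R -> T) (s t : R) (a : nat -> I) : cross (a 0) p s t ->
  exists x, forall k, Q (a k) (iter k f x).
Proof.
move=> c0.
(* [P k J]: after [k] steps, the piece of the path over [J] crosses the leg
   [a k] *)
pose P k (J : R * R) := cross (a k) (fun x => iter k f (p x)) J.1 J.2.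
have stepP k (J : {J : R * R | P k J}) : {J' : {J : R * R | P k.+1 J} |
    (sval J).1 <= (sval J').1 /\ (sval J').2 <= (sval J).2}.
  case: J => J PJ; apply: cid.
  have [s' [t' [h1 h2 h3]]] := cross_step (a k.+1) PJ.
  by exists (exist (P k.+1) (s', t') h3).
pose seqJ := fix seqJ k : {J : R * R | P k J} :=
  if k is k'.+1 then sval (stepP k' (seqJ k')) else exist (P 0) (s, t) c0.
pose lo k := (sval (seqJ k)).1; pose hi k := (sval (seqJ k)).2.
have loS k : lo k <= lo k.+1 by rewrite /lo /=; case: (stepP k (seqJ k)) => ? [].
have hiS k : hi k.+1 <= hi k by rewrite /hi /=; case: (stepP k (seqJ k)) => ? [].
have lohi k : lo k <= hi k by rewrite /lo /hi; apply: cross_le (svalP (seqJ k)).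
have lo_mono k l : (k <= l)%N -> lo k <= lo l.
  elim: l => [|l IH]; first by rewrite leqn0 => /eqP ->.
  by rewrite leq_eqVlt => /predU1P[->//|]; rewrite ltnS => /IH /le_trans; apply.
have hi_mono k l : (k <= l)%N -> hi l <= hi k.
  elim: l => [|l IH]; first by rewrite leqn0 => /eqP ->.
  rewrite leq_eqVlt => /predU1P[->//|]; rewrite ltnS => /IH.
  by apply: le_trans.
have lohi2 k l : lo k <= hi l.
  have [kl|/ltnW lk] := leqP k l; first exact: le_trans (lo_mono _ _ kl) (lohi l).
  exact: le_trans (lohi k) (hi_mono _ _ lk).
pose y := sup (range lo).
have supl : has_sup (range lo).
  by split; [exists (lo 0), 0|exists (hi 0) => _ [k _ <-]].
exists (p y) => k.
apply: (cross_in (svalP (seqJ k))); apply/andP; split.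
  by apply: sup_upper_bound => //; exists k.
by apply: ge_sup; [exists (lo 0), 0|move=> _ [l _ <-]; exact: lohi2].
Qed.

End Itinerary.

(** * Permuting slabs *)

Section Transport.
Context {R : realType} {n : nat}.
Local Notation V := 'rV[R]_n.

(** The slabs around the levels [a k] of the coordinate [al] are disjoint, so a
first map can reshape a box in each of them independently, giving it the extent
of its target in all coordinates but [al]. The targets lie at distinct levels
[b k] of the coordinate [be], so after this the boxes lie in disjoint slabs of
that coordinate, in which a second map moves the coordinate [al] of each
freely. *)
Lemma box_transport (K : finType) (al be : 'I_n) (r : R) (E1 E2 : 'I_n -> R)
  (a b : K -> R) (w1 w2 : R) (T1 T2 : K -> 'I_n -> R) :
  be != al -> 0 < w1 -> 0 < w2 ->
  (forall k l, k != l -> 4 * w1 < `|a k - a l|) ->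
  (forall k l, k != l -> 4 * w2 < `|b k - b l|) ->
  (forall k, - r < a k - 2 * w1 /\ a k + 2 * w1 < r) ->
  (forall k, - r < b k - 2 * w2 /\ b k + 2 * w2 < r) ->
  (forall c, [/\ - r < E1 c, E1 c < E2 c & E2 c < r]) ->
  (forall k c, [/\ - r < T1 k c, T1 k c < T2 k c & T2 k c < r]) ->
  (forall k, T1 k be = b k - w2 /\ T2 k be = b k + w2) ->
  exists2 g, supported_homeo [set x : V | `|x| < r /\
      exists k, `|x 0 al - a k| < 2 * w1 \/ `|x 0 be - b k| < 2 * w2] g &
    forall k (x : V), a k - w1 <= x 0 al <= a k + w1 ->
      (forall c, c != al -> E1 c <= x 0 c <= E2 c) ->
      [/\ cbox (T1 k) (T2 k) (g x), x 0 al = a k - w1 -> g x 0 al = T1 k al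
        & x 0 al = a k + w1 -> g x 0 al = T2 k al].
Proof.
move=> beal w10 w20 aa bb ar br EE TT Tb.
pose ifa c (u v : R) := if c == al then u else v.
pose ifb c (u v : R) := if c == be then u else v.
pose lo1 k c := ifa c (a k - 2 * w1) (- r).
pose hi1 k c := ifa c (a k + 2 * w1) r.
pose e1 k c := ifa c (a k - w1) (E1 c).
pose e2 k c := ifa c (a k + w1) (E2 c).
(* the intermediate boxes: the target except in the coordinate [al] *)
pose m1 k c := ifa c (a k - w1) (T1 k c).
pose m2 k c := ifa c (a k + w1) (T2 k c).
pose lo2 k c := ifb c (b k - 2 * w2) (- r).
pose hi2 k c := ifb c (b k + 2 * w2) r.
have alr k c : - r < ifa c (a k - w1) (T1 k c) /\ ifa c (a k + w1) (T2 k c) < r.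
  rewrite /ifa; case: eqP => _; last by have [] := TT k c.
  by have := ar k; split; lra.
have r0 : 0 < r by have [] := EE al; lra.
have /choice[ga gaP] k : exists g, supported_homeo (obox (lo1 k) (hi1 k)) g /\
    forall x : V, cbox (e1 k) (e2 k) x -> [/\ cbox (m1 k) (m2 k) (g x),
      forall d, x 0 d = e1 k d -> g x 0 d = m1 k d
    & forall d, x 0 d = e2 k d -> g x 0 d = m2 k d].
  have [d|d|g ? ?] := @box_move R n (lo1 k) (hi1 k) (e1 k) (e2 k) (m1 k) (m2 k);
    last by exists g.
    rewrite /lo1 /hi1 /e1 /e2 /ifa; case: eqP => _; last exact: EE.
    by split; lra.
  rewrite /lo1 /hi1 /m1 /m2 /ifa; case: eqP => _; last exact: TT.
  by split; lra.
have /choice[gb gbP] k : exists g, supported_homeo (obox (lo2 k) (hi2 k)) g /\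
    forall x : V, cbox (m1 k) (m2 k) x -> [/\ cbox (T1 k) (T2 k) (g x),
      forall d, x 0 d = m1 k d -> g x 0 d = T1 k d
    & forall d, x 0 d = m2 k d -> g x 0 d = T2 k d].
  have [d|d|g ? ?] := @box_move R n (lo2 k) (hi2 k) (m1 k) (m2 k) (T1 k) (T2 k);
    last by exists g.
    have := TT k d; have := alr k d; have := Tb k.
    rewrite /lo2 /hi2 /m1 /m2 /ifa /ifb; case: (eqVneq d be) => [->|_].
      by rewrite (negbTE beal) => -[-> ->] _ _; split; lra.
    by case: eqP => // _ _ [? ?] _; split; lra.
  have := TT k d; have := Tb k; rewrite /lo2 /hi2 /ifb; case: eqP => // ->.
  by move=> [-> ->] _; split; lra.
have in1 k (x : V) : obox (lo1 k) (hi1 k) x -> `|x 0 al - a k| < 2 * w1 /\ `|x| < r.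
  move=> xW; split.
    by have := xW al; rewrite /lo1 /hi1 /ifa eqxx ltr_distl.
  apply/rV_norm_ltP => // c; rewrite ltr_norml; have := xW c.
  rewrite /lo1 /hi1 /ifa; case: eqP => // _ /andP[? ?]; have := ar k.
  by move=> ?; apply/andP; split; lra.
have in2 k (x : V) : obox (lo2 k) (hi2 k) x -> `|x 0 be - b k| < 2 * w2 /\ `|x| < r.
  move=> xW; split.
    by have := xW be; rewrite /lo2 /hi2 /ifb eqxx ltr_distl.
  apply/rV_norm_ltP => // c; rewrite ltr_norml; have := xW c.
  rewrite /lo2 /hi2 /ifb; case: eqP => // _ /andP[? ?]; have := br k.
  by move=> ?; apply/andP; split; lra.
have far (p q u w : R) : `|u - p| < 2 * w -> `|u - q| < 2 * w -> ~ (4 * w < `|p - q|).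
  move=> up uq; apply/negP; rewrite -leNgt.
  have -> : p - q = (u - q) - (u - p) by ring.
  by apply: le_trans (ler_normB _ _) _; lra.
have [k|k l x /in1[xk _] /in1[xl _]|e e0|Ga GaW GaE] :=
    @supported_homeo_bigcup R n K (fun k => obox (lo1 k) (hi1 k)) ga.
- by case: (gaP k).
- by apply/eqP; apply/negPn/negP => kl; exact: far xk xl (aa _ _ kl).
- by exists (enum K) => i; rewrite mem_enum.
have [k|k l x /in2[xk _] /in2[xl _]|e e0|Gb GbW GbE] :=
    @supported_homeo_bigcup R n K (fun k => obox (lo2 k) (hi2 k)) gb.
- by case: (gbP k).
- by apply/eqP; apply/negPn/negP => kl; exact: far xk xl (bb _ _ kl).
- by exists (enum K) => i; rewrite mem_enum.
exists (Gb \o Ga).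
  apply: supported_homeo_comp.
    by apply: supported_homeo_sub GaW => x [k _ /in1[xk xr]]; split=> //; exists k; left.
  by apply: supported_homeo_sub GbW => x [k _ /in2[xk xr]]; split=> //; exists k; right.
move=> k x xal xE.
have xe : cbox (e1 k) (e2 k) x.
  by move=> c; rewrite /e1 /e2 /ifa; case: eqP => [->|/eqP] //; exact: xE.
have xlo : obox (lo1 k) (hi1 k) x.
  move=> c; have := xe c; rewrite /e1 /e2 /lo1 /hi1 /ifa; have := EE c.
  by case: eqP => _ [? ? ?] /andP[? ?]; apply/andP; split; lra.
have [_ /(_ _ xe) [h1 h2 h3]] := gaP k.
have gxlo : obox (lo2 k) (hi2 k) (ga k x).
  move=> c; have := h1 c; rewrite /m1 /m2 /lo2 /hi2 /ifa /ifb.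
  have := Tb k; have := TT k c; have := alr k c; rewrite /ifa.
  have := beal; case: (eqVneq c be) => [->|_] _.
    case: eqP => [e|_]; first by rewrite e eqxx in beal.
    by move=> _ _ [-> ->] /andP[? ?]; apply/andP; split; lra.
  by case: eqP => _ ? [? ? ?] _ /andP[? ?]; apply/andP; split; lra.
have [_ /(_ _ h1) [h4 h5 h6]] := gbP k.
rewrite /= (GaE k) // (GbE k) //; split => //.
  by move=> xa; apply: h5; rewrite h2 ?xa /e1 /ifa ?eqxx.
by move=> xa; apply: h6; rewrite h3 ?xa /e2 /ifa ?eqxx.
Qed.

End Transport.

(** * A horseshoe at one scale *)

Definition shell (R : realType) (n : nat) (r' r : R) : set 'rV[R]_n :=
  [set x | r' <= `|x| < r].

(** A topological horseshoe with [m ^ n] legs more than [eps] apart, in the weak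
sense that suffices for counting orbits: every itinerary is followed by some
orbit. The legs are labelled by the cells of a cubic lattice. *)
Definition full_horseshoe (R : realType) (T : Type) (dist : T -> T -> R)
    (f : T -> T) (n m : nat) (eps : R) (Q : {ffun 'I_n -> 'I_m} -> set T) : Prop :=
  (forall i j x y, i != j -> Q i x -> Q j y -> eps < dist x y) /\
  (forall a : nat -> {ffun 'I_n -> 'I_m}, exists x, forall k, Q (a k) (iter k f x)).

(** As [C / eps] is [4 * C / r * m], one factor [m] on the right absorbs the
constant once [m] is large. *)
Lemma scale_exists (R : realType) (C r : R) (j : nat) : 0 < C -> 0 < r ->
  exists m : nat, let eps : R := r / (4 * m%:R) in
    [/\ (0 < m)%N, eps < j.+1%:R^-1 & (C / eps) ^+ j <= m%:R ^+ j.+1].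
Proof.
move=> C0 r0.
pose B : R := Num.max (r * j.+1%:R) ((4 * C / r) ^+ j).
have [m mB] : exists m : nat, B < m%:R.
  exists (Num.bound B); apply: archi_boundP.
  by rewrite le_max exprn_ge0 ?orbT // divr_ge0 ?mulr_ge0 // ltW.
have B0 : 0 < B by rewrite lt_max mulr_gt0.
have m0 : 0 < m%:R :> R by apply: lt_trans mB.
exists m; split; first by rewrite -(ltr0n R).
  have : r * j.+1%:R < m%:R by apply: le_lt_trans mB; rewrite le_max lexx.
  move=> h; rewrite ltr_pdivrMr ?mulr_gt0 // -ltr_pdivrMl ?invr_gt0 ?ltr0n // invrK.
  lra.
have -> : C / (r / (4 * m%:R)) = (4 * C / r) * m%:R.
  by field; rewrite !gt_eqF.
rewrite exprMn exprS ler_pM2r ?exprn_gt0 //; apply: ltW; apply: le_lt_trans mB.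
by rewrite le_max lexx orbT.
Qed.

Section Step.
Context {R : realType} {n : nat}.
Local Notation V := 'rV[R]_n.

(** The tubes have width at most [3 * l / 2], and the lattice has step [4 * l],
which leaves gaps larger than [l]. *)
Lemma lattice_tubes (z : V) (m : nat) (l : R) : (0 < m)%N -> 0 < l ->
  exists u : {ffun 'I_n -> 'I_m} -> V,
  [/\ forall i c, z 0 c <= u i 0 c,
      forall i c, u i 0 c + 4 * l <= z 0 c + 4 * l * m%:R,
      forall i (x : V), (forall c, u i 0 c - l / 2 <= x 0 c <= u i 0 c + l) ->
        `|x - z| < 4 * l * m%:R &
      forall i j (x y : V), i != j ->
        (forall c, u i 0 c - l / 2 <= x 0 c <= u i 0 c + l) ->
        (forall c, u j 0 c - l / 2 <= y 0 c <= u j 0 c + l) -> l < `|x - y|].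
Proof.
move=> m_gt0 l0; pose u (i : {ffun 'I_n -> 'I_m}) : V := \row_c (z 0 c + 4 * l * (i c)%:R).
have l40 : 0 < 4 * l by rewrite mulr_gt0.
have uc i c : u i 0 c = z 0 c + 4 * l * (i c)%:R by rewrite mxE.
have natS (p q : nat) : (p < q)%N -> 4 * l * p%:R + 4 * l <= 4 * l * q%:R.
  by move=> pq; rewrite -[X in _ + X]mulr1 -mulrDr ler_pM2l // natr1 ler_nat.
have u1 i c : z 0 c <= u i 0 c by rewrite uc lerDl mulr_ge0 ?ler0n // ltW.
have u2 i c : u i 0 c + 4 * l <= z 0 c + 4 * l * m%:R.
  by rewrite uc -addrA lerD2l natS.
have gap (i j : {ffun 'I_n -> 'I_m}) c (p q : R) : (i c < j c)%N ->
    u i 0 c - l / 2 <= p <= u i 0 c + l -> u j 0 c - l / 2 <= q <= u j 0 c + l ->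
    l < q - p.
  move=> ij; have := natS _ _ ij; rewrite !uc => h /andP[_ h1] /andP[h2 _].
  by clear -h h1 h2 l0; lra.
exists u; split => // [i x xu|i j x y ij xu yu].
  have m0 : 0 < 4 * l * m%:R by rewrite mulr_gt0 ?ltr0n.
  apply/rV_norm_ltP => // c; rewrite !mxE ltr_norml.
  have /andP[h1 h2] := xu c; have := u1 i c; have := u2 i c.
  by clear -h1 h2 l0 => h3 h4; apply/andP; split; lra.
have [c ic] : exists c, i c != j c.
  apply: contrapT => h; move/eqP: ij; apply; apply/ffunP => c.
  by apply/eqP; apply: contrapT => ic; apply: h; exists c; apply/negP.
apply: lt_le_trans (rV_entry_le (x - y) c); rewrite !mxE.
have [ii|ii|e] := ltngtP (i c) (j c); last by case/eqP: ic; exact: val_inj.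
  by rewrite distrC; apply: lt_le_trans (ler_norm _); exact: gap ii (xu c) (yu c).
by apply: lt_le_trans (ler_norm _); exact: gap ii (yu c) (xu c).
Qed.

(** The point [z] is taken on the diagonal, and [al] is a coordinate of [phi z]
that does not vanish. Near [phi z] the coordinate [al], and near [z] the
coordinate [be], stay away from 0: slabs at such levels of these coordinates
avoid a ball around 0, which keeps the support of the folding map in a shell. *)
Lemma source_and_target (phi : V -> V) (rho r : R) : (2 <= n)%N ->
  (forall x : V, `|x| < rho -> {for x, continuous phi}) ->
  (forall x y : V, `|x| < rho -> `|y| < rho -> phi x = phi y -> x = y) ->
  phi 0 = 0 -> 0 < r -> r <= rho ->
  exists (z : V) (al be : 'I_n) (eta r' r1 : R),
  [/\ be != al, [/\ 0 < r1, 0 < eta, 0 < r' & r' < r],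
    forall x : V, `|x - z| < r1 -> `|x| < r /\ `|phi x - phi z| < eta,
    forall c, `|phi z 0 c| + eta < r /\ `|z 0 c| + r1 < r &
    (forall s, `|s - phi z 0 al| < eta -> r' <= `|s|) /\
    (forall s, `|s - z 0 be| < r1 -> r' <= `|s|)].
Proof.
move=> n_ge2 phi_cont phi_inj phi0 r0 r_rho.
have n0 : (0 < n)%N by apply: leq_trans n_ge2.
have phi_c0 : {for 0, continuous phi}.
  by apply: phi_cont; rewrite normr0; exact: lt_le_trans r0 r_rho.
have r20 : 0 < r / 2 by lra.
have /(@continuous_epsdelta R V V) /(_ _ r20) [d0 d00 d0P] := phi_c0.
have [t [t0 tr td0]] : exists t : R, [/\ 0 < t, t <= r / 3 & t < d0].
  exists (Num.min (d0 / 2) (r / 3)); rewrite lt_min ge_min gt_min lexx orbT.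
  by split => //; [apply/andP; split; lra|apply/orP; left; lra].
(* all coordinates of [z] are nonzero, so that [be] may be any coordinate other
   than [al] *)
pose z : V := const_mx t.
have zc c : z 0 c = t by rewrite mxE.
have zt : `|z| <= t.
  by apply/rV_norm_leP; [exact: ltW|move=> c; rewrite zc ger0_norm // ltW].
have yr : `|phi z| < r / 2.
  by have := d0P z; rewrite phi0 !subr0; apply; exact: le_lt_trans zt td0.
have z_rho : `|z| < rho by lra.
have [al yal] : exists al, phi z 0 al != 0.
  apply: rV_neq0; apply/eqP => y0.
  have z0 : z = 0 by apply: phi_inj => //; [rewrite normr0; lra|rewrite phi0].
  by move: t0; rewrite -(zc (Ordinal n0)) z0 mxE ltxx.
have [be beal] : exists be : 'I_n, be != al.
  apply: contrapT => h; have h1 i : i = al.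
    by apply/eqP; apply: contrapT => /negP ia; apply: h; exists i.
  have : Ordinal n0 = Ordinal n_ge2 by rewrite (h1 (Ordinal n0)) (h1 (Ordinal n_ge2)).
  by move/(congr1 val).
have ya0 : 0 < `|phi z 0 al| by rewrite normr_gt0.
have [q [q0 qt qy]] : exists q : R, [/\ 0 < q, q <= t & q <= `|phi z 0 al|].
  by exists (Num.min t `|phi z 0 al|); rewrite lt_min t0 !ge_min !lexx orbT.
have eta0 : 0 < q / 4 by clear -q0; lra.
have phi_cz := phi_cont _ z_rho.
have /(@continuous_epsdelta R V V) /(_ _ eta0)[d1 d10 d1P] := phi_cz.
have [r1 [r10 r1d r1q]] : exists r1 : R, [/\ 0 < r1, r1 <= d1 & r1 <= q / 4].
  by exists (Num.min d1 (q / 4)); rewrite lt_min d10 eta0 !ge_min !lexx orbT.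
exists z, al, be, (q / 4), (q / 2), r1; split => //.
- by clear -r10 eta0 q0 qt tr t0; split; lra.
- move=> x xz; split; last by apply: d1P; lra.
  have -> : x = (x - z) + z by rewrite subrK.
  by apply: le_lt_trans (ler_normD _ _) _; lra.
- move=> c; have := rV_entry_le z c; have := rV_entry_le (phi z) c.
  by clear -zt yr tr qt r1q t0 r0; split; lra.
split=> s.
  move=> sy; have : `|phi z 0 al| <= `|s| + `|s - phi z 0 al|.
    have {1}-> : phi z 0 al = s - (s - phi z 0 al) by ring.
    exact: ler_normB.
  by clear -sy qy q0; lra.
rewrite zc ltr_distl => /andP[h1 h2]; apply: le_trans (ler_norm _).
by clear -h1 h2 r1q qt q0; lra.
Qed.

(** The tube [Q i] starts at the corner [u i], has length [l] along the axis
[al], and half-width [tau] in the other directions, so small that [phi] varies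
by less than [w1] on each of its two ends. Hence the image of any path joining
these ends crosses, for every [k], the slab of half-width [w1] around the level
reserved for the pair [(i, k)], and [box_transport] sends the part of the image
in this slab across [Q k], faces to faces. *)
Lemma fold_map (phi : V -> V) (z y : V) (al be : 'I_n) (r r' eta l : R) (m : nat)
    (u : {ffun 'I_n -> 'I_m} -> V) :
  be != al -> 0 < l -> 0 < eta ->
  (forall x : V, `|x - z| < 4 * l * m%:R -> {for x, continuous phi}) ->
  (forall x : V, `|x - z| < 4 * l * m%:R -> `|phi x - y| < eta) ->
  (forall c, `|y 0 c| + eta < r) -> (forall c, `|z 0 c| + 4 * l * m%:R < r) ->
  (forall s, `|s - y 0 al| < eta -> r' <= `|s|) ->
  (forall s, `|s - z 0 be| < 4 * l * m%:R -> r' <= `|s|) ->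
  (forall i c, z 0 c <= u i 0 c) ->
  (forall i c, u i 0 c + 4 * l <= z 0 c + 4 * l * m%:R) ->
  (forall i (x : V), (forall c, u i 0 c - l / 2 <= x 0 c <= u i 0 c + l) ->
        `|x - z| < 4 * l * m%:R) ->
  (forall i j (x y : V), i != j ->
        (forall c, u i 0 c - l / 2 <= x 0 c <= u i 0 c + l) ->
        (forall c, u j 0 c - l / 2 <= y 0 c <= u j 0 c + l) -> l < `|x - y|) ->
  (forall i, phi (u i) 0 al != phi (u i + l *: delta_mx 0 al) 0 al) ->
  exists2 g, supported_homeo (@shell R n r' r) g &
  exists2 Q : {ffun 'I_n -> 'I_m} -> set V,
    forall i x, Q i x -> `|x - z| < 4 * l * m%:R &
    full_horseshoe (fun x y : V => `|x - y|) (g \o phi) l Q.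
Proof.
move=> beal l0 eta0 phic phiD yr zr near_y near_z u1 u2 tube sep uv.
set r1 := 4 * l * m%:R in phic phiD zr near_z u2 tube *.
pose I : finType := {ffun 'I_n -> 'I_m}.
pose v (i : I) : V := u i + l *: delta_mx 0 al.
have vc i c : v i 0 c = u i 0 c + l *+ (c == al) by rewrite mxE delta_mx_entry.
have uD i : `|u i - z| < r1.
  by apply: (tube i) => c; clear -l0; apply/andP; split; lra.
have vD i : `|v i - z| < r1.
  apply: (tube i) => c; rewrite vc; clear -l0.
  by case: eqP => _ /=; rewrite ?mulr1n ?mulr0n; apply/andP; split; lra.
pose A i := Num.min (phi (u i) 0 al) (phi (v i) 0 al).
pose B i := Num.max (phi (u i) 0 al) (phi (v i) 0 al).
have AB i : A i < B i.
  by rewrite gt_min !lt_max !ltxx /= orbF -neq_lt uv.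
have entry_y (x : V) c : `|x - z| < r1 -> `|phi x 0 c - y 0 c| < eta.
  move=> xz; apply: le_lt_trans (phiD _ xz).
  by have := rV_entry_le (phi x - y) c; rewrite !mxE.
have AB_y i s : A i < s -> s < B i -> `|s - y 0 al| < eta.
  have := entry_y _ al (uD i); have := entry_y _ al (vD i).
  rewrite /A /B gt_min lt_max !ltr_distl; clear.
  by move=> /andP[? ?] /andP[? ?] /orP[] ? /orP[] ?; apply/andP; split; lra.
(* one level for each pair made of a source tube and a target tube *)
pose K : finType := (I * I)%type.
have [a [w1 [w10 aAB aa]]] :=
  @separated_representatives R K (fun k => A k.1) (fun k => B k.1) (fun k => AB k.1).
have /choice[d dP] i : exists d : R, 0 < d /\
    (forall x, `|x - u i| < d -> `|phi x - phi (u i)| < w1) /\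
    (forall x, `|x - v i| < d -> `|phi x - phi (v i)| < w1).
  have /(@continuous_epsdelta R V V) /(_ _ w10)[da da0 daP] := phic _ (uD i).
  have /(@continuous_epsdelta R V V) /(_ _ w10)[db db0 dbP] := phic _ (vD i).
  exists (Num.min da db); split; first by rewrite lt_min da0.
  by split => x; rewrite lt_min => /andP[? ?]; [exact: daP|exact: dbP].
have [|dd dd0 ddP] := @finite_pos_bound R I d; first by move=> i; case: (dP i).
have [tau [tau0 taud taul]] : exists t : R, [/\ 0 < t, t < dd & t <= l / 2].
  exists (Num.min (dd / 2) (l / 2)); rewrite lt_min ge_min gt_min lexx orbT.
  by clear -dd0 l0; split => //; [apply/andP; split; lra|apply/orP; left; lra].
have [k|b [w2 [w20 bAB bb]]] := @separated_representatives R K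
  (fun k => u k.2 0 be - tau) (fun k => u k.2 0 be + tau).
  by clear -tau0; lra.
pose T1 (k : K) c := if c == al then u k.2 0 al else
  if c == be then b k - w2 else u k.2 0 c - tau.
pose T2 (k : K) c := if c == al then u k.2 0 al + l else
  if c == be then b k + w2 else u k.2 0 c + tau.
have ur i c s : u i 0 c - tau < s -> s < u i 0 c + 2 * l -> - r < s /\ s < r.
  move=> h1 h2; have := zr c; have := u1 i c; have := u2 i c.
  have := ler_norm (z 0 c); have := ler_norm (- z 0 c); rewrite normrN.
  by clear -h1 h2 taul tau0 l0 => *; split; lra.
have abs_r s c : `|s - y 0 c| <= eta -> - r < s /\ s < r.
  have := yr c; have := ler_norm (y 0 c); have := ler_norm (- y 0 c).
  by rewrite normrN ler_distl; clear -eta0 => ? ? ? /andP[? ?]; split; lra.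
have [//|//|//|//|k|k|c|k c|k|g2 g2W g2P] := @box_transport R n K al be r
  (fun c => y 0 c - eta) (fun c => y 0 c + eta) a b w1 w2 T1 T2 beal.
- have [h1 h2] := aAB k.
  have h3 : a k - 2 * w1 < B k.1 by clear -w10 h2; lra.
  have h4 : A k.1 < a k + 2 * w1 by clear -w10 h1; lra.
  have /ltW/abs_r[? _] := AB_y _ _ h1 h3.
  by have /ltW/abs_r[_ ?] := AB_y _ _ h4 h2.
- have [h1 h2] := bAB k; split.
    by apply: proj1 (ur k.2 be _ h1 _); clear -h2 w20 l0 taul; lra.
  by apply: proj2 (ur k.2 be _ _ _); clear -h1 h2 w20 l0 taul; lra.
- split; last by case: (abs_r (y 0 c + eta) c); rewrite // addrC addKr ger0_norm // ltW.
    by case: (abs_r (y 0 c - eta) c); rewrite // addrC addKr normrN ger0_norm // ltW.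
  by clear -eta0; lra.
- have ur' := ur k.2; rewrite /T1 /T2; case: eqP => _; [|case: eqP => _].
  + split; [apply: proj1 (ur' al _ _ _)| |apply: proj2 (ur' al _ _ _)];
    by clear -l0 tau0; lra.
  + have [h1 h2] := bAB k.
    by split; [apply: proj1 (ur' be _ _ _)| |apply: proj2 (ur' be _ _ _)];
    clear -l0 taul tau0 h1 h2 w20; lra.
  + have := u1 k.2 c; have := u2 k.2 c; have := zr c.
    have := ler_norm (z 0 c); have := ler_norm (- z 0 c); rewrite normrN.
    have z0 : 0 <= `|z 0 c| by [].
    by clear -l0 taul tau0 => *; split; lra.
- by rewrite /T1 /T2 (negbTE beal) eqxx.
pose Q (i : I) : set V := cbox
  (fun c => if c == al then u i 0 al else u i 0 c - tau)
  (fun c => if c == al then u i 0 al + l else u i 0 c + tau).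
have Qtube i x : Q i x -> forall c, u i 0 c - l / 2 <= x 0 c <= u i 0 c + l.
  move=> Qx c; have := Qx c; clear -l0 taul tau0.
  by case: eqP => [->|_] /andP[? ?]; apply/andP; split; lra.
have QD i x : Q i x -> `|x - z| < r1 by move=> /Qtube; exact: tube.
exists g2.
  apply: supported_homeo_sub g2W => x [xr [k xk]]; rewrite /shell /= xr andbT.
  case: xk => xk.
    apply: le_trans (rV_entry_le x al); apply: near_y.
    have [h1 h2] := aAB k; move: xk; rewrite ltr_distl => /andP[h3 h4].
    by apply: (AB_y k.1); [clear -h1 h3; lra|clear -h2 h4; lra].
  apply: le_trans (rV_entry_le x be); apply: near_z.
  have [h1 h2] := bAB k; have := u1 k.2 be; have := u2 k.2 be.
  move: xk; rewrite !ltr_distl => /andP[h3 h4] h5 h6.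
  clear -h1 h2 h3 h4 h5 h6 l0 taul tau0.
  by apply/andP; split; lra.
exists Q => //; split; first by move=> i j x x' ij /Qtube Qx /Qtube Qx'; exact: sep ij Qx Qx'.
(* joining the two ends of the tube [i] inside it, in either direction *)
pose cross (i : I) (p : R -> V) (s s' : R) := [/\ s <= s',
  forall x, s <= x <= s' -> {for x, continuous p} /\ Q i (p x),
  exists2 x, s <= x <= s' & p x 0 al = u i 0 al &
  exists2 x, s <= x <= s' & p x 0 al = u i 0 al + l].
have near_end (x w : V) c : (forall x, `|x - w| < d c -> `|phi x - phi w| < w1) ->
    (forall c, `|x 0 c - w 0 c| <= tau) -> `|phi x 0 al - phi w 0 al| < w1.
  move=> h xw; apply: le_lt_trans (h x _).
    by have := rV_entry_le (phi x - phi w) al; rewrite !mxE.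
  apply: lt_le_trans (ddP c); apply: le_lt_trans taud.
  by apply/rV_norm_leP => [|e]; [exact: ltW|rewrite !mxE; exact: xw].
move=> itin.
have := @itinerary R V I (g2 \o phi) Q cross.
move=> /(_ _ _ _ (fun s => u (itin 0) + s *: delta_mx 0 al) 0 l itin).
apply.
- by move=> i p s s' [].
- by move=> i p s s' [_ h _ _] x /h[].
- move=> i k p s s' [ss' pQ [x0 x0s px0] [x1 x1s px1]].
  pose f x := phi (p x) 0 al.
  pose kk : K := (i, k).
  have [aA aB] := aAB kk.
  have fc x : s <= x <= s' -> {for x, continuous f}.
    move=> /pQ[pc Qp].
    apply: (@continuous_comp _ _ _ (phi \o p) (fun w : V => w 0 al)).
      by apply: (@continuous_comp _ V V p phi); [exact: pc|exact/phic/(QD i)].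
    exact: rV_entry_continuous.
  have [du [uP vP]] := dP i.
  have f0 : `|f x0 - phi (u i) 0 al| < w1.
    apply: (near_end _ _ i) => // c; have [_ Qp] := pQ _ x0s.
    rewrite ler_distl; have := Qp c; case: eqP => // -> _.
    by rewrite px0; clear -tau0; apply/andP; split; lra.
  have f1 : `|f x1 - phi (v i) 0 al| < w1.
    apply: (near_end _ _ i) => // c; have [_ Qp] := pQ _ x1s.
    rewrite ler_distl vc; have := Qp c; case: eqP => [-> _|_].
      by rewrite px1 mulr1n; clear -tau0; apply/andP; split; lra.
    by rewrite mulr0n addr0.
  have [s1 [s2 [h1 h2 h3 [[xa xas fxa] [xb xbs fxb]] fP]]] :
     exists s1 s2, [/\ s <= s1, s1 <= s2, s2 <= s',
    (exists2 x, s1 <= x <= s2 & f x = a kk - w1) /\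
    (exists2 x, s1 <= x <= s2 & f x = a kk + w1)
    & forall x, s1 <= x <= s2 -> a kk - w1 <= f x <= a kk + w1].
    have aw : a kk - w1 < a kk + w1 by clear -w10; lra.
    move: f0 f1; rewrite !ltr_distl => /andP[f00 f01] /andP[f10 f11].
    move: aA aB; rewrite /A /B /= -/(v i) => aA aB.
    have [h|h|e] := ltgtP (phi (u i) 0 al) (phi (v i) 0 al); last by move/eqP: (uv i).
      move: aA aB; rewrite (min_l (ltW h)) (max_r (ltW h)) => aA aB.
      have lo : f x0 <= a kk - w1 by clear -f01 aA; lra.
      have hi : a kk + w1 <= f x1 by clear -f10 aB; lra.
      exact: (subpath x0s x1s fc lo aw hi).
    move: aA aB; rewrite (min_r (ltW h)) (max_l (ltW h)) => aA aB.
    have lo : f x1 <= a kk - w1 by clear -f11 aA; lra.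
    have hi : a kk + w1 <= f x0 by clear -f00 aB; lra.
    exact: (subpath x1s x0s fc lo aw hi).
  have sub x : s1 <= x <= s2 -> s <= x <= s'.
    by clear -h1 h3 => /andP[? ?]; apply/andP; split; lra.
  have g2x x : s1 <= x <= s2 -> [/\ cbox (T1 kk) (T2 kk) (g2 (phi (p x))),
     f x = a kk - w1 -> g2 (phi (p x)) 0 al = T1 kk al
     & f x = a kk + w1 -> g2 (phi (p x)) 0 al = T2 kk al].
    move=> xs; apply: g2P; first exact: fP.
    move=> c _; have [_ Qp] := pQ _ (sub _ xs); rewrite -ler_distl.
    exact/ltW/entry_y/(QD _ _ Qp).
  exists s1, s2; split; [exact: h1|exact: h3|split; first exact: h2].
  + move=> x xs; split.
      have [pc Qp] := pQ _ (sub _ xs).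
      have [g2c _ _] := g2W.
      apply: (@continuous_comp _ V V (phi \o p) g2); last exact: g2c.
      by apply: (@continuous_comp _ V V p phi); [exact: pc|exact/phic/(QD i)].
    have [+ _ _] := g2x _ xs; move=> gT c; have := gT c; rewrite /T1 /T2 /=.
    case: eqP => // _; case: eqP => // ->.
    by have [] := bAB kk; clear -w20 => /= ? ? /andP[? ?]; apply/andP; split; lra.
  + by exists xa => //; have [_ + _] := g2x _ xas => /(_ fxa) ->; rewrite /T1 eqxx.
  + by exists xb => //; have [_ _ +] := g2x _ xbs => /(_ fxb) ->; rewrite /T2 eqxx.
- split; first exact: ltW.
  + move=> x /andP[x0 xl]; split.
      apply: (@continuousD R V R (cst (u (itin 0)))); first exact: cvg_cst.
      by apply: (@continuousZr_tmp R V R id); move=> ?.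
    move=> c; rewrite mxE delta_mx_entry; clear -x0 xl tau0; case: eqP => [->|_].
      by rewrite mulr1n; apply/andP; split; lra.
    by rewrite mulr0n addr0; apply/andP; split; lra.
  + exists 0; first by rewrite lexx ltW.
    by rewrite mxE delta_mx_entry mul0rn addr0.
  + exists l; first by rewrite lexx ltW.
    by rewrite mxE delta_mx_entry eqxx mulr1n.
Qed.

(** Before folding, the images of the ends of the tubes are pushed apart in the
coordinate [al], so that the image of each tube spans a nondegenerate interval
of values of this coordinate. *)
Lemma horseshoe_step (phi : V -> V) (rho r C : R) (j : nat) : (2 <= n)%N ->
  (forall x : V, `|x| < rho -> {for x, continuous phi}) ->
  (forall x y : V, `|x| < rho -> `|y| < rho -> phi x = phi y -> x = y) ->
  phi 0 = 0 -> 0 < r -> r <= rho -> 0 < C ->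
  exists (r' : R) (g : V -> V), [/\ 0 < r', r' < r, supported_homeo (@shell R n r' r) g &
    exists (m : nat) (eps : R) (Q : {ffun 'I_n -> 'I_m} -> set V),
    [/\ 0 < eps < j.+1%:R^-1, (C / eps) ^+ j <= m%:R ^+ j.+1,
      forall i x, Q i x -> `|x| < r /\ shell r' r (phi x) &
      full_horseshoe (fun x y : V => `|x - y|) (g \o phi) eps Q]].
Proof.
move=> n_ge2 phi_cont phi_inj phi0 r0 r_rho C0.
have [z [al [be [eta [r' [r1 [beal [r10 eta0 r'0 r'r] Dsmall yz [near_y near_z]]]]]]]] :=
  source_and_target n_ge2 phi_cont phi_inj phi0 r0 r_rho.
have [m [m0 eps_j Cm]] := scale_exists j C0 r10.
set l := r1 / (4 * m%:R) in eps_j Cm.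
have m0R : 0 < m%:R :> R by rewrite ltr0n.
have l0 : 0 < l by rewrite divr_gt0 // mulr_gt0.
have r1l : r1 = 4 * l * m%:R by rewrite /l; field; rewrite gt_eqF.
have [u [u1 u2 tube sep]] := lattice_tubes z m0 l0.
rewrite -r1l in u2 tube.
pose v i : V := u i + l *: delta_mx 0 al.
have uD i : `|u i - z| < r1.
  by apply: (tube i) => c; clear -l0; apply/andP; split; lra.
have vD i : `|v i - z| < r1.
  apply: (tube i) => c; rewrite mxE delta_mx_entry; clear -l0.
  by case: eqP => _ /=; rewrite ?mulr1n ?mulr0n; apply/andP; split; lra.
have in_rho (x : V) : `|x - z| < r1 -> `|x| < rho.
  by move=> /Dsmall[xr _]; exact: lt_le_trans r_rho.
pose I : finType := {ffun 'I_n -> 'I_m}.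
have [||g1 g1W g1P] := @push_apart R n [set x | `|x - phi z| < eta] al
   (map (phi \o u) (enum I) ++ map (phi \o v) (enum I)).
- have -> : [set x : V | `|x - phi z| < eta] = ball (phi z) eta.
    by rewrite -ball_normE; apply/seteqP; split => x /=; rewrite distrC.
  exact: ball_open.
- by move=> x; rewrite mem_cat => /orP[] /mapP[i _ ->]; apply: (Dsmall _ _).2.
have [//|//|//|x xz|x xz|c|c|//|s|//|i c|i x|//|i|g2 g2W [Q QD hQ]] :=
  @fold_map (g1 \o phi) z (phi z) al be r r' eta l m u.
- apply: (@continuous_comp V V V).
    by apply/phi_cont/in_rho; rewrite r1l.
  by have [g1c _ _] := g1W; exact: g1c.
- by apply: (supported_homeo_stable g1W); apply: (Dsmall _ _).2; rewrite r1l.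
- by case: (yz c).
- by rewrite -r1l; case: (yz c).
- by rewrite -r1l; exact: near_z.
- by rewrite -r1l; exact: u2.
- by rewrite -r1l; exact: tube.
- apply: g1P.
  + by rewrite mem_cat; apply/orP; left; apply: map_f; rewrite mem_enum.
  + by rewrite mem_cat; apply/orP; right; apply: (map_f (phi \o v)); rewrite mem_enum.
  + apply/eqP => /phi_inj e.
    have := e (in_rho _ (uD i)) (in_rho _ (vD i)).
    move=> /(congr1 (fun w : V => w 0 al)); rewrite mxE delta_mx_entry eqxx mulr1n.
    by clear -l0; lra.
have g1_shell x : `|x - phi z| < eta -> shell r' r x.
  move=> xy; have xc c : `|x 0 c - phi z 0 c| < eta.
    by apply: le_lt_trans xy; have := rV_entry_le (x - phi z) c; rewrite !mxE.
  rewrite /shell /=; apply/andP; split.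
    by apply: le_trans (rV_entry_le x al); apply: near_y.
  apply/rV_norm_ltP => // c; have [h _] := yz c.
  have -> : x 0 c = (x 0 c - phi z 0 c) + phi z 0 c by rewrite subrK.
  by apply: le_lt_trans (ler_normD _ _) _; have := xc c; clear -h; lra.
exists r', (g2 \o g1); split => //.
  by apply: supported_homeo_comp g2W; exact: supported_homeo_sub g1W.
exists m, l, Q; split => //; first by rewrite l0.
by move=> i x /QD; rewrite -r1l => /Dsmall[xr xy]; split => //; exact: g1_shell.
Qed.

End Step.

(** * Horseshoes at all scales *)

Section AllScales.
Context {R : realType} {n : nat}.
Local Notation V := 'rV[R]_n.

(** An orbit that follows an itinerary through the legs of scale [j] is sent by
[phi] into the shell of that scale at each step, so that the glued map acts on
it as the map of scale [j]. *)
Lemma local_horseshoes (phi : V -> V) (rho C : R) : (2 <= n)%N ->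
  (forall x : V, `|x| < rho -> {for x, continuous phi}) ->
  (forall x y : V, `|x| < rho -> `|y| < rho -> phi x = phi y -> x = y) ->
  phi 0 = 0 -> 0 < rho -> 0 < C ->
  exists2 h, supported_homeo [set x : V | `|x| < rho] h & forall j : nat,
    exists (m : nat) (eps : R) (Q : {ffun 'I_n -> 'I_m} -> set V),
    [/\ 0 < eps < j.+1%:R^-1, (C / eps) ^+ j <= m%:R ^+ j.+1,
      forall i x, Q i x -> `|x| < rho &
      full_horseshoe (fun x y : V => `|x - y|) (h \o phi) eps Q].
Proof.
move=> n_ge2 phi_cont phi_inj phi0 rho0 C0.
have /choice[f fP] (jr : nat * R) : exists rg : R * (V -> V),
    0 < jr.2 -> jr.2 <= rho -> [/\ 0 < rg.1, rg.1 < jr.2,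
      supported_homeo (@shell R n rg.1 jr.2) rg.2 &
      exists (m : nat) (eps : R) (Q : {ffun 'I_n -> 'I_m} -> set V),
      [/\ 0 < eps < jr.1.+1%:R^-1, (C / eps) ^+ jr.1 <= m%:R ^+ jr.1.+1,
      forall i x, Q i x -> `|x| < jr.2 /\ shell rg.1 jr.2 (phi x) &
      full_horseshoe (fun x y : V => `|x - y|) (rg.2 \o phi) eps Q]].
  case: jr => j r /=; have [r0|r0] := ltP 0 r; last first.
    by exists (0, id).
  have [rr|rr] := leP r rho; last by exists (0, id).
  have [r' [g P]] := horseshoe_step j n_ge2 phi_cont phi_inj phi0 r0 rr C0.
  by exists (r', g).
(* each shell lies in the ball that the previous ones enclose, and the bound
   [rho / j.+1] makes them shrink to 0 *)
pose rad := fix rad j : R :=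
  if j is i.+1 then Num.min (f (i, rad i)).1 (rho / j.+1%:R) else rho.
pose in_rad j := (f (j, rad j)).1.
pose g j := (f (j, rad j)).2.
have rad_bounds j : 0 < rad j /\ rad j <= rho.
  elim: j => [|j [IH1 IH2]] //=.
  have [h1 h2 _ _] := fP (j, rad j) IH1 IH2.
  rewrite lt_min h1 divr_gt0 ?ltr0n //; split => //.
  by rewrite ge_min (le_trans (ltW h2)).
have fPj j : [/\ 0 < in_rad j, in_rad j < rad j,
      supported_homeo (@shell R n (in_rad j) (rad j)) (g j) &
      exists (m : nat) (eps : R) (Q : {ffun 'I_n -> 'I_m} -> set V),
      [/\ 0 < eps < j.+1%:R^-1, (C / eps) ^+ j <= m%:R ^+ j.+1,
      forall i x, Q i x -> `|x| < rad j /\ shell (in_rad j) (rad j) (phi x) &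
      full_horseshoe (fun x y : V => `|x - y|) (g j \o phi) eps Q]].
  by have [h1 h2] := rad_bounds j; exact: (fP (j, rad j)).
have radS j : rad j.+1 <= in_rad j by rewrite /= ge_min lexx.
have rad_mono i j : (i <= j)%N -> rad j <= rad i.
  elim: j => [|j IH]; first by rewrite leqn0 => /eqP ->.
  rewrite leq_eqVlt => /predU1P[->//|]; rewrite ltnS => /IH; apply: le_trans.
  by apply: le_trans (radS j) _; case: (fPj j) => _ /ltW.
have rad_small j : rad j <= rho / j.+1%:R.
  by case: j => [|j] /=; rewrite ?divr1 // ge_min lexx orbT.
have disj i j (x : V) : (i < j)%N -> shell (in_rad i) (rad i) x ->
    ~ shell (in_rad j) (rad j) x.
  move=> ij /andP[xi _] /andP[_ xj].
  have : rad j <= in_rad i by apply: le_trans (rad_mono _ _ ij) (radS i).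
  by move=> h; move: (lt_le_trans xj (le_trans h xi)); rewrite ltxx.
have [j|i j x xi xj|e e0|h hW hE] :=
    @supported_homeo_bigcup R n nat (fun j => shell (in_rad j) (rad j)) g.
- by case: (fPj j).
- have [ij|ji|//] := ltngtP i j; first by case: (disj _ _ _ ij xi).
  by case: (disj _ _ _ ji xj).
- pose N := Num.bound (2 * rho / e); exists (iota 0 N) => j.
  rewrite mem_iota add0n leq0n /= -leqNgt => Nj x xj.
  have [_ _ gj _] := fPj j.
  have /andP[_ gxr] := supported_homeo_stable gj xj; case/andP: xj => _ xr.
  have NN : 2 * rho / e < N%:R by apply: archi_boundP; rewrite divr_ge0 ?mulr_ge0 // ltW.
  have : 2 * (rho / j.+1%:R) <= e.
    rewrite mulrA ler_pdivrMr ?ltr0n // -ler_pdivrMl // mulrC.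
    by apply: le_trans (ltW NN) _; rewrite ler_nat ltnW.
  apply: le_trans; apply: le_trans (ler_normB _ _) _.
  move: (rad_small j) gxr xr; move: (rho / _) (rad j) `|g j x| `|x|.
  by clear => *; lra.
exists h.
  apply: supported_homeo_sub hW => x [j _ /andP[_ xr]] /=.
  by apply: lt_le_trans xr _; case: (rad_bounds j).
move=> j; have [_ _ _ [m [eps [Q [h1 h2 h3 [h4 h5]]]]]] := fPj j.
exists m, eps, Q; split => //.
  move=> i x /h3[xr _]; apply: lt_le_trans xr _; by case: (rad_bounds j).
split => // a; have [x xP] := h5 a; exists x => k.
suff -> : iter k (h \o phi) x = iter k (g j \o phi) x by exact: xP.
elim: k => [//|k IH]; rewrite !iterS IH /=; apply: hE.
by case: (h3 _ _ (xP k)).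
Qed.

End AllScales.

(** * Bounds on the upper metric mean dimension *)

Section Counting.
Context {R : realType} {T : choiceType}.

Lemma counting_range_inj (W : finType) (s : W -> T) : injective s ->
  counting (range s) = #|W|%:R%:E :> \bar R.
Proof.
move=> sI; pose F := [fset s w | w in W]%fset.
have rF : range s = [set` F].
  apply/seteqP; split => x /=.
    by move=> [w _ <-]; apply/imfsetP; exists w.
  by move=> /imfsetP[w _ ->]; exists w.
rewrite /counting rF asboolT; last exact: finite_fset.
by rewrite set_fsetK card_imfset //= cardE.
Qed.

Lemma counting_code_le (W : finType) (E : set T) (code : T -> W) :
  (forall x y, E x -> E y -> code x = code y -> x = y) ->
  (counting E <= #|W|%:R%:E :> \bar R)%E.
Proof.
move=> codeI; have [E0|/set0P[x0 Ex0]] := eqVneq E set0.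
  by rewrite /counting E0 asboolT // fset_set0 cardfs0 lee_fin ler0n.
pose s w := if pselect (exists x, E x /\ code x = w) is left H
  then projT1 (cid H) else x0.
pose F := [fset s w | w in W]%fset.
have EF : E `<=` [set` F].
  move=> x Ex /=; apply/imfsetP; exists (code x) => //=.
  rewrite /s; case: pselect => [H|[]]; last by exists x.
  by case: (projT2 (cid H)) => Ey cy; apply: codeI => //; rewrite cy.
have finE : finite_set E by apply: sub_finite_set EF _; exact: finite_fset.
rewrite /counting asboolT // lee_fin ler_nat.
apply: leq_trans (_ : #|` F| <= _)%N; last first.
  by apply: leq_trans (leq_imfset_card _ _ _) _; rewrite /= -cardE.
by apply: fsubset_leq_card; rewrite -[F]set_fsetK -fset_set_sub //; exact: finite_fset.
Qed.

End Counting.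

Section Limsup.
Context {R : realType}.

Lemma limn_esup_ge (u : nat -> \bar R) (c : \bar R) :
  (forall N, exists2 k, (N <= k)%N & (c <= u k)%E) -> (c <= limn_esup u)%E.
Proof.
move=> cu; apply: le_ereal_inf_tmp => _ [A [N _ NA] <-].
have [k Nk ck] := cu N; apply: le_trans ck _; apply: ereal_sup_ubound.
by exists k => //; apply: NA.
Qed.

Lemma limn_esup_le (u : nat -> \bar R) (c : \bar R) N :
  (forall k, (N <= k)%N -> (u k <= c)%E) -> (limn_esup u <= c)%E.
Proof.
move=> cu; apply: ge_ereal_inf.
exists (ereal_sup (u @` [set k | (N <= k)%N])).
  by exists [set k | (N <= k)%N] => //; exists N.
by apply: ge_ereal_sup => _ [k /= Nk <-]; exact: cu.
Qed.

Lemma limf_esup_right_ge (f : R -> \bar R) (c : \bar R) :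
  (forall d : R, 0 < d -> exists2 x, 0 < x < d & (c <= f x)%E) ->
  (c <= limf_esup f 0^'+)%E.
Proof.
move=> cf; apply: le_ereal_inf_tmp => _ [A /nbhs_ballP[d /= d0 dA] <-].
have [x /andP[x0 xd] cx] := cf _ d0; apply: le_trans cx _; apply: ereal_sup_ubound.
by exists x => //; apply: dA => //; rewrite /ball /= sub0r normrN gtr0_norm.
Qed.

Lemma limf_esup_right_le (f : R -> \bar R) (c : \bar R) (d : R) : 0 < d ->
  (forall x, 0 < x < d -> (f x <= c)%E) -> (limf_esup f 0^'+ <= c)%E.
Proof.
move=> d0 cf; apply: ge_ereal_inf.
exists (ereal_sup (f @` [set x | 0 < x < d])).
  exists [set x | 0 < x < d] => //.
  apply/nbhs_ballP; exists d => //= x; rewrite /ball /= sub0r normrN => xd x0.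
  by rewrite x0 (le_lt_trans (ler_norm _) xd).
by apply: ge_ereal_sup => _ [x /= xd <-]; exact: cf.
Qed.

End Limsup.

Section Mdim.
Context {R : realType} {X : metricType R}.
Implicit Types (G : X -> X) (eps : R).

Lemma dyn_dist_ge G k i x y : (i < k)%N ->
  mdist (iter i G x) (iter i G y) <= dyn_dist G k x y.
Proof.
move=> ik; rewrite /dyn_dist; apply/bigmax_geP; right.
by exists (Ordinal ik).
Qed.

(** The [m ^ (n * l)] words of length [l] give as many points, any two of which
are separated at some time [b * P] with [b < l]; orbits are watched during
[P * l] steps, whence the division by [P]. *)
Lemma horseshoe_growth G P n m eps (Q : {ffun 'I_n -> 'I_m} -> set X) :
  (0 < P)%N -> (0 < m)%N -> 0 < eps ->
  full_horseshoe (@mdist R X) (iter P G) eps Q ->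
  (((n%:R * ln m%:R) / P%:R)%:E <= separated_growth G eps)%E.
Proof.
move=> P0 m0 eps0 [Qsep Qit].
pose I : finType := {ffun 'I_n -> 'I_m}.
pose i0 : I := [ffun _ => Ordinal m0].
have cardI : #|I| = (m ^ n)%N by rewrite card_ffun !card_ord.
apply: limn_esup_ge => N; exists (P * N.+1)%N.
  by apply: leq_trans (leqnSn _) _; rewrite leq_pmull.
set l := N.+1.
(* words are prolonged to itineraries by a constant *)
pose ext (w : {ffun 'I_l -> I}) (k : nat) : I := if insub k is Some o then w o else i0.
have /choice[s sP] w := Qit (ext w).
have sep w w' : w != w' -> eps < dyn_dist G (P * l) (s w) (s w').
  move=> ww'; have [b wb] : exists b, w b != w' b.
    apply: contrapT => h; move/eqP: ww'; apply; apply/ffunP => o.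
    by apply/eqP; apply: contrapT => ic; apply: h; exists o; apply/negP.
  have io : (b * P < P * l)%N by rewrite mulnC ltn_pmul2l.
  apply: lt_le_trans (dyn_dist_ge _ _ _ io); rewrite !iterM.
  have e v : ext v b = v b by rewrite /ext valK.
  by apply: (Qsep _ _ _ _ wb); [rewrite -(e w)|rewrite -(e w')]; exact: sP.
have sI : injective s.
  move=> w w' ss; apply/eqP; apply: contraT => /sep; rewrite ss ltNge => /negP; case.
  rewrite /dyn_dist; apply/bigmax_leP; split; first exact: ltW.
  by move=> i _; rewrite mdistxx ltW.
have Nsep : (((m ^ n) ^ l)%:R%:E <= max_separated G (P * l) eps)%E.
  have -> : ((m ^ n) ^ l)%N = #|{ffun 'I_l -> I}| by rewrite card_ffun cardI card_ord.
  rewrite -(counting_range_inj sI).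
  apply: ereal_sup_ubound; exists (range s) => //.
  move=> _ _ [w _ <-] [w' _ <-] ss; apply: sep.
  by apply: contra_notN ss => /eqP ->.
have mn0 : 0 < ((m ^ n) ^ l)%:R :> R by rewrite ltr0n !expn_gt0 m0.
have lnN : ln ((m ^ n) ^ l)%:R = l%:R * (n%:R * ln m%:R) :> R.
  by rewrite !natrX !lnXn ?exprn_gt0 ?ltr0n // !mulr_natl.
have : ((ln ((m ^ n) ^ l)%:R)%:E <= lne (max_separated G (P * l) eps))%E.
  rewrite -lne_EFin // lee_lne // in_itv /= leey andbT ?lee_fin ?ltW //.
  by apply: lt_le_trans Nsep; rewrite lte_fin.
have Pl0 : (0 <= ((P * l)%:R^-1 : R)%:E)%E by rewrite lee_fin invr_ge0 ler0n.
move=> /(lee_wpmul2l Pl0); apply: le_trans.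
rewrite lnN -EFinM lee_fin natrM invfM.
rewrite le_eqVlt; apply/orP; left; apply/eqP; field.
by rewrite !gt_eqF ?ltr0n.
Qed.

(** The inequality between [m] and [eps] says that [ln m / |ln eps|] is at least
[j / (j + 1)]. *)
Lemma upper_mdim_ge G P n : (0 < P)%N ->
  (forall j : nat, exists (m : nat) eps (Q : {ffun 'I_n -> 'I_m} -> set X),
    [/\ 0 < eps < j.+1%:R^-1, (1 / eps) ^+ j <= m%:R ^+ j.+1 &
      full_horseshoe (@mdist R X) (iter P G) eps Q]) ->
  ((n%:R / P%:R)%:E <= upper_mdim G)%E.
Proof.
move=> P0 hs; have P0R : 0 < P%:R :> R by rewrite ltr0n.
apply/lee_addgt0Pr => e e0.
rewrite -leeBlDr // -EFinB.
apply: limf_esup_right_ge => d d0.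
(* large enough for the scale to be less than [d] and the loss [n / P / j.+1]
   less than [e] *)
pose j := (Num.bound (d^-1) + Num.bound (n%:R / P%:R / e) + 1)%N.
have [m [eps [Q [/andP[eps0 epsj] mj hQ]]]] := hs j.
have j1 : (1 <= j)%N by rewrite /j addn1.
have jd : d^-1 < j%:R.
  apply: lt_le_trans (archi_boundP _) _; first by rewrite invr_ge0 ltW.
  by rewrite ler_nat /j -addnA leq_addr.
have je : n%:R / P%:R / e < j%:R.
  apply: lt_le_trans (archi_boundP _) _.
    by rewrite !divr_ge0 ?ler0n // ltW.
  by rewrite ler_nat /j addnAC leq_addl.
have m0 : (0 < m)%N.
  rewrite lt0n; apply: contraTneq mj => ->; rewrite expr0n /= -ltNge.
  by rewrite exprn_gt0 // divr_gt0.
have eps1 : eps < 1.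
  by apply: lt_le_trans epsj _; rewrite invf_le1 ?ltr0n // ler1n.
exists eps.
  rewrite eps0 (lt_trans epsj) // -[ltRHS]invrK ltf_pV2 ?posrE ?invr_gt0 ?ltr0n //.
  by apply: lt_trans jd _; rewrite ltr_nat.
have ln0 : ln eps < 0 by rewrite ln_lt0 // eps0.
have an0 : 0 < `|ln eps| by rewrite normr_gt0 lt_eqF.
have ai0 : (0 <= (`|ln eps|^-1)%:E)%E by rewrite lee_fin invr_ge0.
have /(lee_wpmul2r ai0) := horseshoe_growth P0 m0 eps0 hQ; apply: le_trans.
rewrite -EFinM lee_fin.
have key : j%:R * `|ln eps| <= j.+1%:R * ln m%:R.
  have : ln ((1 / eps) ^+ j) <= ln (m%:R ^+ j.+1).
    by rewrite ler_ln ?posrE ?exprn_gt0 ?divr_gt0 ?ltr0n.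
  rewrite !lnXn ?divr_gt0 ?ltr0n // div1r lnV ?posrE // ltr0_norm //.
  by rewrite -[(- ln eps) *+ j]mulr_natl -[ln m%:R *+ _]mulr_natl.
have jj : 1 - j.+1%:R^-1 <= ln m%:R / `|ln eps|.
  rewrite ler_pdivlMr //.
  have -> : 1 - j.+1%:R^-1 = j%:R / j.+1%:R :> R.
    by rewrite -natr1; field; rewrite natr1 pnatr_eq0.
  by rewrite mulrAC ler_pdivrMr ?ltr0n // [leRHS]mulrC.
have -> : n%:R * ln m%:R / P%:R / `|ln eps| = (n%:R / P%:R) * (ln m%:R / `|ln eps|).
  by field; rewrite !gt_eqF.
apply: le_trans (_ : (n%:R / P%:R) * (1 - j.+1%:R^-1) <= _); last first.
  by apply: ler_wpM2l; rewrite ?divr_ge0 ?ler0n.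
rewrite mulrBr mulr1 lerD2l lerN2 ler_pdivrMr ?ltr0n //.
move: je; rewrite ltr_pdivrMr // => je; apply: le_trans (ltW je) _.
by rewrite mulrC ler_pM2l // ler_nat.
Qed.

(** Two points of a separated set have different itineraries with respect to a
cover by sets of diameter at most [eps], so the growth rate is at most the
logarithm of the size of the cover; the constant [C] disappears after division
by [|ln eps|]. *)
Lemma upper_mdim_le G n (C : R) (x0 : X) :
  (forall eps, 0 < eps < 1 -> exists (K : finType) (c : X -> K),
     #|K|%:R <= C * (eps^-1) ^+ n /\ forall x y, c x = c y -> mdist x y <= eps) ->
  (upper_mdim G <= n%:R%:E)%E.
Proof.
move=> cov; apply/lee_addgt0Pr => e e0.
pose D := Num.max 1 C.
have D1 : 1 <= D by rewrite le_max lexx.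
(* for [eps < d] the constant contributes [ln D], at most [e * |ln eps|] *)
pose d := Num.min 1 (expR (- (ln D / e))).
have d0 : 0 < d by rewrite lt_min ltr01 expR_gt0.
apply: (limf_esup_right_le d0) => eps /andP[eps0 epsd].
have eps1 : eps < 1 by apply: lt_le_trans epsd _; rewrite ge_min lexx.
have [|K [c [cardK cP]]] := cov eps; first by rewrite eps0.
have K0 : (0 < #|K|)%N by apply/card_gt0P; exists (c x0).
have K0R : 0 < #|K|%:R :> R by rewrite ltr0n.
have sepK k : (max_separated G k eps <= (#|K| ^ k)%:R%:E)%E.
  apply: ge_ereal_sup => _ [E Esep <-].
  have -> : (#|K| ^ k)%N = #|{ffun 'I_k -> K}| by rewrite card_ffun card_ord.
  apply: (@counting_code_le R X _ E (fun x => [ffun i : 'I_k => c (iter i G x)])).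
  move=> x y Ex Ey /ffunP cxy; apply: contrapT => /(Esep _ _ Ex Ey); apply/negP.
  rewrite -leNgt; apply/bigmax_leP; split; first exact: ltW.
  by move=> i _; apply: cP; have := cxy i; rewrite !ffunE.
have growth : (separated_growth G eps <= (ln #|K|%:R)%:E)%E.
  apply: (@limn_esup_le _ _ _ 1%N) => k k0.
  have kR : 0 < k%:R :> R by rewrite ltr0n.
  have : (lne (max_separated G k eps) <= (k%:R * ln #|K|%:R)%:E)%E.
    have -> : k%:R * ln #|K|%:R = ln ((#|K| ^ k)%:R) :> R.
      by rewrite natrX lnXn // -[RHS]mulr_natl.
    rewrite -lne_EFin ?ltr0n ?expn_gt0 ?K0 // lee_lne // in_itv /= leey andbT.
      apply: ereal_sup_ubound; exists set0 => //.
      by rewrite /counting asboolT // fset_set0 cardfs0.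
    by rewrite lee_fin ler0n.
  have ki0 : (0 <= (k%:R^-1 : R)%:E)%E by rewrite lee_fin invr_ge0 ler0n.
  move=> /(lee_wpmul2l ki0)/le_trans; apply.
  by rewrite -EFinM lee_fin mulrA mulVf ?mul1r // gt_eqF.
have ln0 : ln eps < 0 by rewrite ln_lt0 // eps0.
have an0 : 0 < `|ln eps| by rewrite normr_gt0 lt_eqF.
have ai0 : (0 <= (`|ln eps|^-1)%:E)%E by rewrite lee_fin invr_ge0.
move: growth => /(lee_wpmul2r ai0)/le_trans; apply.
rewrite -EFinM -EFinD lee_fin ler_pdivrMr // mulrDl.
have lnK : ln #|K|%:R <= ln D + n%:R * `|ln eps|.
  have le1 : #|K|%:R <= D * (eps^-1) ^+ n.
    apply: le_trans cardK _; apply: ler_wpM2r; last by rewrite le_max lexx orbT.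
    by rewrite exprn_ge0 // invr_ge0 ltW.
  have D0 : 0 < D by apply: lt_le_trans D1.
  apply: le_trans (_ : ln (D * (eps^-1) ^+ n) <= _).
    by rewrite ler_ln ?posrE // mulr_gt0 // exprn_gt0 // invr_gt0.
  rewrite lnM ?posrE ?exprn_gt0 ?invr_gt0 // lnXn ?invr_gt0 // lnV ?posrE //.
  by rewrite ltr0_norm // -[(- ln eps) *+ n]mulr_natl.
apply: le_trans lnK _; rewrite addrC lerD2l.
have : eps < expR (- (ln D / e)) by apply: lt_le_trans epsd _; rewrite ge_min lexx orbT.
move=> /ltW; rewrite -ler_ln ?posrE ?expR_gt0 // expRK ltr0_norm //.
by rewrite lerNr ler_pdivrMr // mulrC.
Qed.

End Mdim.

(** * Differentiability of C1 maps *)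

Section C1.
Context {R : realType}.

Lemma differentiable_epsdelta (V W : normedModType R) (f : V -> W)
    (df : {linear V -> W}) (x : V) : continuous df ->
  (forall e : R, 0 < e -> exists2 d, 0 < d &
    forall h, `|h| < d -> `|f (h + x) - f x - df h| <= e * `|h|) ->
  differentiable f x /\ 'd f x = df :> (V -> W).
Proof.
move=> dfc H.
have E : f \o shift x = cst (f x) + df +o_ 0 id.
  apply/eqaddoP => e e0; have [d d0 dP] := H _ e0.
  apply/nbhs_ballP; exists d => //= h; rewrite -ball_normE /= sub0r normrN => hd.
  by have := dP _ hd; rewrite /= -[X in _ -> `|X| <= _]/(f (h + x) - (f x + df h)) opprD addrA.
have D := diff_unique dfc E; split => //.
by apply/diff_locallyP; rewrite D.
Qed.

Lemma mvt_line (f f' : R -> R) (t e D : R) :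
  (forall s : R, `|s| <= `|t| -> is_derive s 1 f (f' s)) ->
  (forall s : R, `|s| <= `|t| -> `|f' s - D| <= e) ->
  `|f t - f 0 - t * D| <= e * `|t|.
Proof.
move=> df f'D.
have within (a b : R) : - `|t| <= a -> b <= `|t| -> {within `[a, b], continuous f}.
  move=> ha hb; apply: derivable_within_continuous => s.
  rewrite in_itv /= => /andP[? ?]; have [] := df s => //.
  by rewrite ler_norml; apply/andP; split; lra.
have [t0|t0] := leP 0 t.
  have tE : `|t| = t by rewrite ger0_norm.
  have [s||s sI ->] := @MVT_segment R f f' 0 t t0.
  - rewrite in_itv /= => /andP[? ?]; apply: df.
    by rewrite tE ger0_norm ltW.
  - by apply: within; rewrite ?tE //; lra.
  - move: sI; rewrite in_itv /= => /andP[s0 st].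
    rewrite subr0 (mulrC t) -mulrBl normrM tE; apply: ler_wpM2r => //.
    by apply: f'D; rewrite tE ger0_norm.
have tE : `|t| = - t by rewrite ltr0_norm.
have [s||s sI E] := @MVT_segment R f f' t 0 (ltW t0).
- rewrite in_itv /= => /andP[? ?]; apply: df.
  by rewrite tE ltr0_norm // lerN2 ltW.
- by apply: within; rewrite ?tE ?opprK //; lra.
- move: sI; rewrite in_itv /= => /andP[ts s0].
  have -> : f t - f 0 - t * D = (f' s - D) * t.
    by rewrite -(opprB (f 0)) E; ring.
  rewrite normrM; apply: ler_wpM2r => //.
  by apply: f'D; rewrite tE ler0_norm // lerN2.
Qed.

Lemma is_derive_line (V W : normedModType R) (f : V -> W) (y v : V) (s : R) :
  derivable f (y + s *: v) v ->
  is_derive s 1 (fun s => f (y + s *: v)) ('D_v f (y + s *: v)).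
Proof.
have E : (fun h : R => h^-1 *: (((fun s => f (y + s *: v)) \o shift s) (h *: 1) -
    f (y + s *: v))) =
  (fun h => h^-1 *: ((f \o shift (y + s *: v)) (h *: v) - f (y + s *: v))).
  apply/funext => h /=; rewrite [h *: 1]mulr1; congr (_ *: (f _ - _)).
  by rewrite scalerDl addrCA.
by move=> df; split; [rewrite /derivable E|rewrite /derive E].
Qed.

Lemma rV_decomp n (h : 'rV[R]_n) : h = \sum_c h 0 c *: delta_mx 0 c.
Proof. by rewrite {1}(row_sum_delta h). Qed.

(** The increment of [f] is split along the axes; each part is estimated by the
mean value theorem and the continuity of the corresponding partial
derivative. *)
Lemma C1_differentiable n k (f : 'rV[R]_n -> 'rV[R]_k) (U : set 'rV[R]_n) x :
  open U -> U x ->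
  (forall c y, U y -> derivable f y (delta_mx 0 c)) ->
  (forall c, {for x, continuous (fun y => 'D_(delta_mx 0 c) f y)}) ->
  differentiable f x /\ forall v, 'd f x v = \sum_c v 0 c *: 'D_(delta_mx 0 c) f x.
Proof.
move=> Uo Ux dfU dfc.
pose V := 'rV[R]_n; pose W := 'rV[R]_k.
pose L (v : V) : W := \sum_c v 0 c *: 'D_(delta_mx 0 c) f x.
have Llin : linear L.
  move=> a u v; rewrite /L scaler_sumr -big_split /=; apply: eq_bigr => c _.
  by rewrite !mxE scalerDl scalerA.
pose LM := GRing.isLinear.Build _ _ _ _ _ Llin.
pose LL : {linear V -> W} := HB.pack L LM.
have LLc : continuous LL.
  move=> v; apply/(@continuous_epsdelta R V W) => e e0.
  (* a Lipschitz constant of the differential *)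
  pose B := \sum_c `|'D_(delta_mx 0 c) f x|.
  have B0 : 0 <= B by apply: sumr_ge0.
  exists (e / (B + 1)); first by rewrite divr_gt0 // ltr_pwDr.
  move=> y yv; rewrite -linearB.
  apply: le_lt_trans (_ : B * `|y - v| < e).
    apply: le_trans (ler_norm_sum _ _ _) _; rewrite mulr_suml; apply: ler_sum => c _.
    by rewrite normrZ mulrC; apply: ler_wpM2l => //; exact: rV_entry_le.
  apply: le_lt_trans (_ : (B + 1) * `|y - v| < e).
    by apply: ler_wpM2r => //; rewrite lerDl.
  by rewrite mulrC -ltr_pdivlMr // ltr_pwDr.
suff H : forall e : R, 0 < e -> exists2 d, 0 < d &
    forall h, `|h| < d -> `|f (h + x) - f x - LL h| <= e * `|h|.
  have [D1 D2] := differentiable_epsdelta LLc H.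
  by split => // v; rewrite D2.
move=> e e0.
(* the expansion at [x] for increments along the axes of [cs] *)
pose P (cs : seq 'I_n) := forall e : R, 0 < e -> exists2 d, 0 < d &
  forall h : V, `|h| < d ->
  `|f (\sum_(c <- cs) h 0 c *: delta_mx 0 c + x) - f x -
    \sum_(c <- cs) h 0 c *: 'D_(delta_mx 0 c) f x| <= e * `|h|.
suff PP cs : P cs.
  have [d d0 dP] := PP (index_enum _) _ e0; exists d => // h hd.
  by have := dP _ hd; rewrite -rV_decomp.
elim: cs => [|c cs IH] {e0}e e0.
  by exists 1 => // h _; rewrite !big_nil add0r !subrr normr0 mulr_ge0 // ltW.
have e20 : 0 < e / 2 by rewrite divr_gt0.
have [d1 d10 d1P] := IH _ e20.
have [d2 d20 d2U] : exists2 d : R, 0 < d & forall y, `|y - x| < d -> U y.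
  move: Uo; rewrite openE => /(_ _ Ux) /nbhs_ballP[d /= d0 dW].
  by exists d => // z zd; apply: dW; rewrite -ball_normE /= distrC.
have /(@continuous_epsdelta R V W) /(_ _ e20)[d3 d30 d3P] := dfc c.
pose N : R := (size cs).+1%:R.
have N0 : 0 < N by rewrite ltr0n.
pose m := Num.min d1 (Num.min (d2 / (2 * N)) (d3 / (2 * N))).
have N20 : 0 < 2 * N by rewrite mulr_gt0.
exists m; first by rewrite !lt_min d10 !divr_gt0.
move=> h; rewrite !lt_min !ltr_pdivlMr // => /andP[h1 /andP[h2 h3]].
rewrite !big_cons.
set u : V := \sum_(c <- cs) h 0 c *: delta_mx 0 c.
set S : W := \sum_(c <- cs) _.
have uN : `|u| <= (size cs)%:R * `|h|.
  rewrite /u; elim: (cs) => [|b bs IHb]; first by rewrite big_nil normr0 mul0r.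
  rewrite big_cons; apply: le_trans (ler_normD _ _) _.
  rewrite -natr1 mulrDl mul1r addrC; apply: lerD => //.
  apply/rV_norm_leP => // i; rewrite delta_mx_entry.
  by case: eqP => _; rewrite ?mulr1n ?mulr0n ?normr0 // rV_entry_le.
have near (s : R) : `|s| <= `|h 0 c| -> `|(x + u) + s *: delta_mx 0 c - x| <= N * `|h|.
  move=> sh; have -> : (x + u) + s *: delta_mx 0 c - x = u + s *: delta_mx 0 c.
    by apply/rowP => i; rewrite !mxE; ring.
  apply: le_trans (ler_normD _ _) _; rewrite /N -natr1 mulrDl mul1r; apply: lerD => //.
  apply/rV_norm_leP => // i; rewrite delta_mx_entry.
  case: eqP => _; rewrite ?mulr1n ?mulr0n ?normr0 //.
  by apply: le_trans sh _; exact: rV_entry_le.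
have h0 : 0 <= `|h| by [].
have near2 s : `|s| <= `|h 0 c| -> `|(x + u) + s *: delta_mx 0 c - x| < d2.
  by move=> /near h4; clear -h4 h2 h0 d20; lra.
have near3 s : `|s| <= `|h 0 c| -> `|(x + u) + s *: delta_mx 0 c - x| < d3.
  by move=> /near h4; clear -h4 h3 h0 d30; lra.
have step : `|f ((x + u) + h 0 c *: delta_mx 0 c) - f (x + u) -
    h 0 c *: 'D_(delta_mx 0 c) f x| <= e / 2 * `|h|.
  apply/rV_norm_leP => [|j]; first by rewrite mulr_ge0 // ltW.
  rewrite !mxE.
  pose F (s : R) := f ((x + u) + s *: delta_mx 0 c) 0 j.
  pose F' (s : R) := 'D_(delta_mx 0 c) f ((x + u) + s *: delta_mx 0 c) 0 j.
  have := @mvt_line F F' (h 0 c) (e / 2) ('D_(delta_mx 0 c) f x 0 j).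
  rewrite {3}/F scale0r addr0 => /(_ _ _)/le_trans; apply.
  - move=> s /near2/d2U/(dfU c) df.
    have [D1 D2] := is_derive_line df.
    have Dj := (derivable_mxP _ _ _).1 D1 0 j.
    by split; [exact: Dj|rewrite /F' -D2 derive_mx // mxE].
  - move=> s /near3/d3P h4; apply: ltW; apply: le_lt_trans h4.
    have := rV_entry_le ('D_(delta_mx 0 c) f ((x + u) + s *: delta_mx 0 c) -
      'D_(delta_mx 0 c) f x) j.
    by rewrite !mxE.
  - by apply: ler_wpM2l; [exact: ltW|exact: rV_entry_le].
have -> : h 0 c *: delta_mx 0 c + u + x = (x + u) + h 0 c *: delta_mx 0 c.
  by apply/rowP => i; rewrite !mxE; ring.
have := d1P _ h1; rewrite -/u -/S [u + x]addrC => IHh.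
have -> : f (x + u + h 0 c *: delta_mx 0 c) - f x - (h 0 c *: 'D_(delta_mx 0 c) f x + S) =
  (f ((x + u) + h 0 c *: delta_mx 0 c) - f (x + u) - h 0 c *: 'D_(delta_mx 0 c) f x) +
  (f (x + u) - f x - S).
  by apply/rowP => i; rewrite !mxE; ring.
apply: le_trans (ler_normD _ _) _.
by clear -IHh step; lra.
Qed.

End C1.

(** * Speed of curves in charts *)

Lemma near_eq_continuous (T U : topologicalType) (f h : T -> U) (t : T) :
  {near t, f =1 h} -> {for t, continuous f} -> {for t, continuous h}.
Proof.
move=> E fc; rewrite /prop_for /continuous_at -(nbhs_singleton E).
by apply: cvg_trans fc; exact: near_eq_cvg.
Qed.

Section Curves.
Context {R : realType} {n : nat} {X : topologicalType}.
Variable g : riemannian_structure R n X.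
Implicit Types (c : chart R n X) (gamma : R -> X) (t : R).
Local Notation V := 'rV[R]_n.

Lemma chart_near gamma t c : {for t, continuous gamma} -> chart_dom c (gamma t) ->
  \forall s \near t, chart_dom c (gamma s).
Proof.
by move=> gc ct; apply: gc; apply: open_nbhs_nbhs; split => //; exact: chart_dom_open.
Qed.

Lemma transition_chart c1 c2 x : chart_dom c1 x -> transition c1 c2 (c1 x) = c2 x.
Proof. by move=> x1; rewrite /transition /= chart_mapK // inE. Qed.

Lemma transition_dom_open c1 c2 : open (c1 @` (chart_dom c1 `&` chart_dom c2)).
Proof.
rewrite openE => _ [x [x1 x2] <-].
have img1 : (c1 @` chart_dom c1) (c1 x) by exists x.
have N1 : nbhs (c1 x) (c1 @` chart_dom c1).
  by apply: open_nbhs_nbhs; split => //; exact: chart_img_open.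
have N2 : nbhs (c1 x) (chart_inv c1 @^-1` chart_dom c2).
  have := @chart_inv_continuous _ _ _ c1 (c1 x); rewrite inE => /(_ img1); apply.
  rewrite chart_mapK ?inE //.
  by apply: open_nbhs_nbhs; split => //; exact: chart_dom_open.
apply: (filterS2 _ _ N1 N2) => y [z z1 <-] /=; rewrite chart_mapK ?inE // => z2.
by exists z.
Qed.

Lemma transition_C1 c1 c2 (y : V) : atlas g c1 -> atlas g c2 ->
  (c1 @` (chart_dom c1 `&` chart_dom c2)) y ->
  [/\ differentiable (transition c1 c2) y,
    forall v : V, 'd (transition c1 c2) y v =
      \sum_i v 0 i *: 'D_(delta_mx 0 i) (transition c1 c2) y &
    forall i, {for y, continuous (fun z => 'D_(delta_mx 0 i) (transition c1 c2) z)}].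
Proof.
move=> a1 a2 Uy.
have [_ C1] := transition_smooth a1 a2 1%N.
have C1c i : {for y, continuous (fun z => 'D_(delta_mx 0 i) (transition c1 c2) z)}.
  by case: (C1 i) => _ [+ _]; apply; rewrite inE.
have [D1 D2] := @C1_differentiable R n n _ _ y (@transition_dom_open c1 c2) Uy
  (fun i => (C1 i).1) C1c.
by split.
Qed.

Lemma curve_change gamma t c1 c2 : atlas g c1 -> atlas g c2 ->
  {for t, continuous gamma} -> chart_dom c1 (gamma t) -> chart_dom c2 (gamma t) ->
  derivable (c1 \o gamma) t 1 ->
  derivable (c2 \o gamma) t 1 /\
  derive1 (c2 \o gamma) t =
    derive1 (c1 \o gamma) t *m 'J (transition c1 c2) (c1 (gamma t)).
Proof.
move=> a1 a2 gc d1 d2 df.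
have [D1 _ _] := transition_C1 a1 a2 (imageP c1 (conj d1 d2)).
have E : {near t, (transition c1 c2 \o (c1 \o gamma)) =1 (c2 \o gamma)}.
  apply: filterS (chart_near gc d1) => s s1 /=; exact: transition_chart.
have df1 : differentiable (c1 \o gamma) t by exact/derivable1_diffP.
have D2 : differentiable (transition c1 c2 \o (c1 \o gamma)) t.
  exact: differentiable_comp.
split; first by apply: near_eq_derivable E _; exact/derivable1_diffP.
rewrite derive1E -(near_eq_derive _ E) deriveE // diff_comp // /jacobian mul_rV_lin1 /=.
by congr ('d _ _ _); rewrite derive1E deriveE.
Qed.

Definition speed_in c gamma t : R :=
  let v := derive1 (c \o gamma) t in
  Num.sqrt ((v *m gram g c (c (gamma t)) *m v^T) 0 0).

(** The transformation rule of the Gram matrices is what makes the speed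
independent of the chart. *)
Lemma speed_chart c gamma t : atlas g c -> {for t, continuous gamma} ->
  chart_dom c (gamma t) -> derivable (c \o gamma) t 1 ->
  speed g gamma t = speed_in c gamma t.
Proof.
move=> ac gc ct df; rewrite /speed /speed_in.
set c2 := chart_at g (gamma t).
have a2 : atlas g c2 := chart_at_atlas g _.
have d2 : chart_dom c2 (gamma t) := chart_at_dom g _.
have [_ ->] := curve_change ac a2 gc ct d2 df.
congr (Num.sqrt (_ 0 0)).
rewrite (gram_transition ac a2 (imageP c (conj ct d2))) transition_chart //.
by rewrite trmx_mul !mulmxA.
Qed.

Lemma quadratic_continuous (T : topologicalType) (v : T -> V) (G : T -> 'M[R]_n) (t : T) :
  {for t, continuous v} -> {for t, continuous G} ->
  {for t, continuous (fun s => (v s *m G s *m (v s)^T) 0 0)}.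
Proof.
move=> vc Gc.
have vi i : {for t, continuous (fun s => v s 0 i)}.
  by apply: (@continuous_comp _ _ _ v (fun w : V => w 0 i)) => //; exact: coord_continuous.
have Gij i j : {for t, continuous (fun s => G s i j)}.
  by apply: (@continuous_comp _ _ _ G (fun M : 'M[R]_n => M i j)) => //; exact: coord_continuous.
have -> : (fun s => (v s *m G s *m (v s)^T) 0 0) =
    (fun s => \sum_i (\sum_j v s 0 j * G s j i) * v s 0 i).
  by apply/funext => s; rewrite mxE; apply: eq_bigr => i _; rewrite !mxE.
have sum_c (F : 'I_n -> T -> R) : (forall i, {for t, continuous (F i)}) ->
    {for t, continuous (fun s => \sum_i F i s)}.
  move=> Fc; apply: (@cvg_big R 'I_n +%R 0 xpredT add_continuous T (nbhs t)).
  by move=> i _; exact: Fc.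
apply: (sum_c _) => i; apply: continuousM; last exact: vi.
by apply: (sum_c _) => j; apply: continuousM; [exact: vi|exact: Gij].
Qed.

Lemma speed_in_continuous c gamma t : atlas g c -> {for t, continuous gamma} ->
  chart_dom c (gamma t) -> {for t, continuous (derive1 (c \o gamma))} ->
  {for t, continuous (speed_in c gamma)}.
Proof.
move=> ac gc ct dc.
apply: (@continuous_comp _ _ _
  (fun s => (derive1 (c \o gamma) s *m gram g c (c (gamma s)) *m (derive1 (c \o gamma) s)^T) 0 0)
  Num.sqrt); last exact: sqrt_continuous.
apply: (@quadratic_continuous _ (derive1 (c \o gamma)) (gram g c \o (c \o gamma)) t dc).
apply: (@continuous_comp _ _ _ (c \o gamma) (gram g c)).
  apply: (@continuous_comp _ _ _ gamma c); first exact: gc.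
  by have := @chart_map_continuous _ _ _ c (gamma t); rewrite inE; apply.
have [+ _] := gram_smooth ac 0%N => /(_ (c (gamma t))); apply.
by rewrite inE; exists (gamma t).
Qed.

(** The chart used by [speed] may change abruptly along the curve; near a given
time, [speed_chart] allows to keep the same one. *)
Lemma speed_continuous (U : set R) gamma t : open U -> U t ->
  C1_curve_on g U gamma -> {for t, continuous (speed g gamma)}.
Proof.
move=> Uo Ut [gc gd].
have gct s : U s -> {for s, continuous gamma} by move=> Us; apply: gc; rewrite inE.
pose c := chart_at g (gamma t).
have ac : atlas g c := chart_at_atlas g _.
have ct : chart_dom c (gamma t) := chart_at_dom g _.
have [_ dc] := gd c t ac Ut ct.
have E : {near t, speed_in c gamma =1 speed g gamma}.
  have NU : nbhs t U by apply: open_nbhs_nbhs; split.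
  apply: (filterS2 _ _ NU (chart_near (gct _ Ut) ct)) => s Us cs.
  have [df _] := gd c s ac Us cs; exact: esym (speed_chart ac (gct _ Us) cs df).
exact: near_eq_continuous E (speed_in_continuous ac (gct _ Ut) ct dc).
Qed.

End Curves.

(** * Comparison of the metric tensor with the sup norm *)

Section QuadraticBounds.
Context {R : realType} {n : nat}.
Local Notation V := 'rV[R]_n.

Definition quad (M : 'M[R]_n) (v : V) : R := (v *m M *m v^T) 0 0.

Lemma mx_entry_le (M : 'M[R]_n) i j : `|M i j| <= `|M|.
Proof.
rewrite [leRHS]/Num.Def.normr /= mx_normrE.
by apply/bigmax_geP; right; exists (i, j).
Qed.

Lemma quad_le (M : 'M[R]_n) (v : V) : `|quad M v| <= n%:R ^+ 2 * `|M| * `|v| ^+ 2.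
Proof.
rewrite /quad mxE; apply: le_trans (ler_norm_sum _ _ _) _.
have -> : n%:R ^+ 2 * `|M| * `|v| ^+ 2 = \sum_(i < n) \sum_(j < n) `|v| * `|M| * `|v|.
  have sumE (a : R) : \sum_(i < n) a = n%:R * a by rewrite sumr_const card_ord mulr_natl.
  by rewrite !sumE; ring.
apply: ler_sum => i _; rewrite !mxE normrM.
apply: le_trans (_ : (\sum_j `|v 0 j * M j i|) * `|v 0 i| <= _).
  by apply: ler_wpM2r => //; exact: ler_norm_sum.
rewrite mulr_suml; apply: ler_sum => j _; rewrite normrM.
apply: ler_pM; [by rewrite mulr_ge0|by []| |exact: rV_entry_le].
by apply: ler_pM; [by []|by []|exact: rV_entry_le|exact: mx_entry_le].
Qed.

Lemma quadB (M N : 'M[R]_n) v : quad (M - N) v = quad M v - quad N v.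
Proof. by rewrite /quad mulmxBr mulmxBl !mxE. Qed.

Lemma quadZ (M : 'M[R]_n) (a : R) v : quad M (a *: v) = a ^+ 2 * quad M v.
Proof.
by rewrite /quad linearZ /= -scalemxAr -!scalemxAl scalerA mxE expr2.
Qed.

(** The minimum of the form on the unit sphere, which is compact. *)
Lemma quad_posdef_bound (M : 'M[R]_n) : (0 < n)%N ->
  (forall v, v != 0 -> 0 < quad M v) ->
  exists2 mu : R, 0 < mu & forall v, mu * `|v| ^+ 2 <= quad M v.
Proof.
move=> n0 Mpos.
pose S : set V := [set v | `|v| = 1].
have S0 : S !=set0.
  exists (const_mx 1) => /=; apply/eqP; rewrite eq_le; apply/andP; split.
    by apply/rV_norm_leP => // c; rewrite mxE normr1.
  have := rV_entry_le (const_mx 1 : V) (Ordinal n0); by rewrite mxE normr1.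
have Sc : compact S.
  apply: bounded_closed_compact.
    exists 1; split; first exact: num_real.
    by move=> M1 M11 v /= ->; exact: ltW.
  have -> : S = (fun v : V => `|v|) @^-1` [set 1] by [].
  by apply: closed_comp; [move=> v _; exact: norm_continuous|exact: closed_eq].
have qc : continuous (quad M).
  move=> v; apply: (@quadratic_continuous R n V id (cst M) v); first by move=> ?.
  by apply/(@continuous_epsdelta R V 'M[R]_n) => e e0; exists 1 => // y _; rewrite subrr normr0.
have [v0 v0S v0P] := EVT_min_rV S0 Sc (continuous_subspaceT qc).
rewrite inE in v0S.
have v0n0 : v0 != 0 by rewrite -normr_eq0 v0S oner_eq0.
exists (quad M v0); first exact: Mpos.
move=> v; have [->|vn0] := eqVneq v 0.
  by rewrite normr0 expr0n /= mulr0 -(scale0r v0) quadZ expr0n mul0r.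
have nv0 : 0 < `|v| by rewrite normr_gt0.
have vE : v = `|v| *: (`|v|^-1 *: v) by rewrite scalerA divff ?scale1r // gt_eqF.
rewrite {2}vE quadZ mulrC ler_pM2l ?exprn_gt0 //; apply: v0P.
by rewrite inE /S /= normrZ ger0_norm ?invr_ge0 // mulVf // gt_eqF.
Qed.

(** A variation of the Gram matrix by less than [mu / (2 * n ^ 2)] costs at most
half of the lower bound [mu] of the form at [x0]. *)
Lemma metric_bounds (G : V -> 'M[R]_n) (x0 : V) : (0 < n)%N ->
  {for x0, continuous G} -> (forall v, v != 0 -> 0 < quad (G x0) v) ->
  exists (r lam Lam : R), [/\ 0 < r, 0 < lam, 0 < Lam &
    forall x v, `|x - x0| < r ->
      lam * `|v| <= Num.sqrt (quad (G x) v) <= Lam * `|v|].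
Proof.
move=> n0 Gc Gpos; have [mu mu0 muP] := quad_posdef_bound n0 Gpos.
have n20 : 0 < n%:R ^+ 2 :> R by rewrite exprn_gt0 // ltr0n.
pose e := Num.min 1 (mu / (2 * n%:R ^+ 2)).
have e0 : 0 < e by rewrite lt_min ltr01 divr_gt0 // mulr_gt0.
have /(@continuous_epsdelta R V 'M[R]_n) /(_ _ e0)[r r0 rP] := Gc.
pose L := n%:R ^+ 2 * (`|G x0| + 1).
have L0 : 0 < L by rewrite mulr_gt0 // ltr_wpDl.
exists r, (Num.sqrt (mu / 2)), (Num.sqrt L); split => //.
- by rewrite sqrtr_gt0 divr_gt0.
- by rewrite sqrtr_gt0.
move=> x v /rP Gx.
have nE a : 0 <= a -> Num.sqrt a * `|v| = Num.sqrt (a * `|v| ^+ 2).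
  by move=> a0; rewrite sqrtrM // sqrtr_sqr normr_id.
have v20 : 0 <= `|v| ^+ 2 by rewrite exprn_ge0.
have e1 : e <= 1 by rewrite ge_min lexx.
have e2 : n%:R ^+ 2 * e <= mu / 2.
  have : e <= mu / (2 * n%:R ^+ 2) by rewrite ge_min lexx orbT.
  move=> /(ler_wpM2l (ltW n20)) /le_trans; apply.
  rewrite le_eqVlt; apply/orP; left; apply/eqP; field.
  by rewrite pnatr_eq0 -lt0n.
rewrite !nE ?divr_ge0 ?(ltW mu0) ?(ltW L0) //.
apply/andP; split; apply: ler_wsqrtr.
  have := quad_le (G x - G x0) v; rewrite quadB ler_norml => /andP[+ _].
  have h : n%:R ^+ 2 * `|G x - G x0| * `|v| ^+ 2 <= mu / 2 * `|v| ^+ 2.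
    apply: ler_wpM2r => //; apply: le_trans e2; apply: ler_wpM2l; [exact: ltW|exact: ltW].
  have := muP v; clear -h; lra.
apply: le_trans (ler_norm _) _; apply: le_trans (quad_le _ _) _.
apply: ler_wpM2r => //; apply: ler_wpM2l; first exact: ltW.
have -> : G x = G x0 + (G x - G x0) by rewrite addrC subrK.
apply: le_trans (ler_normD _ _) _; rewrite lerD2l.
exact: le_trans (ltW Gx) e1.
Qed.

End QuadraticBounds.

Section Increment.
Context {R : realType}.
Local Notation mu := (@lebesgue_measure R).

Lemma within_itv_continuous (f : R -> R) (a b : R) :
  (forall t, a <= t <= b -> {for t, continuous f}) ->
  {within `[a, b], continuous f}.
Proof.
by move=> fc; apply: continuous_in_subspaceT => t; rewrite inE /= in_itv /=; exact: fc.
Qed.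

Lemma itv_measurable_fun (f : R -> R) (a b : R) :
  (forall t, a <= t <= b -> {for t, continuous f}) ->
  measurable_fun `[a, b] (EFin \o f).
Proof.
move=> fc; apply/measurable_EFinP.
by apply: subspace_continuous_measurable_fun => //; exact: within_itv_continuous.
Qed.

Lemma increment_le_integral (f s : R -> R) (a b : R) : a <= b ->
  (forall t, a <= t <= b -> derivable f t 1) ->
  (forall t, a <= t <= b -> {for t, continuous (derive1 f)}) ->
  (forall t, a <= t <= b -> {for t, continuous s}) ->
  (forall t, a <= t <= b -> derive1 f t <= s t) ->
  ((f b - f a)%:E <= \int[mu]_(t in `[a, b]) (s t)%:E)%E.
Proof.
rewrite le_eqVlt => /predU1P[->|ab] df dfc sc dfs.
  by rewrite subrr set_itv1 integral_set1.
have fc t : a <= t <= b -> {for t, continuous f}.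
  by move=> /df dft; apply: differentiable_continuous; exact/derivable1_diffP.
have le_lt t : t \in `]a, b[ -> a <= t <= b.
  by rewrite in_itv /= => /andP[/ltW -> /ltW ->].
rewrite EFinB -(@continuous_FTC2 R (derive1 f) f a b ab); first last.
- by [].
- split.
  + by move=> t /le_lt; exact: df.
  + apply: cvg_at_right_filter; apply: fc; by rewrite lexx ltW.
  + apply: cvg_at_left_filter; apply: fc; by rewrite lexx ltW.
- exact: within_itv_continuous.
apply: le_integral => //.
- by apply: continuous_compact_integrable; [exact: segment_compact|exact: within_itv_continuous].
- by apply: continuous_compact_integrable; [exact: segment_compact|exact: within_itv_continuous].
- by move=> t; rewrite inE /= in_itv /= lee_fin => /dfs.
Qed.

End Increment.

(** * Upper bound on the Riemannian distance *)

Section UpperDistance.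
Context {R : realType} {n : nat} {X : topologicalType}.
Variable g : riemannian_structure R n X.
Local Notation V := 'rV[R]_n.
Local Notation mu := (@lebesgue_measure R).

Lemma line_derive (v u : V) (s : R) :
  is_derive s 1 (fun s : R => v + s *: u) u.
Proof.
move: (@is_derive_line R V V id v u s); rewrite derive_id; apply.
exact: derivable_id.
Qed.

Lemma chart_inv_img (c : chart R n X) (y : V) : chart_img c y ->
  chart_dom c (chart_inv c y) /\ c (chart_inv c y) = y.
Proof. by move=> [x xd <-]; rewrite chart_mapK ?inE. Qed.

Lemma segment_in_ball (x0 v w : V) (r t : R) : `|v - x0| < r -> `|w - x0| < r ->
  0 <= t <= 1 -> `|v + t *: (w - v) - x0| < r.
Proof.
move=> vr wr /andP[t0 t1].
have -> : v + t *: (w - v) - x0 = (1 - t) *: (v - x0) + t *: (w - x0).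
  by apply/rowP => i; rewrite !mxE; ring.
apply: le_lt_trans (ler_normD _ _) _.
rewrite !normrZ ger0_norm ?subr_ge0 // (ger0_norm t0).
have [->|tn0] := eqVneq t 0; first by rewrite subr0 mul1r mul0r addr0.
have tp : 0 < t by rewrite lt_neqAle eq_sym tn0.
have h1 : (1 - t) * `|v - x0| <= (1 - t) * r by apply: ler_wpM2l; [rewrite subr_ge0|exact: ltW].
have h2 : t * `|w - x0| < t * r by rewrite ltr_pM2l.
clear -h1 h2; lra.
Qed.

(** The straight segment in the chart is an admissible path. Most of the proof
checks that it is C1 in every other chart of the atlas. *)
Lemma riemannian_dist_le (c : chart R n X) (x0 v w : V) (r Lam : R) : atlas g c ->
  (forall x, `|x - x0| < r -> chart_img c x) ->
  (forall x u, `|x - x0| < r -> Num.sqrt (quad (gram g c x) u) <= Lam * `|u|) ->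
  `|v - x0| < r -> `|w - x0| < r ->
  (riemannian_dist g (chart_inv c v) (chart_inv c w) <= (Lam * `|w - v|)%:E)%E.
Proof.
move=> ac img bound vr wr.
pose line (t : R) : V := v + t *: (w - v).
pose gamma (t : R) := chart_inv c (line t).
have lined t : derivable line t 1 /\ derive1 line t = w - v.
  by have [D1 D2] := line_derive v (w - v) t; split; [exact: D1|rewrite derive1E].
have linec t : {for t, continuous line}.
  by apply: differentiable_continuous; apply/derivable1_diffP; case: (lined t).
pose U := [set t : R | `|line t - x0| < r].
have Uo : open U.
  have -> : U = line @^-1` (ball x0 r).
    by rewrite -ball_normE; apply/seteqP; split => t /=; rewrite distrC.
  by apply: open_comp; [move=> t _; exact: linec|exact: ball_open].
have U01 t : 0 <= t <= 1 -> U t by exact: segment_in_ball.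
have Uimg t : U t -> chart_img c (line t) by exact: img.
have Uc t : U t -> chart_dom c (gamma t) /\ c (gamma t) = line t.
  by move=> /Uimg; exact: chart_inv_img.
have gammac t : U t -> {for t, continuous gamma}.
  move=> Ut; apply: (@continuous_comp _ _ _ line (chart_inv c)); first exact: linec.
  by have := @chart_inv_continuous _ _ _ c (line t); rewrite inE; apply; exact: Uimg.
have C1 : C1_curve_on g U gamma.
  split=> [t|c' t ac' Ut c't]; first by rewrite inE; exact: gammac.
  have inter s : U s -> chart_dom c' (gamma s) ->
      (c @` (chart_dom c `&` chart_dom c')) (line s).
    by move=> Us c's; have [ds <-] := Uc s Us; exists (gamma s).
  have deriv s : U s -> chart_dom c' (gamma s) ->
      derivable (transition c c' \o line) s 1 /\
      derive1 (transition c c' \o line) s =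
      \sum_i (w - v) 0 i *: 'D_(delta_mx 0 i) (transition c c') (line s).
    move=> Us c's; have [D1 D2 _] := transition_C1 ac ac' (inter _ Us c's).
    have [L1 L2] := lined s.
    have dl : differentiable line s by exact/derivable1_diffP.
    have dc : differentiable (transition c c' \o line) s by exact: differentiable_comp.
    split; first exact/derivable1_diffP.
    by rewrite derive1E deriveE // diff_comp //= -D2 -L2 derive1E deriveE.
  split; first by case: (deriv t Ut c't).
  have NU : nbhs t U by apply: open_nbhs_nbhs; split.
  have E : {near t, (fun s => \sum_i (w - v) 0 i *: 'D_(delta_mx 0 i) (transition c c') (line s))
     =1 derive1 (c' \o gamma)}.
    apply: (filterS2 _ _ NU (chart_near (gammac _ Ut) c't)) => s Us c's.
    by case: (deriv s Us c's).
  apply: near_eq_continuous E _.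
  apply: (@cvg_big V 'I_n +%R 0 xpredT add_continuous R (nbhs t)) => i _.
  have [_ _ Dc] := transition_C1 ac ac' (inter _ Ut c't).
  apply: (@continuousZl_tmp R V R (fun s => 'D_(delta_mx 0 i) (transition c c') (line s))).
  by apply: (@continuous_comp _ _ _ line (fun y => 'D_(delta_mx 0 i) (transition c c') y));
    [exact: linec|exact: Dc].
have sp t : 0 <= t <= 1 -> speed g gamma t <= Lam * `|w - v|.
  move=> t01; have Ut := U01 t t01; have [dt ct] := Uc t Ut.
  have [D1 _] := C1.2 c t ac Ut dt.
  rewrite (speed_chart ac (gammac t Ut) dt D1) /speed_in.
  have -> : derive1 (c \o gamma) t = w - v.
    have NU : nbhs t U by apply: open_nbhs_nbhs; split.
    have E : {near t, line =1 (c \o gamma)}.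
      by apply: filterS NU => s Us; case: (Uc s Us) => _ /= ->.
    by rewrite derive1E -(near_eq_derive _ E) -derive1E; case: (lined t).
  by rewrite ct; exact: bound.
have len : (segment_length g gamma <= (Lam * `|w - v|)%:E)%E.
  apply: le_trans (_ : (\int[mu]_(t in `[0%R, 1%R]) (cst (Lam * `|w - v|)%:E) t <= _)%E).
    apply: ge0_le_integral.
    - by [].
    - by move=> t _; rewrite lee_fin sqrtr_ge0.
    - apply: itv_measurable_fun => t t01; apply: (speed_continuous Uo) C1.
      exact: U01.
    - exact: measurable_cst.
    - by move=> t /=; rewrite in_itv /= lee_fin => /sp.
  rewrite integral_cst //.
  have mu01 : mu `[0%R, 1%R] = 1%E.
    by rewrite lebesgue_measure_itv /= lte_fin ltr01 oppr0 adde0.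
  by rewrite [X in (_ * X)%E]mu01 mule1.
apply: le_trans len; apply: ereal_inf_lbound; exists [:: gamma]; last first.
  by rewrite /path_length big_seq1.
split.
- exists U; split => // t /=; rewrite in_itv /=; exact: U01.
- by rewrite /gamma /line scale0r addr0.
- by rewrite /= /gamma /line scale1r addrC subrK.
Qed.

End UpperDistance.

(** * Lower bound on the Riemannian distance *)

Section LowerDistance.
Context {R : realType} {n : nat} {X : topologicalType}.
Variable g : riemannian_structure R n X.
Local Notation V := 'rV[R]_n.
Local Notation mu := (@lebesgue_measure R).
Variables (c : chart R n X) (x0 : V) (r lam : R).
Hypothesis Xhaus : hausdorff_space X.
Hypothesis ac : atlas g c.
Hypothesis img : forall x, `|x - x0| < r -> chart_img c x.
Hypothesis lam0 : 0 < lam.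
Hypothesis bound : forall x u, `|x - x0| < r ->
  lam * `|u| <= Num.sqrt (quad (gram g c x) u).

Definition chart_ball : set X := [set x | chart_dom c x /\ `|c x - x0| < r].

Lemma chart_ball_open : open chart_ball.
Proof.
rewrite openE => x [xd xr].
have N1 : nbhs x (chart_dom c) by apply: open_nbhs_nbhs; split => //; exact: chart_dom_open.
have N2 : nbhs x (c @^-1` ball x0 r).
  have := @chart_map_continuous _ _ _ c x; rewrite inE => /(_ xd); apply.
  by apply: open_nbhs_nbhs; split; [exact: ball_open|rewrite -ball_normE /= distrC].
apply: (filterS2 _ _ N1 N2) => y yd; rewrite /= -ball_normE /= distrC => yr.
by split.
Qed.

Lemma closed_chart_ball_closed rho : rho < r ->
  closed (chart_inv c @` [set v : V | `|v - x0| <= rho]).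
Proof.
move=> rhor; apply: compact_closed => //; apply: continuous_compact.
  apply: continuous_in_subspaceT => v; rewrite inE /= => vr.
  have := @chart_inv_continuous _ _ _ c v; rewrite inE; apply.
  by apply: img; apply: le_lt_trans rhor.
apply: bounded_closed_compact.
  exists (rho + `|x0|); split; first exact: num_real.
  move=> M hM v /= vr; have -> : v = (v - x0) + x0 by rewrite subrK.
  apply: le_trans (ler_normD _ _) _; apply: ltW; apply: le_lt_trans hM.
  by rewrite lerD2r.
have -> : [set v : V | `|v - x0| <= rho] = (fun v : V => `|v - x0|) @^-1` [set y | y <= rho] by [].
apply: closed_comp; last exact: closed_le.
move=> v _; apply: (@continuous_comp V V R (fun v => v - x0) (fun w => `|w|)).
  apply/(@continuous_epsdelta R V V) => e e0; exists e => // y.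
  by rewrite opprB addrA subrK.
exact: norm_continuous.
Qed.

Lemma segment_length_ge0 gamma : (0 <= segment_length g gamma)%E.
Proof. by apply: integral_ge0 => t _; rewrite lee_fin sqrtr_ge0. Qed.

(** For the sup norm it is enough to bound the increment of each coordinate,
which is the integral of its derivative; [a] is [lam] or its opposite, to bound
the absolute value. *)
Lemma chart_increment_le (U : set R) gamma t : open U -> `[0, 1] `<=` U ->
  C1_curve_on g U gamma -> 0 <= t <= 1 ->
  (forall s, 0 <= s <= t -> chart_ball (gamma s)) ->
  ((lam * `|c (gamma t) - c (gamma 0)|)%:E <= segment_length g gamma)%E.
Proof.
move=> Uo U01 C1 /andP[t0 t1] inB.
have Us s : 0 <= s <= t -> U s.
  by move=> /andP[s0 st]; apply: U01; rewrite /= in_itv /= s0 (le_trans st).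
have spc s : 0 <= s <= 1 -> {for s, continuous (speed g gamma)}.
  by move=> s01; apply: (speed_continuous Uo) C1; apply: U01; rewrite /= in_itv.
pose h := c \o gamma.
have hd s : 0 <= s <= t -> derivable h s 1 /\ {for s, continuous (derive1 h)}.
  by move=> st; have [d _] := inB s st; exact: (C1.2 c s ac (Us s st) d).
have gammac s : 0 <= s <= t -> {for s, continuous gamma}.
  by move=> st; apply: C1.1; rewrite inE; exact: Us.
have speed_ge s : 0 <= s <= t -> lam * `|derive1 h s| <= speed g gamma s.
  move=> st; have [d br] := inB s st; have [dh _] := hd s st.
  by rewrite (speed_chart ac (gammac s st) d dh); exact: bound.
have coord (a : R) (k : 'I_n) : `|a| = lam ->
    ((a * (h t 0 k - h 0 0 k))%:E <= segment_length g gamma)%E.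
  move=> alam.
  have dk s : 0 <= s <= t -> is_derive s 1 (fun s => a * h s 0 k) (a * derive1 h s 0 k).
    move=> st; have [dh _] := hd s st.
    have dhk := (derivable_mxP _ _ _).1 dh 0 k.
    have : is_derive s 1 (fun s => h s 0 k) (derive1 h s 0 k).
      by split => //; rewrite derive1E derive_mx // mxE.
    exact: is_deriveZ.
  have dkE s : 0 <= s <= t -> derive1 (fun s => a * h s 0 k) s = a * derive1 h s 0 k.
    by move=> /dk[_ <-]; rewrite derive1E.
  apply: le_trans (_ : (\int[mu]_(s in `[0%R, t]) (speed g gamma s)%:E <= _)%E); last first.
    apply: ge0_subset_integral => //.
    - by apply: itv_measurable_fun.
    - by move=> s _; rewrite lee_fin sqrtr_ge0.
    - by move=> s /=; rewrite !in_itv /= => /andP[-> st]; exact: le_trans st t1.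
  rewrite mulrBr; apply: (@increment_le_integral R (fun s => a * h s 0 k)) => // s st.
  - by case: (dk s st).
  - have NU : nbhs s U by apply: open_nbhs_nbhs; split => //; exact: Us.
    have ND : \forall u \near s, chart_dom c (gamma u).
      by apply: chart_near (gammac s st) _; case: (inB s st).
    have E : {near s, (fun u => a * derive1 h u 0 k) =1 derive1 (fun s => a * h s 0 k)}.
      apply: (filterS2 _ _ NU ND) => u Uu du.
      have [dh _] := C1.2 c u ac Uu du.
      have dhk := (derivable_mxP _ _ _).1 dh 0 k.
      have : is_derive u 1 (fun s => a * h s 0 k) (a * derive1 h u 0 k).
        apply: is_deriveZ; split => //.
        by rewrite derive1E derive_mx // mxE.
      by case=> _ <-; rewrite derive1E.
    apply: near_eq_continuous E _; apply: cvgMr.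
    apply: (@continuous_comp _ _ _ (derive1 h) (fun w : V => w 0 k)).
      by case: (hd s st).
    exact: coord_continuous.
  - by apply: spc; case/andP: st => -> st /=; exact: le_trans st t1.
  - rewrite dkE //; apply: le_trans (speed_ge s st).
    apply: le_trans (ler_norm _) _; rewrite normrM alam.
    by apply: ler_wpM2l; [exact: ltW|exact: rV_entry_le].
have := segment_length_ge0 gamma.
case: (segment_length g gamma) coord => [l| |] coord; [|by move=> _; rewrite leey|by []].
rewrite !lee_fin => l0; rewrite mulrC -ler_pdivlMr //; apply/rV_norm_leP => [|k].
  by rewrite divr_ge0 // ltW.
rewrite ler_pdivlMr // mulrC.
have := coord lam k; rewrite gtr0_norm // => /(_ erefl); rewrite lee_fin => h1.
have := coord (- lam) k; rewrite normrN gtr0_norm // => /(_ erefl); rewrite lee_fin => h2.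
rewrite !mxE -(gtr0_norm lam0) -normrM ler_norml.
by rewrite lerNl -mulNr; apply/andP; split.
Qed.

(** A short curve cannot leave the chart ball. Let [T] be the supremum of the
times until which it stays in it. By [chart_increment_le] it stays until then in
a closed ball of radius [rho < r], hence also at the time [T], hence slightly
longer if [T < 1]. *)
Lemma segment_length_lower gamma : C1_segment g gamma -> chart_ball (gamma 0) ->
  (segment_length g gamma < (lam * (r - `|c (gamma 0) - x0|))%:E)%E ->
  chart_ball (gamma 1) /\
  ((lam * `|c (gamma 1) - c (gamma 0)|)%:E <= segment_length g gamma)%E.
Proof.
move=> [U [Uo U01 C1]] B0 Llt.
have incr t := @chart_increment_le U gamma t Uo U01 C1.
suff inB : forall s, 0 <= s <= 1 -> chart_ball (gamma s).
  by split; [apply: inB|apply: incr => //]; rewrite lexx ler01.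
have gammac t : 0 <= t <= 1 -> {for t, continuous gamma}.
  by move=> t01; apply: C1.1; rewrite inE; apply: U01; rewrite /= in_itv.
have [l Ll] : exists l, segment_length g gamma = l%:E.
  have := segment_length_ge0 gamma; move: Llt.
  by case: (segment_length g gamma) => [l| |] // _ _; exists l.
rewrite Ll in Llt incr; rewrite lte_fin in Llt.
(* how far from [x0] a curve of length [l] can get *)
pose rho := `|c (gamma 0) - x0| + l / lam.
have rhor : rho < r.
  by rewrite /rho -ltrBrDl ltr_pdivrMr // mulrC.
pose K := chart_inv c @` [set v : V | `|v - x0| <= rho].
have Kc : closed K := closed_chart_ball_closed rhor.
have KB x : K x -> chart_ball x.
  move=> [v /= vr <-]; have vr' := le_lt_trans vr rhor.
  by have [d1 d2] := chart_inv_img (img vr'); split => //; rewrite d2.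
have BK t : 0 <= t <= 1 -> (forall s, 0 <= s <= t -> chart_ball (gamma s)) -> K (gamma t).
  move=> t01 Bt; have [|d dr] := Bt t; first by case/andP: t01 => ->; rewrite lexx.
  exists (c (gamma t)); last by rewrite chart_mapK // inE.
  rewrite /=; have := incr t t01 Bt; rewrite lee_fin mulrC -ler_pdivlMr // => h.
  have -> : c (gamma t) - x0 = (c (gamma 0) - x0) + (c (gamma t) - c (gamma 0)).
    by apply/rowP => i; rewrite !mxE; ring.
  by apply: le_trans (ler_normD _ _) _; rewrite lerD2l.
pose S := [set t : R | 0 <= t <= 1 /\ forall s, 0 <= s <= t -> chart_ball (gamma s)].
have S0 : S 0.
  split; first by rewrite lexx ler01.
  by move=> u; rewrite -eq_le => /eqP <-.
have S1 t : S t -> t <= 1 by case => /andP[].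
have supS : has_sup S by split; [exists 0|exists 1 => t /S1].
pose T := sup S.
have T0 : 0 <= T by apply: sup_upper_bound.
have T1 : T <= 1 by apply: ge_sup; [exists 0|move=> t /S1].
have T01 : 0 <= T <= 1 by rewrite T0.
have below s : 0 <= s -> s < T -> S s.
  move=> s0 sT; have [t [t01 tB] st] := sup_adherent (eps := T - s) (ltac:(by rewrite subr_gt0)) supS.
  have {}st : s < t by move: st; rewrite -/T opprB addrC subrK.
  split; first by rewrite s0 (le_trans (ltW st)) //; case/andP: t01.
  by move=> u /andP[u0 us]; apply: tB; rewrite u0 (le_trans us (ltW st)).
have KT : K (gamma T).
  have [T0'|] := ltP 0 T; last first.
    move=> T0'; have -> : T = 0 by apply/eqP; rewrite eq_le T0' T0.
    by apply: BK; [rewrite lexx ler01|case: S0].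
  apply: contrapT => nK.
  have : \forall s \near T, (~` K) (gamma s).
    apply: (gammac T T01); apply: open_nbhs_nbhs; split => //.
    by rewrite openC.
  move=> /nbhs_ballP[d /= d0 dP].
  pose s := Num.max 0 (T - d / 2).
  have sT : s < T by rewrite gt_max T0' gtrBl divr_gt0.
  have s0 : 0 <= s by rewrite le_max lexx.
  have [s01 sB] := below s s0 sT.
  apply: (dP s); last exact: BK.
  rewrite /ball /= ger0_norm ?subr_ge0 ?(ltW sT) //.
  have : T - d / 2 <= s by rewrite le_max lexx orbT.
  by clear -d0; lra.
have ST : S T.
  split => // s /andP[s0]; rewrite le_eqVlt => /predU1P[->|sT]; first exact: KB.
  by have [_] := below s s0 sT; apply; rewrite s0 lexx.
suff -> : 1 = T by exact: ST.2.
apply/eqP; rewrite eq_le T1 andbT leNgt; apply/negP => T1'.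
have : \forall s \near T, chart_ball (gamma s).
  apply: (gammac T T01); apply: open_nbhs_nbhs; split; first exact: chart_ball_open.
  exact: KB.
move=> /nbhs_ballP[d /= d0 dP].
pose t := Num.min 1 (T + d / 2).
have Tt : T < t by rewrite lt_min T1' ltrDl divr_gt0.
suff : S t by move/(sup_upper_bound supS); rewrite -/T leNgt Tt.
split; first by rewrite (le_trans T0 (ltW Tt)) /t ge_min lexx.
move=> s /andP[s0 st]; have [sT|Ts] := leP s T; first by apply: ST.2; rewrite s0.
apply: dP; rewrite /ball /= distrC ger0_norm ?subr_ge0 ?(ltW Ts) //.
have : t <= T + d / 2 by rewrite ge_min lexx orbT.
by clear -st d0; lra.
Qed.

(** Each piece uses up part of the available length, and the hypothesis is
inherited by the rest of the path from the end point of that piece. *)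
Lemma path_length_lower s x y : piecewise_C1_path g x y s -> chart_ball x ->
  (path_length g s < (lam * (r - `|c x - x0|))%:E)%E ->
  chart_ball y /\ ((lam * `|c y - c x|)%:E <= path_length g s)%E.
Proof.
rewrite /path_length; elim: s x => [|gamma s IH] x.
  by move=> /= -> yB _; split => //; rewrite big_nil subrr normr0 mulr0.
move=> /= [gC gx path]; rewrite -gx big_cons => xB.
set L1 := segment_length g gamma; set L2 := (\sum_(i <- s) _)%E => Llt.
have L10 : (0 <= L1)%E := segment_length_ge0 gamma.
have L20 : (0 <= L2)%E by apply: sume_ge0 => i _; exact: segment_length_ge0.
have [|B1 len1] := segment_length_lower gC xB.
  by apply: le_lt_trans Llt; rewrite leeDl.
have [l1 E1] : exists l, L1 = l%:E.
  move: L10 L20 Llt; case: L1 {len1} => [l| |] //; first by exists l.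
  by case: L2.
have [l2 E2] : exists l, L2 = l%:E.
  by move: L20 Llt; rewrite E1; case: L2 => [l| |] //; exists l.
rewrite -/L1 E1 lee_fin in len1; rewrite E1 E2 -EFinD lte_fin in Llt.
have [|By len2] := IH _ path B1.
  rewrite -/L2 E2 lte_fin.
  have : `|c (gamma 1) - x0| <= `|c (gamma 0) - x0| + `|c (gamma 1) - c (gamma 0)|.
    have -> : c (gamma 1) - x0 = (c (gamma 0) - x0) + (c (gamma 1) - c (gamma 0)).
      by apply/rowP => i; rewrite !mxE; ring.
    exact: ler_normD.
  move=> /(ler_wpM2l (ltW lam0)); rewrite mulrDr mulrBr; rewrite mulrBr in Llt.
  by lra.
split => //; rewrite E1 E2 -EFinD lee_fin; rewrite -/L2 E2 lee_fin in len2.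
have -> : c y - c (gamma 0) = (c (gamma 1) - c (gamma 0)) + (c y - c (gamma 1)).
  by apply/rowP => i; rewrite !mxE; ring.
have := ler_wpM2l (ltW lam0) (ler_normD (c (gamma 1) - c (gamma 0)) (c y - c (gamma 1))).
by rewrite mulrDr; lra.
Qed.

(** A path that is not covered by [path_length_lower] has length at least
[lam * (2 * r / 3)], which exceeds [lam] times the distance of two points of the
ball of radius [r / 3]. *)
Lemma riemannian_dist_ge x y : chart_ball x -> chart_ball y ->
  `|c x - x0| < r / 3 -> `|c y - x0| < r / 3 ->
  ((lam * `|c y - c x|)%:E <= riemannian_dist g x y)%E.
Proof.
move=> xB yB xr yr; apply: le_ereal_inf_tmp => _ [s path <-].
have [Llt|Lge] := ltP (path_length g s) (lam * (r - `|c x - x0|))%:E.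
  by case: (path_length_lower path xB Llt).
apply: le_trans Lge; rewrite lee_fin; apply: ler_wpM2l; first exact: ltW.
have -> : c y - c x = (c y - x0) - (c x - x0) by apply/rowP => i; rewrite !mxE; ring.
by apply: le_trans (ler_normB _ _) _; lra.
Qed.

End LowerDistance.

(** * Bilipschitz charts and covers *)

(** Compactness in terms of filters is applied to the filter generated by the
sets of all lists that contain a given list. *)
Lemma finite_subcover (X : topologicalType) (U : X -> set X) :
  compact [set: X] -> (forall p, nbhs p (U p)) ->
  exists s : seq X, forall x, exists2 p, p \in s & U p x.
Proof.
move=> /compact_near_coveringP Xc Unbhs.
pose F : set_system (seq X) :=
  [set A | exists s : seq X, forall t : seq X, {subset s <= t} -> A t].
have FF : Filter F.
  split; first by exists [::].
    move=> A B [s sA] [t tB]; exists (s ++ t) => u stu; split.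
      by apply: sA => x xs; apply: stu; rewrite mem_cat xs.
    by apply: tB => x xt; apply: stu; rewrite mem_cat xt orbT.
  by move=> A B AB [s sA]; exists s => t /sA /AB.
have [|s sP] := Xc _ F (fun s x => exists2 p, p \in s & U p x) FF.
  move=> p _; exists (U p, [set t : seq X | p \in t]) => /=.
    by split; [exact: Unbhs|exists [:: p] => t; apply; rewrite inE].
  by case=> x t /= [Ux pt]; exists p.
by exists s => x; exact: (sP s (fun=> id) x Logic.I).
Qed.

Section BilipschitzCharts.
Context {R : realType} {n : nat} {X : metricType R}.
Local Notation V := 'rV[R]_n.

(** [kappa] is a coordinate map and [iota] the parametrisation inverse to it,
considered on a ball around 0 only. *)
Record bilip_chart (rho lam Lam : R) (iota : V -> X) (kappa : X -> V) : Prop := {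
  bilip_rho : 0 < rho ;
  bilip_lam : 0 < lam ;
  bilip_Lam : 0 < Lam ;
  bilip_K : forall v, `|v| < rho -> kappa (iota v) = v ;
  bilip_ge : forall v w, `|v| < rho -> `|w| < rho ->
    lam * `|v - w| <= mdist (iota v) (iota w) ;
  bilip_le : forall v w, `|v| < rho -> `|w| < rho ->
    mdist (iota v) (iota w) <= Lam * `|v - w| ;
  bilip_open : forall r, r <= rho -> open (iota @` [set v | `|v| < r]) }.

Lemma riemannian_bilip (g : riemannian_structure R n X) (p : X) (e : R) :
  (0 < n)%N -> is_induced_metric g -> 0 < e ->
  exists rho lam Lam iota kappa, [/\ bilip_chart rho lam Lam iota kappa,
    iota 0 = p & forall v, `|v| < rho -> mdist p (iota v) < e].
Proof.
move=> n0 ind e0.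
pose c := chart_at g p; pose x0 := c p.
have ac : atlas g c := chart_at_atlas g p.
have pd : chart_dom c p := chart_at_dom g p.
have img0 : chart_img c x0 by exists p.
have [+ _] := gram_smooth ac 0%N; move=> /(_ x0); rewrite inE => /(_ img0) Gc.
have [r1 [lam [Lam [r10 lam0 Lam0 bd]]]] :=
  metric_bounds n0 Gc (fun v => @gram_posdef _ _ _ g c x0 v ac img0).
have [r2 r20 r2P] : exists2 r2 : R, 0 < r2 & forall x, `|x - x0| < r2 -> chart_img c x.
  have := @chart_img_open _ _ _ c; rewrite openE => /(_ x0 img0) /nbhs_ballP[d /= d0 dP].
  by exists d => // x xd; apply: dP; rewrite -ball_normE /= distrC.
pose r := Num.min r1 r2.
have r0 : 0 < r by rewrite lt_min r10.
have rr1 : r <= r1 by rewrite ge_min lexx.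
have rr2 : r <= r2 by rewrite ge_min lexx orbT.
have img x : `|x - x0| < r -> chart_img c x by move=> h; apply: r2P; exact: lt_le_trans rr2.
have bdl x u : `|x - x0| < r -> lam * `|u| <= Num.sqrt (quad (gram g c x) u).
  by move=> h; case/andP: (bd x u (lt_le_trans h rr1)).
have bdu x u : `|x - x0| < r -> Num.sqrt (quad (gram g c x) u) <= Lam * `|u|.
  by move=> h; case/andP: (bd x u (lt_le_trans h rr1)).
pose rho := Num.min (r / 3) (e / Lam).
have rho0 : 0 < rho by rewrite lt_min !divr_gt0.
have rho3 : rho <= r / 3 by rewrite ge_min lexx.
have rhoe : rho <= e / Lam by rewrite ge_min lexx orbT.
pose iota (v : V) := chart_inv c (v + x0); pose kappa (x : X) : V := c x - x0.
have sh (v : V) : v + x0 - x0 = v by rewrite addrK.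
have rho_r (v : V) : `|v| < rho -> `|v + x0 - x0| < r by rewrite sh => h; lra.
have facts (v : V) : `|v| < rho -> chart_dom c (iota v) /\ c (iota v) = v + x0.
  by move=> h; apply: chart_inv_img; apply: img; exact: rho_r.
have fin (x y : X) : riemannian_dist g x y = (mdist x y)%:E by rewrite ind.
have le v w : `|v| < rho -> `|w| < rho -> mdist (iota v) (iota w) <= Lam * `|v - w|.
  move=> vr wr; rewrite -lee_fin -fin.
  have := riemannian_dist_le ac img bdu (rho_r _ vr) (rho_r _ wr).
  have -> : w + x0 - (v + x0) = w - v by apply/rowP => i; rewrite !mxE; ring.
  by rewrite distrC.
have iota0 : iota 0 = p by rewrite /iota add0r chart_mapK // inE.
exists rho, lam, Lam, iota, kappa; split => //; last first.
  move=> v vr; rewrite -iota0; apply: le_lt_trans (le _ _ _ vr) _; first by rewrite normr0.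
  by rewrite sub0r normrN mulrC -ltr_pdivlMr //; exact: lt_le_trans vr rhoe.
split => //.
- by move=> v /facts[_ h]; rewrite /kappa h sh.
- move=> v w vr wr; rewrite -lee_fin -fin.
  have [dv cv] := facts v vr; have [dw cw] := facts w wr.
  have := @riemannian_dist_ge R n X g c x0 r lam (@metric_hausdorff R X) ac img lam0 bdl (iota v) (iota w).
  rewrite /chart_ball /= cv cw !sh.
  have -> : w + x0 - (v + x0) = w - v by apply/rowP => i; rewrite !mxE; ring.
  by rewrite distrC; apply; try split => //; lra.
- move=> s srho.
  have -> : iota @` [set v | `|v| < s] = chart_ball c x0 s.
    apply/seteqP; split => [_ [v /= vs <-]|x [xd xs]].
      have [d cv] := facts v (lt_le_trans vs srho).
      by split => //; rewrite cv sh.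
    by exists (c x - x0) => //; rewrite /iota subrK chart_mapK // inE.
  exact: chart_ball_open.
Qed.

Lemma bilip_iota_continuous rho lam Lam iota kappa v :
  bilip_chart rho lam Lam iota kappa -> `|v| < rho -> {for v, continuous iota}.
Proof.
move=> B vr A /nbhs_ballP[e /= e0 eA].
have L0 := bilip_Lam B.
have m0 : 0 < Num.min (e / Lam) (rho - `|v|) by rewrite lt_min divr_gt0 // subr_gt0.
apply/nbhs_ballP; exists (Num.min (e / Lam) (rho - `|v|)) => //= w.
rewrite -ball_normE /= lt_min => /andP[h1 h2]; apply: eA; rewrite ballEmdist /=.
apply: le_lt_trans (bilip_le B vr _) _.
  have -> : w = v - (v - w) by rewrite opprB addrC subrK.
  by apply: le_lt_trans (ler_normB _ _) _; lra.
by rewrite mulrC -ltr_pdivlMr.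
Qed.

Lemma bilip_kappa_continuous rho lam Lam iota kappa v :
  bilip_chart rho lam Lam iota kappa -> `|v| < rho ->
  {for iota v, continuous kappa}.
Proof.
move=> B vr A; rewrite (bilip_K B vr) => /nbhs_ballP[e /= e0 eA].
have l0 := bilip_lam B.
have N1 : nbhs (iota v) (iota @` [set v | `|v| < rho]).
  by apply: open_nbhs_nbhs; split; [exact: (bilip_open B)|exists v].
have N2 : nbhs (iota v) (ball (iota v) (lam * e)) by apply: nbhsx_ballx; rewrite mulr_gt0.
apply: (filterS2 _ _ N1 N2) => _ [w /= wr <-]; rewrite ballEmdist /= (bilip_K B wr) => h.
apply: eA; rewrite -ball_normE /= -(ltr_pM2l l0).
by apply: le_lt_trans h; exact: bilip_ge B _ _ _ _.
Qed.

(** Finitely many charts cover the space; each is cut into cubes of side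
[eps / Lam]. *)
Lemma covering_bound : compact [set: X] ->
  (forall p : X, exists rho lam Lam iota kappa,
     bilip_chart rho lam Lam iota kappa /\ iota 0 = p) ->
  exists C : R, forall eps, 0 < eps < 1 ->
    exists (K : finType) (code : X -> K), #|K|%:R <= C * (eps^-1) ^+ n /\
      forall x y, code x = code y -> mdist x y <= eps.
Proof.
move=> Xc charts.
have /choice[ch chP] (p : X) : exists q : (R * R * R * (V -> X) * (X -> V)),
    bilip_chart q.1.1.1.1 q.1.1.1.2 q.1.1.2 q.1.2 q.2 /\ q.1.2 0 = p.
  by have [rho [lam [Lam [iota [kappa H]]]]] := charts p; exists (rho, lam, Lam, iota, kappa).
pose rho p := (ch p).1.1.1.1; pose Lam p := (ch p).1.1.2.
pose iota p := (ch p).1.2; pose kappa p := (ch p).2.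
have B p : bilip_chart (rho p) (ch p).1.1.1.2 (Lam p) (iota p) (kappa p) by case: (chP p).
pose U p := iota p @` [set v | `|v| < rho p].
have Uo p : open (U p) by exact: (bilip_open (B p)).
have Up p : U p p.
  by case: (chP p) => _ h; exists 0 => //=; rewrite normr0; exact: (bilip_rho (B p)).
have [s sP] := finite_subcover Xc (fun p => open_nbhs_nbhs (conj (Uo p) (Up p))).
pose I : finType := seq_sub s.
have /choice[idx idxP] (x : X) : exists i : I, U (val i) x.
  by have [p ps Upx] := sP x; exists (SeqSub ps).
have [L0 L00 L0P] : exists2 L : R, 0 < L & forall i : I, 2 * rho (val i) * Lam (val i) <= L.
  exists (1 + \sum_(i : I) 2 * rho (val i) * Lam (val i)).
    rewrite ltr_wpDr // sumr_ge0 // => i _.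
    by rewrite !mulr_ge0 // ltW //; [exact: (bilip_rho (B _))|exact: (bilip_Lam (B _))].
  move=> i; rewrite (bigD1 i) //= addrCA lerDl addr_ge0 // sumr_ge0 // => j _.
  by rewrite !mulr_ge0 // ltW //; [exact: (bilip_rho (B _))|exact: (bilip_Lam (B _))].
exists (#|I|%:R * (L0 + 2) ^+ n) => eps /andP[eps0 eps1].
(* at most [N] cells are needed along each axis of each chart *)
pose N := (Num.truncn (L0 / eps)).+1.
pose cell (x : X) (c : 'I_n) : nat := let p := val (idx x) in
  Num.truncn ((kappa p x 0 c + rho p) * Lam p / eps).
have L0e : 0 <= L0 / eps by rewrite divr_ge0 // ltW.
have coords x : exists v, [/\ `|v| < rho (val (idx x)), iota (val (idx x)) v = x &
    kappa (val (idx x)) x = v].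
  have [v /= vr vx] := idxP x; exists v; split => //.
  exact: etrans (congr1 (kappa (val (idx x))) (esym vx)) (bilip_K (B (val (idx x))) vr).
have arg_ge0 x c : 0 <= (kappa (val (idx x)) x 0 c + rho (val (idx x))) * Lam (val (idx x)) / eps.
  have [v [vr _ ->]] := coords x.
  rewrite divr_ge0 ?(ltW eps0) // mulr_ge0 ?(ltW (bilip_Lam (B _))) //.
  by have := le_lt_trans (rV_entry_le v c) vr; rewrite ltr_norml => /andP[? _]; lra.
have cellN x c : (cell x c < N)%N.
  have [v [vr _ kv]] := coords x.
  have L1 := bilip_Lam (B (val (idx x))).
  rewrite ltnS; apply: Num.Theory.le_truncn; rewrite ler_pdivrMr // divfK ?gt_eqF //.
  apply: le_trans (L0P (idx x)); rewrite kv ler_pM2r //.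
  by have := le_lt_trans (rV_entry_le v c) vr; rewrite ltr_norml => /andP[_ ?]; lra.
pose K : finType := (I * {ffun 'I_n -> 'I_N})%type.
exists K, (fun x => (idx x, [ffun c => Ordinal (cellN x c)])); split.
  rewrite card_prod card_ffun !card_ord natrM natrX -mulrA -exprMn.
  apply: ler_wpM2l; first exact: ler0n.
  apply: lerXn2r; rewrite ?nnegrE ?ler0n //.
    by rewrite mulr_ge0 ?invr_ge0 ?(ltW eps0) // addr_ge0 // ltW.
  rewrite /N -natr1; have /andP[h1 _] := truncn_itv L0e.
  have : 1 <= eps^-1 by rewrite invf_ge1 // ltW.
  move: h1; rewrite mulrDl; lra.
move=> x y [] ixy /ffunP cxy.
have [v [vr vx kv]] := coords x; have [w [wr wy kw]] := coords y.
rewrite -ixy in wr wy kw.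
have L1 := bilip_Lam (B (val (idx x))).
rewrite -vx -wy; apply: le_trans (bilip_le (B _) vr wr) _.
rewrite mulrC -ler_pdivlMr //; apply/rV_norm_leP => [|c].
  by rewrite divr_ge0 // ltW.
have := cxy c; rewrite !ffunE => /(congr1 val) /= cc.
have /andP[a1 a2] := truncn_itv (arg_ge0 x c).
have /andP[b1 b2] := truncn_itv (arg_ge0 y c).
rewrite /cell in cc; rewrite -ixy in b1 b2 cc.
rewrite -cc in b1 b2; rewrite kv in a1 a2 b1 b2; rewrite kw in b1 b2.
set q := (Num.truncn _) in a1 a2 b1 b2.
rewrite !mxE ler_norml; rewrite -natr1 in a2 b2.
have E (u : R) : (u + rho (val (idx x))) * Lam (val (idx x)) / eps =
  (u + rho (val (idx x))) / (eps / Lam (val (idx x))).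
  by rewrite invf_div mulrA.
rewrite !E in a1 a2 b1 b2.
have : 0 < eps / Lam (val (idx x)) by rewrite divr_gt0.
move: a1 a2 b1 b2; rewrite -/(Lam _); move: (eps / _) (rho _) (v 0 c) (w 0 c) q%:R.
move=> d e a b k + + + + d0; rewrite !ler_pdivlMr // !ltr_pdivrMr // !mulrDl !mul1r.
by clear => a1 a2 b1 b2; apply/andP; split; lra.
Qed.

End BilipschitzCharts.

(** * Perturbations supported in a chart *)

Lemma compact_homeomorphism (R : realType) (X : metricType R) (f : X -> X) :
  compact [set: X] -> continuous f -> bijective f -> homeomorphism f.
Proof.
move=> Xc fc [f' fK f'K]; split => //; exists f'; split => //.
apply/continuousP => A oA; rewrite -[_ @^-1` A]setCK; apply: closed_openC.
have -> : ~` (f' @^-1` A) = f @` (~` A).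
  apply/seteqP; split => [x Ax|_ [x Ax <-]]; first by exists (f' x).
  by rewrite /= fK.
apply: compact_closed; first exact: metric_hausdorff.
apply: continuous_compact; first exact: continuous_subspaceT.
by apply: subclosed_compact Xc _ => //; exact: open_closedC.
Qed.

Section LiftedHomeo.
Context {R : realType} {n : nat} {X : metricType R}.
Local Notation V := 'rV[R]_n.
Variables (rho lam Lam : R) (iota : V -> X) (kappa : X -> V).
Hypothesis B : bilip_chart rho lam Lam iota kappa.

Definition chart_image (r : R) : set X := iota @` [set v | `|v| < r].

Definition chart_lift (h : V -> V) (x : X) : X :=
  if `[< chart_image rho x >] then iota (h (kappa x)) else x.

Lemma chart_lift_iota h v : `|v| < rho -> chart_lift h (iota v) = iota (h v).
Proof.
move=> vr; rewrite /chart_lift (bilip_K B vr).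
by rewrite ifT //; apply/asboolP; exists v.
Qed.

Lemma chart_lift_off h x : ~ chart_image rho x -> chart_lift h x = x.
Proof. by move=> nx; rewrite /chart_lift asboolF. Qed.

Lemma chart_liftK h h' : (forall v, `|v| < rho -> `|h v| < rho) ->
  cancel h h' -> cancel (chart_lift h) (chart_lift h').
Proof.
move=> hr hK x; have [[v vr <-]|nx] := pselect (chart_image rho x).
  by rewrite (chart_lift_iota _ vr) chart_lift_iota ?hK //; exact: hr.
by rewrite !chart_lift_off.
Qed.

Lemma closed_chart_image r : r < rho -> closed (iota @` [set v | `|v| <= r]).
Proof.
move=> rr; apply: compact_closed; first exact: metric_hausdorff.
have [r0|r0] := ltP r 0.
  have -> : [set v : V | `|v| <= r] = set0.
    by apply/seteqP; split => // v /= h; have := le_lt_trans h r0; rewrite normr_lt0.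
  by rewrite image_set0; exact: compact0.
have -> : [set v : V | `|v| <= r] =
    [set v : V | forall i, [set` `[- r, r]] (v ord0 i)].
  apply/seteqP; split => v /=.
    by move=> /(rV_norm_leP _ r0) h i; rewrite in_itv /= -ler_norml; exact: h.
  by move=> h; apply/(rV_norm_leP _ r0) => i; have := h i; rewrite in_itv /= -ler_norml.
apply: continuous_compact; last first.
  by apply: (@rV_compact R n (fun=> `[- r, r]%classic)) => _; exact: segment_compact.
apply: continuous_in_subspaceT => v; rewrite inE /= => h.
apply: (bilip_iota_continuous B); apply: le_lt_trans rr.
by apply/(rV_norm_leP _ r0) => i; have := h i; rewrite in_itv /= -ler_norml.
Qed.

(** At points outside the chart, continuity holds because the lift is the
identity off the image of a closed ball, and that image is closed. *)
Lemma chart_lift_homeo s h : s < rho -> supported_homeo [set v | `|v| < s] h ->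
  supported_homeo (chart_image s) (chart_lift h).
Proof.
move=> sr hh; have [hc hb hf] := hh.
have hr v : `|v| < rho -> `|h v| < rho.
  have sub : [set v : V | `|v| < s] `<=` [set v | `|v| < rho].
    by move=> w /= ws; exact: lt_trans ws sr.
  exact: supported_homeo_stable (supported_homeo_sub sub hh).
have fixed x : ~ chart_image s x -> chart_lift h x = x.
  move=> nx; have [[v vr vx]|nU] := pselect (chart_image rho x); last first.
    exact: chart_lift_off.
  rewrite -vx chart_lift_iota // hf // => vs; apply: nx; by exists v.
split => //; last first.
  have [h' hK h'K] := hb; exists (chart_lift h'); apply: chart_liftK => // v vr.
  have [vs|/hf hv] := pselect (`|h' v| < s); first exact: lt_trans vs sr.
  by rewrite -hv h'K.
move=> x; have [[v vr <-]|nU] := pselect (chart_image rho x).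
  have N1 : nbhs (iota v) (chart_image rho).
    by apply: open_nbhs_nbhs; split; [exact: (bilip_open B)|exists v].
  apply: (@near_eq_continuous _ _ (iota \o (h \o kappa))).
    apply: filterS N1 => _ [w wr <-]; rewrite chart_lift_iota //=.
    by rewrite (bilip_K B wr).
  apply: continuous_comp.
    apply: continuous_comp; first exact: bilip_kappa_continuous B vr.
    exact: hc.
  apply: (bilip_iota_continuous B); rewrite /= (bilip_K B vr); exact: hr.
have Ux : nbhs x (~` (iota @` [set v | `|v| <= s])).
  apply: open_nbhs_nbhs; split; first exact: closed_openC (closed_chart_image sr).
  by case=> v /= vs vx; apply: nU; exists v => //=; exact: le_lt_trans sr.
apply: (@near_eq_continuous _ _ id); last exact: cvg_id.
apply: filterS Ux => y ny; rewrite fixed // => -[v vs vy]; apply: ny.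
by exists v => //=; exact: ltW.
Qed.

End LiftedHomeo.

(** * Perturbation near a periodic point *)

Section PeriodicPoint.
Context {R : realType} {n : nat} {X : metricType R}.
Local Notation V := 'rV[R]_n.

Definition small_charts : Prop := forall (p : X) (e : R), 0 < e ->
  exists rho lam Lam (iota : V -> X) kappa,
    [/\ bilip_chart rho lam Lam iota kappa, iota 0 = p &
        forall v, `|v| < rho -> mdist p (iota v) < e].

Lemma iter_continuous (T : topologicalType) (F : T -> T) k :
  continuous F -> continuous (iter k F).
Proof.
move=> Fc; elim: k => [|k IH] x; first exact: cvg_id.
by rewrite (_ : iter k.+1 F = F \o iter k F) //; apply: continuous_comp; [exact: IH|exact: Fc].
Qed.

Lemma supported_homeo_close (W : set X) (h : X -> X) p e :
  supported_homeo W h -> (forall y, W y -> mdist p y < e) -> 0 < e ->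
  forall x, mdist x (h x) < e + e.
Proof.
move=> hW We e0 x; have [Wx|nWx] := pselect (W x); last first.
  by have [_ _ ->] := hW => //; rewrite mdistxx addr_gt0.
apply: le_lt_trans (metric_triangle _ p _) _; rewrite metric_sym.
by apply: ltrD; apply: We => //; exact: supported_homeo_stable hW _.
Qed.

(** The radius [r] is chosen so that the ball does not meet its first [P - 1]
images: there the perturbed map follows [F] until the return, and its [P]-th
iterate reads as [h \o phi] in the chart. The distances in the chart are
distorted by the factor [lam], for which the constant [1 / lam] in
[local_horseshoes] compensates. *)
Lemma periodic_horseshoes (F : X -> X) p P e : (2 <= n)%N -> small_charts ->
  continuous F -> injective F -> (0 < P)%N -> iter P F p = p ->
  (forall i, (0 < i < P)%N -> iter i F p <> p) -> 0 < e ->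
  exists h, [/\ continuous h, bijective h, forall x, mdist x (h x) < e &
    ((n%:R / P%:R)%:E <= upper_mdim (h \o F))%E].
Proof.
move=> n2 charts Fc FI P0 perP minP e0.
have e20 : 0 < e / 2 by rewrite divr_gt0.
have [rho [lam0 [Lam [iota [kappa [B iota0 small]]]]]] := charts p _ e20.
have rho0 := bilip_rho B.
have itc k v : `|v| < rho -> {for v, continuous (iter k F \o iota)}.
  move=> vr; apply: continuous_comp; first exact: bilip_iota_continuous B vr.
  exact: iter_continuous.
have itI k : injective (iter k F) by elim: k => // k IH x y /= /FI /IH.
have zr : `|0 : V| < rho by rewrite normr0.
have [r1 r10 r1P] : exists2 r, 0 < r & forall v, `|v| < r ->
    chart_image iota rho (iter P F (iota v)).
  have : nbhs (0 : V) ((iter P F \o iota) @^-1` chart_image iota rho).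
    apply: (itc P _ zr); apply: open_nbhs_nbhs; split.
      exact: (bilip_open B).
    by exists 0 => //=; rewrite iota0 perP.
  move=> /nbhs_ballP[d /= d0 dP]; exists d => // v vd; apply: dP.
  by rewrite -ball_normE /= sub0r normrN.
have /choice[f fP] (i : 'I_P) : exists r, 0 < r /\ ((0 < i)%N ->
    forall v w, `|v| < r -> `|w| < r -> iter i F (iota v) <> iota w).
  have [->|i0] := posnP i; first by exists 1.
  pose d := mdist p (iter i F p).
  have d0 : 0 < d.
    rewrite lt_neqAle mdist_ge0 andbT eq_sym; apply/eqP => /mdist_positivity h.
    by apply: (minP i); rewrite ?i0 //= -h.
  have : nbhs (0 : V) ((iter i F \o iota) @^-1` ball (iter i F p) (d / 2)).
    apply: (itc i _ zr); rewrite /= iota0; apply: nbhsx_ballx.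
    by rewrite divr_gt0.
  move=> /nbhs_ballP[r /= r0 rP].
  have L0 := bilip_Lam B.
  exists (Num.min r (Num.min rho (d / 2 / Lam))); split.
    by rewrite !lt_min r0 rho0 !divr_gt0.
  move=> _ v w; rewrite !lt_min => /andP[vr _] /and3P[_ wr wL] E.
  have h1 : mdist (iter i F p) (iter i F (iota v)) < d / 2.
    have := rP v; rewrite -ball_normE /= sub0r normrN => /(_ vr).
    by rewrite ballEmdist.
  have h2 : mdist p (iota w) < d / 2.
    rewrite -iota0; apply: le_lt_trans (bilip_le B zr wr) _.
    by rewrite sub0r normrN mulrC -ltr_pdivlMr.
  have := metric_triangle p (iota w) (iter i F p).
  by rewrite -/d; rewrite E (metric_sym _ (iota w)) in h1; lra.
have [r2 r20 r2P] := finite_pos_bound (fun i => (fP i).1).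
pose r := Num.min (rho / 2) (Num.min r1 r2).
have r0 : 0 < r by rewrite !lt_min r10 r20 divr_gt0.
have rrho : r < rho.
  by apply: le_lt_trans (_ : rho / 2 < rho); [rewrite ge_min lexx|lra].
have rr1 : r <= r1 by rewrite !ge_min lexx orbT.
have rr2 : r <= r2 by rewrite !ge_min lexx !orbT.
pose phi v := kappa (iter P F (iota v)).
have phiE v : `|v| < r -> `|phi v| < rho /\ iota (phi v) = iter P F (iota v).
  move=> vr; have [w wr wE] := r1P _ (lt_le_trans vr rr1).
  by rewrite /phi -wE (bilip_K B wr).
(* a constant at most 1, so that the scales do not increase when passing to
   distances of [X] *)
pose lam := Num.min lam0 1.
have lam_gt0 : 0 < lam by rewrite lt_min (bilip_lam B) ltr01.
have lam1 : lam <= 1 by rewrite ge_min lexx orbT.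
have ge v w : `|v| < rho -> `|w| < rho -> lam * `|v - w| <= mdist (iota v) (iota w).
  move=> vr wr; apply: le_trans (bilip_ge B vr wr); apply: ler_wpM2r => //.
  by rewrite ge_min lexx.
have [|||||h hh hs] := @local_horseshoes R n phi r (1 / lam) n2.
- move=> v vr; have vrho := lt_trans vr rrho.
  apply: (@continuous_comp _ _ _ (iter P F \o iota) kappa); first exact: itc.
  have [wr wE] := phiE v vr; rewrite /= -wE.
  exact: bilip_kappa_continuous B wr.
- move=> v w vr wr E; have [_ vE] := phiE v vr; have [_ wE] := phiE w wr.
  have : iota v = iota w by apply: (itI P); rewrite -vE -wE E.
  by move=> /(congr1 kappa); rewrite !(bilip_K B) //; exact: lt_trans rrho.
- by rewrite /phi iota0 perP -iota0 (bilip_K B zr).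
- exact: r0.
- by rewrite divr_gt0.
have Hh := chart_lift_homeo B rrho hh.
have [Hc Hb Hf] := Hh.
exists (chart_lift rho iota kappa h); split => //.
  move=> x; rewrite [e]splitr; apply: supported_homeo_close Hh _ e20 x.
  by move=> _ [v /= vr <-]; apply: small; exact: lt_trans rrho.
set G := _ \o F.
have hr v : `|v| < rho -> `|h v| < rho.
  have sub : [set v : V | `|v| < r] `<=` [set v | `|v| < rho].
    by move=> w /= ws; exact: lt_trans ws rrho.
  exact: supported_homeo_stable (supported_homeo_sub sub hh).
have Giter v i : `|v| < r -> (i < P)%N -> iter i G (iota v) = iter i F (iota v).
  move=> vr; elim: i => // i IH iP; rewrite !iterS IH ?(ltnW iP) // /G /= Hf //.
  case=> w /= wr wE; have := (fP (Ordinal iP)).2 isT v w.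
  have r2f := le_trans rr2 (r2P (Ordinal iP)).
  move=> /(_ (lt_le_trans vr r2f) (lt_le_trans wr r2f)); apply; exact: esym wE.
have GP v : `|v| < r -> iter P G (iota v) = iota (h (phi v)).
  move=> vr; have [wr wE] := phiE v vr.
  rewrite -{1}(prednK P0) iterS Giter ?prednK // /G /= -iterS prednK // -wE.
  exact: (chart_lift_iota B h wr).
apply: upper_mdim_ge => // j.
have [m [eps [Q [/andP[eps0 epsj] mj Qr [Qsep Qit]]]]] := hs j.
exists m, (lam * eps), [ffun i => iota @` Q i]; split.
- rewrite mulr_gt0 //=; apply: le_lt_trans epsj.
  by rewrite ger_pMl.
- by apply: le_trans mj; rewrite invfM mulrA.
- split.
    move=> i i' x y ii'; rewrite !ffunE => -[v Qv <-] [w Qw <-].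
    apply: lt_le_trans (_ : lam * `|v - w| <= _).
      by rewrite ltr_pM2l //; exact: Qsep ii' Qv Qw.
    by apply: ge; apply: lt_trans rrho; [exact: Qr Qv|exact: Qr Qw].
  move=> a; have [v vP] := Qit a; exists (iota v) => k; rewrite ffunE.
  exists (iter k (h \o phi) v); first exact: vP.
  elim: k => // k IH; rewrite !iterS -IH GP //; exact: Qr (vP k).
Qed.

(** The pigeonhole principle along an orbit gives a return to some set of the
cover; the first one is taken. *)
Lemma orbit_return (F : X -> X) (x0 : X) (s : seq X) (U : X -> set X) :
  (forall x, exists2 q, q \in s & U q x) ->
  exists p q P, [/\ (0 < P)%N, U q p, U q (iter P F p) &
    forall i, (0 < i < P)%N -> ~ U q (iter i F p)].
Proof.
move=> cov; have /choice[c cP] (k : nat) : exists q : seq_sub s, U (val q) (iter k F x0).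
  by have [q qs Uq] := cov (iter k F x0); exists (SeqSub qs).
have [a [b [ab cab]]] : exists a b : nat, (a < b)%N /\ c a = c b.
  have /injectivePn[a [b nab cab]] :
      ~~ injectiveb (fun i : 'I_(#|{: seq_sub s}|.+1) => c i).
    apply/negP => /injectiveP /leq_card; rewrite card_ord.
    by rewrite ltnn.
  wlog ab : a b nab cab / (a < b)%N.
    have [h|h|/val_inj h] := ltngtP a b; first by move=> H; exact: (H a b).
      by move=> H; apply: (H b a) => //; rewrite eq_sym.
    by rewrite h eqxx in nab.
  by exists a, b.
pose q := val (c a); pose p := iter a F x0.
have ex : exists P, (0 < P)%N && `[< U q (iter P F p) >].
  exists (b - a)%N; rewrite subn_gt0 ab /=; apply/asboolP.
  by rewrite /p -iterD subnK ?(ltnW ab) // /q cab.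
have [P /andP[P0 /asboolP UP] Pmin] := ex_minnP ex.
exists p, q, P; split => //; first exact: cP.
move=> i /andP[i0 iP] Ui; move: iP; rewrite ltnNge Pmin // i0; exact/asboolP.
Qed.

(** The push that brings the first return back to the starting point is
supported in the ball that the orbit left in the meantime, so that the orbit is
unchanged until its return. *)
Lemma closing_orbit (F : X -> X) (x0 : X) e : compact [set: X] -> small_charts ->
  0 < e ->
  exists h p P, [/\ continuous h, bijective h, forall x, mdist x (h x) < e,
    (0 < P)%N & iter P (h \o F) p = p /\
      forall i, (0 < i < P)%N -> iter i (h \o F) p <> p].
Proof.
move=> Xc charts e0; have e20 : 0 < e / 2 by rewrite divr_gt0.
have /choice[ch chP] (q : X) : exists c : (R * R * R) * (V -> X) * (X -> V),
    [/\ bilip_chart c.1.1.1.1 c.1.1.1.2 c.1.1.2 c.1.2 c.2, c.1.2 0 = q &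
      forall v, `|v| < c.1.1.1.1 -> mdist q (c.1.2 v) < e / 2].
  by have [rho [l [L [io [k H]]]]] := charts q _ e20; exists (rho, l, L, io, k).
pose U q := chart_image (ch q).1.2 ((ch q).1.1.1.1 / 2).
have [|s sP] := @finite_subcover X U Xc.
  move=> q; have [B c0 _] := chP q; have r0 := bilip_rho B.
  apply: open_nbhs_nbhs; split; first by apply: (bilip_open B); lra.
  by exists 0 => //=; rewrite normr0 divr_gt0.
have [p [q [P [P0 Up UP Umin]]]] := orbit_return F x0 sP.
have [B c0 small] := chP q; have r0 := bilip_rho B.
have r20 : 0 < (ch q).1.1.1.1 / 2 by rewrite divr_gt0.
have [v vr vp] := Up; have [w wr wp] := UP.
have [||h hh hwv] := @point_move R n (fun c => 0 - (ch q).1.1.1.1 / 2)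
    (fun c => 0 + (ch q).1.1.1.1 / 2) w v.
- move: wr; rewrite /= -[X in Num.norm X]subr0 => /(obox_ball _ _ r20) h c.
  by have := h c; rewrite mxE.
- move: vr; rewrite /= -[X in Num.norm X]subr0 => /(obox_ball _ _ r20) h c.
  by have := h c; rewrite mxE.
have {}hh : supported_homeo [set v : V | `|v| < (ch q).1.1.1.1 / 2] h.
  apply: supported_homeo_sub hh => u /= uP; rewrite -[u]subr0; apply/(obox_ball _ _ r20) => c.
  by have := uP c; rewrite mxE.
have sr : (ch q).1.1.1.1 / 2 < (ch q).1.1.1.1 by lra.
have Hh := chart_lift_homeo B sr hh; have [Hc Hb Hf] := Hh.
set H := chart_lift _ _ _ _ in Hh Hc Hb Hf.
have itE i : (i < P)%N -> iter i (H \o F) p = iter i F p.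
  elim: i => // i IH iP; rewrite !iterS IH ?(ltnW iP) //= Hf //; exact: (Umin i.+1).
exists H, p, P; split => //.
  move=> x; rewrite [e]splitr; apply: supported_homeo_close Hh _ e20 x.
  by move=> _ [u /= ur <-]; apply: small; exact: lt_trans sr.
split.
  rewrite -{1}(prednK P0) iterS itE ?prednK //= -iterS prednK // -wp.
  by rewrite /H (chart_lift_iota B) ?hwv //; exact: lt_trans wr sr.
move=> i /andP[i0 iP]; rewrite itE // => ip.
by apply: (Umin i); rewrite ?i0 // ip.
Qed.

Lemma closure_uniform (F : X -> X) (A : set {uniform X -> X}) :
  (forall e, 0 < e -> exists2 G : X -> X, A G & forall x, mdist (F x) (G x) < e) ->
  closure A F.
Proof.
move=> app N /uniform_nbhs[E [+ EN]]; rewrite -entourage_ballE => -[e /= e0 eE].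
have [G AG FG] := app e e0; exists G; split => //; apply: EN => x _.
by apply: eE => /=; rewrite ballEmdist /=; exact: FG.
Qed.

End PeriodicPoint.

(** * Density *)

Theorem proposition10 (R : realType) (n : nat) (X : metricType R)
    (g : riemannian_structure R n X)
    (dim_ge2 : (2 <= n)%N)
    (X_nonempty : [set: X] !=set0)
    (X_compact : compact [set: X])
    (d_induced : is_induced_metric g) :
  let H : set {uniform X -> X} := [set F | homeomorphism (F : X -> X)] in
  let A : set {uniform X -> X} :=
    [set F | H F /\ upper_mdim (F : X -> X) = n%:R%:E] in
  let B : set {uniform X -> X} :=
    [set F | H F /\ (0 < upper_mdim (F : X -> X))%E] in
  [set F | H F /\ exists p : X, F p = p] `<=` closure A /\
  H `<=` closure B.
Proof.
move=> H A B; have n0 : (0 < n)%N by exact: ltn_trans dim_ge2.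
have charts : @small_charts R n X.
  by move=> p e e0; have := riemannian_bilip p n0 d_induced e0.
have [x0 _] := X_nonempty.
have HbijP (F : X -> X) : homeomorphism F -> continuous F /\ bijective F.
  by move=> [Fc [F' [_ FK F'K]]]; split => //; exists F'.
have homeo_comp (F h : X -> X) : homeomorphism F -> continuous h -> bijective h ->
    homeomorphism (h \o F).
  move=> /HbijP[Fc Fb] hc hb; apply: compact_homeomorphism => //.
    by move=> x; apply: continuous_comp; [exact: Fc|exact: hc].
  exact: bij_comp.
split=> [F [HF [p Fp]]|F HF]; apply: closure_uniform => e e0;
    have [Fc Fb] := HbijP _ HF.
  have [|h [hc hb he hd]] := periodic_horseshoes (P := 1) dim_ge2 charts Fc
    (bij_inj Fb) isT Fp _ e0; first by case=> [|[]].
  exists (h \o F) => [|x]; last exact: he.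
  split; first exact: homeo_comp.
  have [|C cov] := @covering_bound R n X X_compact.
    move=> q; have [rho [l [L [io [k [cB c0 _]]]]]] := charts q 1 ltr01.
    by exists rho, l, L, io, k.
  apply/eqP; rewrite eq_le (upper_mdim_le (h \o F) x0 cov) /=.
  by move: hd; rewrite divr1.
have e20 : 0 < e / 2 by rewrite divr_gt0.
have [h0 [p [P [h0c h0b h0e P0 [perP minP]]]]] := closing_orbit F x0 X_compact charts e20.
have [F0c F0b] := HbijP _ (homeo_comp _ _ HF h0c h0b).
have [h [hc hb he hd]] := periodic_horseshoes dim_ge2 charts F0c (bij_inj F0b) P0
  perP minP e20.
exists (h \o (h0 \o F)) => [|x].
  split; first by apply: (homeo_comp) => //; exact: (homeo_comp).
  by apply: lt_le_trans hd; rewrite lte_fin divr_gt0 // ltr0n.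
apply: le_lt_trans (metric_triangle (F x) (h0 (F x)) _) _.
by rewrite [e]splitr; apply: ltrD.
Qed.
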